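(* Let $(X,\Sigma,\mathfrak m)$ be a complete, $\sigma$-finite measure space. Let $\mathbb B$ be a universal separable Banach space. Then the section functor $$\Gamma\colon\mathbf{SBB}_{\mathbb B}(X,\Sigma,\mathfrak m)\longrightarrow\mathbf{NMod}_{\rm cg}(X,\Sigma,\mathfrak m)$$ is an equivalence of categories. In particular, if $(X,\Sigma,\mathfrak m)$ is a separable measure space, then $$\Gamma\colon\mathbf{SBB}_{\mathbb B}(X,\Sigma,\mathfrak m)\longrightarrow\mathbf{NMod}_{\rm s}(X,\Sigma,\mathfrak m)$$ is an equivalence of categories.
   Context: Measurable spaces $(X,\Sigma)$ are assumed to satisfy $\{x\}\in\Sigma$ for every $x\in X$. Banach spaces are real. $L^0(\mathfrak m)$: the ring of $\mathfrak m$-a.e. equivalence classes of measurable functions $X\to\mathbb R$, with the distance $d_{L^0(\mathfrak m)}(f,g)=\int\min\{|f-g|,1\}\,d\mathfrak m'$, where $\mathfrak m'$ is a fixed probability measure with $\mathfrak m\ll\mathfrak m'\ll\mathfrak m$ (the induced topology does not depend on $\mathfrak m'$). Normed $L^0(\mathfrak m)$-module: a couple $(\mathscr M,|\cdot|)$ where $\mathscr M$ is an algebraic $L^0(\mathfrak m)$-module, the pointwise norm $|\cdot|\colon\mathscr M\to L^0(\mathfrak m)$ satisfies, $\mathfrak m$-a.e., $|v|\ge0$ with equality iff $v=0$, $|v+w|\le|v|+|w|$, $|f\cdot v|=|f||v|$ for all $f\in L^0(\mathfrak m)$, $v,w\in\mathscr M$, and the distance $d_{\mathscr M}(v,w):=d_{L^0(\mathfrak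 m)}(|v-w|,0)$ is complete. A morphism $\Phi\colon\mathscr M\to\mathscr N$ is an $L^0(\mathfrak m)$-linear map with $|\Phi(v)|\le|v|$ $\mathfrak m$-a.e. for all $v$. $\mathscr M$ is countably-generated if there is a countable set $\mathcal C\subseteq\mathscr M$ such that the smallest algebraic $L^0(\mathfrak m)$-submodule containing $\mathcal C$ is $d_{\mathscr M}$-dense; it is separable if $(\mathscr M,d_{\mathscr M})$ is a separable metric space. $\mathbf{NMod}_{\rm cg}(X,\Sigma,\mathfrak m)$ and $\mathbf{NMod}_{\rm s}(X,\Sigma,\mathfrak m)$ are the categories of countably-generated, respectively separable, normed $L^0(\mathfrak m)$-modules with these morphisms. $(X,\Sigma,\mathfrak m)$ is a separable measure space if, for some finite measure $\mathfrak m'$ on $(X,\Sigma)$ with $\mathfrak m\ll\mathfrak m'\ll\mathfrak m$, the quotient of $\Sigma$ by the relation $\mathfrak m(A\Delta B)=0$ is separable for the distance $\mathfrak m'(A\Delta B)$. Universal separable Banach space: a separable Banach space $\mathbb B$ into which every separable Banach space embeds linearly and isometrically. $\mathrm{Gr}(\mathbb B)$ is the family of closed linear subspaces of $\mathbb B$. A separable Banach $\mathbb B$-bundle over $X$ is a map $\mathbf E\colon X\to\mathrm{Gr}(\mathbb B)$ such that $\{x\in X:\mathbf E(x)\cap U\ne\emptyset\}\in\Sigma$ for every open $U\subseteq\mathbb B$. Set $\mathrm T\mathbf E:=\bigcup_{x\in X}\{x\}\times\mathbf E(x)\in\Sigma\otimes\mathscr B(\mathbb B)$, where $\mathscr B(\mathbb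 B)$ is the Borel $\sigma$-algebra. A pre-morphism from $\mathbf E$ to $\mathbf F$ is a measurable map $\bar\varphi\colon\mathrm T\mathbf E\to\mathrm T\mathbf F$ with $\bar\varphi(\{x\}\times\mathbf E(x))\subseteq\{x\}\times\mathbf F(x)\cong\mathbf F(x)$ and such that $\bar\varphi(x,\cdot)\colon\mathbf E(x)\to\mathbf F(x)$ is a linear contraction (norm $\le1$) for every $x\in X$. Two pre-morphisms are equivalent if they agree on the fibers over every $x\in X\setminus N$ for some $N\in\Sigma$ with $\mathfrak m(N)=0$; morphisms $\varphi\colon\mathbf E\to\mathbf F$ are equivalence classes. $\mathbf{SBB}_{\mathbb B}(X,\Sigma,\mathfrak m)$ is the category of separable Banach $\mathbb B$-bundles over $X$ with these morphisms. A section of $\mathbf E$ is a measurable map $\bar s\colon X\to\mathbb B$ with $\bar s(x)\in\mathbf E(x)$ for all $x$. $\Gamma(\mathbf E)$ is the space of sections modulo $\mathfrak m$-a.e. equality, with the natural pointwise operations and pointwise norm $|s|(x)=\|s(x)\|_{\mathbb B}$; it is a countably-generated normed $L^0(\mathfrak m)$-module. For a morphism $\varphi\colon\mathbf E\to\mathbf F$ with representative $\bar\varphi$, $\Gamma(\varphi)\colon\Gamma(\mathbf E)\to\Gamma(\mathbf F)$ sends the class of $\bar s$ to the class of $x\mapsto\bar\varphi(x,\bar s(x))\in\mathbf F(x)$. This defines the (covariant) section functor $\Gamma$. *)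

(* Defs.v *)
From HB Require Import structures.
From mathcomp Require Import all_boot all_order all_algebra.
From mathcomp Require Import generic_quotient.
From mathcomp Require Import all_classical all_reals all_analysis.
From mathcomp Require Import measurable_realfun.

Set Implicit Arguments.
Unset Strict Implicit.
Unset Printing Implicit Defensive.

Import Order.TTheory GRing.Theory Num.Theory.
Import numFieldNormedType.Exports.

Local Open Scope classical_set_scope.
Local Open Scope ring_scope.
Local Open Scope quotient_scope.

Record category := Category {
  obj :> Type;
  hom : obj -> obj -> Type;
  idm : forall a, hom a a;
  compm : forall a b c, hom b c -> hom a b -> hom a c;
  compm1 : forall a b (f : hom a b), compm f (idm a) = f;
  comp1m : forall a b (f : hom a b), compm (idm b) f = f;
  compmA : forall a b c d (f : hom a b) (g : hom b c) (h : hom c d),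
    compm h (compm g f) = compm (compm h g) f }.
Arguments hom {c0} a b : rename.
Arguments idm {c0} a : rename.
Arguments compm {c0 a b c} g f : rename.

Record functor (C D : category) := Functor {
  fobj :> C -> D;
  fmap : forall a b, hom a b -> hom (fobj a) (fobj b);
  fmap1 : forall a, fmap (idm a) = idm (fobj a);
  fmapM : forall a b c (g : hom b c) (f : hom a b),
    fmap (compm g f) = compm (fmap g) (fmap f) }.
Arguments fmap {C D} F {a b} f : rename.

Definition id_functor (C : category) : functor C C :=
  @Functor C C id (fun _ _ f => f) (fun _ => erefl) (fun _ _ _ _ _ => erefl).

Section CompFunctor.
Variables (C D E : category) (G : functor D E) (F : functor C D).

Lemma comp_fmap1 (a : C) : fmap G (fmap F (idm a)) = idm (G (F a)).
Proof. by rewrite !fmap1. Qed.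

Lemma comp_fmapM (a b c : C) (g : hom b c) (f : hom a b) :
  fmap G (fmap F (compm g f)) =
  compm (fmap G (fmap F g)) (fmap G (fmap F f)).
Proof. by rewrite !fmapM. Qed.

Definition comp_functor : functor C E :=
  @Functor C E (fun a => G (F a)) (fun _ _ f => fmap G (fmap F f))
    comp_fmap1 comp_fmapM.
End CompFunctor.

Definition isomorphism (C : category) (a b : C) (f : hom a b) :=
  exists g : hom b a, compm g f = idm a /\ compm f g = idm b.

Definition naturally_isomorphic (C D : category) (F G : functor C D) :=
  exists eta : forall a : C, hom (F a) (G a),
    (forall (a b : C) (f : hom a b),
        compm (eta b) (fmap F f) = compm (fmap G f) (eta a)) /\
    (forall a, isomorphism (eta a)).

Definition equivalence_of_categories (C D : category) (F : functor C D) :=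
  exists G : functor D C,
    naturally_isomorphic (comp_functor G F) (id_functor C) /\
    naturally_isomorphic (comp_functor F G) (id_functor D).

Section FullSubcategory.
Variables (D : category) (P : D -> Prop).

Definition full_subcategory : category :=
  @Category {a : D | P a} (fun a b => hom (projT1 a) (projT1 b))
    (fun a => idm (projT1 a)) (fun _ _ _ g f => compm g f)
    (fun _ _ f => compm1 f) (fun _ _ f => comp1m f)
    (fun _ _ _ _ f g h => compmA f g h).

Definition corestrict (C : category) (F : functor C D)
    (FP : forall a, P (F a)) : functor C full_subcategory :=
  @Functor C full_subcategory (fun a => exist P (F a) (FP a))
    (fun _ _ f => fmap F f) (fmap1 F) (fun _ _ _ g f => fmapM F g f).
End FullSubcategory.

Section Distance.
Context {R : realType} {T : Type} (dist : T -> T -> R).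

Definition dist_cauchy (u : nat -> T) :=
  forall e : R, 0 < e -> exists N : nat,
    forall m n, (N <= m)%N -> (N <= n)%N -> dist (u m) (u n) < e.

Definition dist_complete :=
  forall u : nat -> T, dist_cauchy u ->
    exists l, (fun n => dist (u n) l) @ \oo --> (0 : R).

Definition dist_dense (A : set T) :=
  forall x (e : R), 0 < e -> exists2 y, A y & dist x y < e.

Definition dist_separable := exists2 A : set T, countable A & dist_dense A.
End Distance.

Definition separable_space (T : topologicalType) :=
  exists2 A : set T, countable A & dense A.

Record separableBanach (R : realType) := SeparableBanach {
  sb_sort :> completeNormedModType R;
  sb_separable : separable_space sb_sort }.

Definition universal_separable_Banach (R : realType) (B : separableBanach R) :=
  forall V : separableBanach R,
    exists f : {linear V -> B}, forall v, `|f v| = `|v|.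

Definition borel (R : realType) (B : separableBanach R) : measurableType _ :=
  g_sigma_algebraType (@open B).

Section SeparableMeasurability.
Context {R : realType}.

Lemma separable_seq (B : separableBanach R) :
  exists u : nat -> B, forall x (e : R), 0 < e -> exists n, ball x e (u n).
Proof.
have [A cA dA] := sb_separable B.
have neA : A !=set0.
  by have [|x [_ Ax]] := dA setT _ openT; [exists 0|exists x].
have [A0|[g]] := pfcard_geP cA.
  by case: neA => x; rewrite A0.
exists g => x e e0.
have [||y [bxy Ay]] := dA (ball x e)^°.
- by exists x; exact: nbhsx_ballx.
- exact: open_interior.
have [n _ gn] := @surj _ _ _ _ g y Ay.
by exists n; rewrite gn; exact: interior_subset bxy.
Qed.

Section Comp2.
Context {d : measure_display} {X : measurableType d}.
Context {U V W : normedModType R} (u : nat -> U) (v : nat -> V).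
Hypothesis du : forall x (e : R), 0 < e -> exists n, ball x e (u n).
Hypothesis dv : forall x (e : R), 0 < e -> exists n, ball x e (v n).

Lemma measurable_open_comp2 (f : X -> U) (g : X -> V) (h : U * V -> W) :
  (forall O, open O -> measurable (f @^-1` O)) ->
  (forall O, open O -> measurable (g @^-1` O)) ->
  continuous h ->
  forall O, open O -> measurable ((fun x => h (f x, g x)) @^-1` O).
Proof.
move=> mf mg ch O oO.
pose r (k : nat) : R := k.+1%:R^-1.
pose F (i : nat * nat * nat) : set X :=
  [set x | ball (u i.1.1) (r i.2) `*` ball (v i.1.2) (r i.2) `<=` h @^-1` O
           /\ ball (u i.1.1) (r i.2) (f x) /\ ball (v i.1.2) (r i.2) (g x)].
have -> : (fun x => h (f x, g x)) @^-1` O = \bigcup_i F i.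
  apply/seteqP; split => x /=; last first.
    by move=> [i _ [hi [fi gi]]]; exact: (hi (f x, g x)).
  move=> Ox.
  have /nbhs_ballP[e /= e0 He] : nbhs (f x, g x) (h @^-1` O).
    by apply: ch; exact: open_nbhs_nbhs.
  have [k rk] : exists k, r k + r k < e.
    have e20 : 0 < e / 2 by rewrite divr_gt0.
    have := near_infty_natSinv_lt (PosNum e20) => -[N _ /(_ N (leqnn N)) /= hN].
    by exists N; rewrite [e]splitr ltrD.
  have r0 : 0 < r k by rewrite invr_gt0.
  have [m hm] := du (f x) r0.
  have [n hn] := dv (g x) r0.
  exists (m, n, k) => //; split=> /=; last by (split; exact: ball_sym).
  move=> [a b] [/= ha hb]; apply: He; split => /=.
    by apply: (le_ball (ltW rk)); exact: (ball_triangle hm ha).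
  by apply: (le_ball (ltW rk)); exact: (ball_triangle hn hb).
apply: countable_bigcupT_measurable; first exact: countableP.
move=> i; have [H|H] := pselect
  (ball (u i.1.1) (r i.2) `*` ball (v i.1.2) (r i.2) `<=` h @^-1` O); last first.
  rewrite (_ : F i = set0); first exact: measurable0.
  by apply/seteqP; split => x // [].
rewrite (_ : F i = f @^-1` ball (u i.1.1) (r i.2) `&`
                   g @^-1` ball (v i.1.2) (r i.2)).
  by apply: measurableI; [apply: mf|apply: mg]; apply: ball_open; rewrite invr_gt0.
by apply/seteqP; split => x /=; [case|].
Qed.
End Comp2.

Context {d : measure_display} {X : measurableType d}.

Lemma borel_measurableP (B : separableBanach R) (f : X -> B) :
  measurable_fun setT (f : X -> borel B) <->
  (forall O : set B, open O -> measurable (f @^-1` O)).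
Proof.
split=> [mf O oO|H].
  by rewrite -[_ @^-1` _]setTI; apply: mf => //; exact: sub_sigma_algebra.
apply: (@measurability _ _ X (borel B) setT f (@open B)) => //.
move=> _ [U oU <-].
by rewrite setTI; exact: H.
Qed.

Lemma real_measurableP (f : X -> R) :
  measurable_fun setT f <-> (forall O : set R, open O -> measurable (f @^-1` O)).
Proof.
split=> [mf O oO|H].
  by rewrite -[_ @^-1` _]setTI; apply: mf => //; exact: open_measurable.
apply: (measurability _ (RGenOpens.measurableE R)).
move=> _ [_ [a [b ->] <-]]; rewrite setTI; apply: H; exact: interval_open.
Qed.

Lemma real_seq :
  exists u : nat -> R, forall x (e : R), 0 < e -> exists n, ball x e (u n).
Proof.
exists (fun n => ratr (odflt 0%Q (unpickle n))) => x e e0.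
have [||y [bxy [q _ qy]]] := @dense_rat R (ball x e).
- by exists x; exact: ballxx.
- exact: ball_open.
by exists (pickle q); rewrite pickleK /= qy.
Qed.

Lemma borel_measurableD (B : separableBanach R) (f g : X -> B) :
  measurable_fun setT (f : X -> borel B) ->
  measurable_fun setT (g : X -> borel B) ->
  measurable_fun setT ((fun x => f x + g x) : X -> borel B).
Proof.
move=> /borel_measurableP mf /borel_measurableP mg; apply/borel_measurableP.
have [u du] := separable_seq B.
apply: (measurable_open_comp2 du du mf mg (h := fun z => z.1 + z.2)).
exact: add_continuous.
Qed.

Lemma borel_measurableZ (B : separableBanach R) (a : X -> R) (f : X -> B) :
  measurable_fun setT a ->
  measurable_fun setT (f : X -> borel B) ->
  measurable_fun setT ((fun x => a x *: f x) : X -> borel B).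
Proof.
move=> /real_measurableP ma /borel_measurableP mf; apply/borel_measurableP.
have [u du] := separable_seq B.
have [v dv] := real_seq.
apply: (measurable_open_comp2 dv du ma mf (h := fun z => z.1 *: z.2)).
exact: scale_continuous.
Qed.

Lemma borel_measurable_norm (B : separableBanach R) (f : X -> B) :
  measurable_fun setT (f : X -> borel B) ->
  measurable_fun setT (fun x => `|f x|).
Proof.
move=> /borel_measurableP mf; apply/real_measurableP => O oO.
apply: (mf ((fun v : B => `|v|) @^-1` O)).
by apply: open_comp => // v _; exact: norm_continuous.
Qed.
End SeparableMeasurability.

Section MkMfun.
Context {d1 d2 : measure_display}.
Context {X : measurableType d1} {Y : measurableType d2} (f : X -> Y).
Hypothesis mf : measurable_fun setT f.

#[local] HB.instance Definition _ := isMeasurableFun.Build d1 d2 X Y f mf.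

Definition mk_mfun : {mfun X >-> Y} := f.
End MkMfun.

Section L0.
Context {R : realType} {d : measure_display} {X : measurableType d}.
Variable mu : {measure set X -> \bar R}.

Definition L0 : Type := {mfun_ mu, X >-> R}.
HB.instance Definition _ := Choice.on L0.
HB.instance Definition _ := EqQuotient.on L0.

Definition L0_fun (f : L0) : X -> R := (repr f : {mfun X >-> R}).
Coercion L0_fun : L0 >-> Funclass.

Implicit Types f g h : {mfun X >-> R}.

Lemma L0_piP f g : (\pi_L0 f = \pi_L0 g) <-> (f = g %[ae mu]).
Proof.
by split=> [/eqmodP/asboolP|H]; [exact|apply/eqmodP/asboolP].
Qed.

Lemma L0_reprK f : (repr (\pi_L0 f) : {mfun X >-> R}) = f %[ae mu].
Proof. by apply/L0_piP; rewrite reprK. Qed.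

Definition L0_add (a b : L0) : L0 := \pi_L0 (repr a + repr b).
Definition L0_opp (a : L0) : L0 := \pi_L0 (- repr a).
Definition L0_mul (a b : L0) : L0 := \pi_L0 (repr a * repr b).

Lemma L0_addE f g : L0_add (\pi_L0 f) (\pi_L0 g) = \pi_L0 (f + g).
Proof.
apply/L0_piP; have := L0_reprK f; have := L0_reprK g.
by apply: filterS2 => x Hg Hf _; rewrite !mfunD /= Hf// Hg.
Qed.

Lemma L0_oppE f : L0_opp (\pi_L0 f) = \pi_L0 (- f).
Proof.
apply/L0_piP; have := L0_reprK f.
by apply: filterS => x Hf _; rewrite !mfunN /= Hf.
Qed.

Lemma L0_mulE f g : L0_mul (\pi_L0 f) (\pi_L0 g) = \pi_L0 (f * g).
Proof.
apply/L0_piP; have := L0_reprK f; have := L0_reprK g.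
by apply: filterS2 => x Hg Hf _; rewrite !mfunM /= Hf// Hg.
Qed.

Lemma L0_addA : associative L0_add.
Proof.
move=> a b c; elim/quotW: a => f; elim/quotW: b => g; elim/quotW: c => h.
by rewrite (L0_addE f g) (L0_addE g h) (L0_addE (f + g)) (L0_addE f) addrA.
Qed.

Lemma L0_addC : commutative L0_add.
Proof.
move=> a b; elim/quotW: a => f; elim/quotW: b => g.
by rewrite (L0_addE f) (L0_addE g) addrC.
Qed.

Lemma L0_add0 : left_id (\pi_L0 0) L0_add.
Proof. by move=> a; elim/quotW: a => f; rewrite (L0_addE 0 f) add0r. Qed.

Lemma L0_addN : left_inverse (\pi_L0 0) L0_opp L0_add.
Proof. by move=> a; elim/quotW: a => f; rewrite (L0_oppE f) (L0_addE (- f)) addNr. Qed.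

HB.instance Definition _ :=
  GRing.isZmodule.Build L0 L0_addA L0_addC L0_add0 L0_addN.

Lemma L0_mulA : associative L0_mul.
Proof.
move=> a b c; elim/quotW: a => f; elim/quotW: b => g; elim/quotW: c => h.
by rewrite (L0_mulE f g) (L0_mulE g h) (L0_mulE (f * g)) (L0_mulE f) mulrA.
Qed.

Lemma L0_mulC : commutative L0_mul.
Proof.
move=> a b; elim/quotW: a => f; elim/quotW: b => g.
by rewrite (L0_mulE f) (L0_mulE g) mulrC.
Qed.

Lemma L0_mul1 : left_id (\pi_L0 1) L0_mul.
Proof. by move=> a; elim/quotW: a => f; rewrite (L0_mulE 1 f) mul1r. Qed.

Lemma L0_mulD : left_distributive L0_mul +%R.
Proof.
move=> a b c; elim/quotW: a => f; elim/quotW: b => g; elim/quotW: c => h.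
have DE (u v : {mfun X >-> R}) : \pi_L0 u + \pi_L0 v = \pi_L0 (u + v).
  exact: L0_addE.
by rewrite (DE f g) (L0_mulE f) (L0_mulE g) (L0_mulE (f + g)) DE mulrDl.
Qed.

HB.instance Definition _ :=
  GRing.Zmodule_isComPzRing.Build L0 L0_mulA L0_mulC L0_mul1 L0_mulD.

Lemma mfun_norm_subproof f : measurable_fun setT (fun x => `|f x|).
Proof. by apply: measurableT_comp => //; exact: normr_measurable. Qed.

Definition mfun_norm f : {mfun X >-> R} := mk_mfun (mfun_norm_subproof f).

Definition L0_abs (a : L0) : L0 := \pi_L0 (mfun_norm (repr a)).

Definition L0_le (a b : L0) : Prop := {ae mu, forall x, a x <= b x}.

Lemma L0_absE f : L0_abs (\pi_L0 f) = \pi_L0 (mfun_norm f).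
Proof.
apply/L0_piP; have := L0_reprK f.
by apply: filterS => x Hf _ /=; rewrite Hf.
Qed.

Lemma L0_leP f g :
  L0_le (\pi_L0 f) (\pi_L0 g) <-> {ae mu, forall x, f x <= g x}.
Proof.
split; have := L0_reprK f; have := L0_reprK g.
  by apply: filterS3 => x Hg Hf; rewrite /L0_fun Hf// Hg.
by apply: filterS3 => x Hg Hf; rewrite /L0_fun Hf// Hg.
Qed.

(** Meant for [m'] with [mu `<< m'] and [m' `<< mu], which is not assumed here;
    [m' `<< mu] makes the value independent of the representatives. *)
Definition L0_dist (m' : probability X R) (a b : L0) : R :=
  \int[m']_x Num.min `|a x - b x| 1.

End L0.

(** A normed [L^0]-module without the completeness of its distance, which is
    [is_normed_module] below and is imposed on the objects of [NMod_cg] and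
    [NMod_s]. *)
Record prenormed_module {R : realType} {d : measure_display}
    {X : measurableType d} (mu : {measure set X -> \bar R}) := PrenormedModule {
  pm_sort :> lmodType (L0 mu);
  pnorm : pm_sort -> L0 mu;
  pnorm_ge0 : forall v, L0_le 0 (pnorm v);
  pnorm_eq0 : forall v, pnorm v = 0 <-> v = 0;
  pnormD : forall v w, L0_le (pnorm (v + w)) (pnorm v + pnorm w);
  pnormZ : forall (f : L0 mu) v, pnorm (f *: v) = L0_abs f * pnorm v }.

Section NormedModules.
Context {R : realType} {d : measure_display} {X : measurableType d}.
Variable mu : {measure set X -> \bar R}.

Record module_morphism (M N : prenormed_module mu) := ModuleMorphism {
  mm_fun :> M -> N;
  mm_linear : forall (f : L0 mu) v w,
    mm_fun (f *: v + w) = f *: mm_fun v + mm_fun w;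
  mm_contraction : forall v, L0_le (pnorm (mm_fun v)) (pnorm v) }.

Lemma module_morphismP (M N : prenormed_module mu)
    (phi psi : module_morphism M N) : phi =1 psi -> phi = psi.
Proof.
case: phi psi => [f lf cf] [g lg cg] /= /funext fg; subst g.
by congr ModuleMorphism; exact: Prop_irrelevance.
Qed.

Lemma L0_le_refl (a : L0 mu) : L0_le a a.
Proof. exact: nearW. Qed.

Lemma L0_le_trans (a b c : L0 mu) : L0_le a b -> L0_le b c -> L0_le a c.
Proof. by apply: filterS2 => x; exact: le_trans. Qed.

Definition id_module_morphism (M : prenormed_module mu) : module_morphism M M :=
  @ModuleMorphism M M id (fun _ _ _ => erefl) (fun v => L0_le_refl (pnorm v)).

Section Comp.
Variables (M N P : prenormed_module mu).
Variables (psi : module_morphism N P) (phi : module_morphism M N).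

Lemma comp_mm_linear (f : L0 mu) (v w : M) :
  psi (phi (f *: v + w)) = f *: psi (phi v) + psi (phi w).
Proof. by rewrite !mm_linear. Qed.

Lemma comp_mm_contraction (v : M) : L0_le (pnorm (psi (phi v))) (pnorm v).
Proof. by apply: L0_le_trans (mm_contraction phi v); exact: mm_contraction. Qed.

Definition comp_module_morphism : module_morphism M P :=
  @ModuleMorphism M P (fun v => psi (phi v)) comp_mm_linear comp_mm_contraction.
End Comp.

Lemma comp_mm1 (M N : prenormed_module mu) (phi : module_morphism M N) :
  comp_module_morphism phi (id_module_morphism M) = phi.
Proof. exact: module_morphismP. Qed.

Lemma comp_1mm (M N : prenormed_module mu) (phi : module_morphism M N) :
  comp_module_morphism (id_module_morphism N) phi = phi.
Proof. exact: module_morphismP. Qed.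

Lemma comp_mmA (M N P Q : prenormed_module mu) (phi : module_morphism M N)
    (psi : module_morphism N P) (chi : module_morphism P Q) :
  comp_module_morphism chi (comp_module_morphism psi phi) =
  comp_module_morphism (comp_module_morphism chi psi) phi.
Proof. exact: module_morphismP. Qed.

Definition PNMod : category :=
  Category comp_mm1 comp_1mm comp_mmA.

Variable m' : probability X R.

Definition module_dist (M : prenormed_module mu) (v w : M) : R :=
  L0_dist m' (pnorm (v - w)) 0.

Definition is_normed_module (M : prenormed_module mu) : Prop :=
  dist_complete (@module_dist M).

Definition is_submodule (M : lmodType (L0 mu)) (S : set M) : Prop :=
  S 0 /\ forall (f : L0 mu) v w, S v -> S w -> S (f *: v + w).

Definition countably_generated (M : prenormed_module mu) : Prop :=
  exists2 C : set M, countable C &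
    dist_dense (@module_dist M) (smallest (@is_submodule M) C).

Definition separable_module (M : prenormed_module mu) : Prop :=
  dist_separable (@module_dist M).

Definition NMod_cg : category :=
  full_subcategory (D := PNMod)
    (fun M => is_normed_module M /\ countably_generated M).

Definition NMod_s : category :=
  full_subcategory (D := PNMod)
    (fun M => is_normed_module M /\ separable_module M).

End NormedModules.

Section MeasureAlgebra.
Context {R : realType} {d : measure_display} {X : measurableType d}.
Variable mu : {measure set X -> \bar R}.

Record mset := MSet { mset_set :> set X; mset_measurable : measurable mset_set }.

HB.instance Definition _ := gen_eqMixin mset.
HB.instance Definition _ := gen_choiceMixin mset.

Definition mset_eq (A B : mset) : bool := `[< mu (A `+` B) = 0%E >].

Lemma mset_eqP (A B : mset) :
  mset_eq A B <-> {ae mu, forall x, mset_set A x <-> mset_set B x}.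
Proof.
have mAB : measurable (A `+` B).
  by apply: measurableU; apply: measurableD; exact: mset_measurable.
have E : A `+` B = ~` [set x | mset_set A x <-> mset_set B x].
  apply/seteqP; split => x /=.
    by case=> -[? ?] [? ?]; tauto.
  move=> H; have [Ax|Ax] := pselect (mset_set A x); have [Bx|Bx] := pselect (mset_set B x).
  - by exfalso; apply: H.
  - by left.
  - by right.
  - by exfalso; apply: H.
split=> [/asboolP H|[N [mN N0 sN]]].
  by exists (A `+` B); split=> //; rewrite E.
apply/asboolP/eqP; rewrite -measure_le0 -N0; apply: le_measure.
- by rewrite inE.
- by rewrite inE.
- by rewrite E; exact: sN.
Qed.

Lemma mset_eq_refl : reflexive mset_eq.
Proof. by move=> A; apply/mset_eqP; exact: nearW. Qed.

Lemma mset_eq_sym : symmetric mset_eq.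
Proof.
suff H A B : mset_eq A B -> mset_eq B A by move=> A B; apply/idP/idP; exact: H.
by move=> /mset_eqP h; apply/mset_eqP; apply: filterS h => x [].
Qed.

Lemma mset_eq_trans : transitive mset_eq.
Proof.
move=> B A C /mset_eqP h1 /mset_eqP h2; apply/mset_eqP.
by apply: filterS2 h1 h2 => x; tauto.
Qed.

Canonical mset_eq_equiv :=
  EquivRel mset_eq mset_eq_refl mset_eq_sym mset_eq_trans.

Definition measure_algebra : Type := {eq_quot mset_eq}.
HB.instance Definition _ := Choice.on measure_algebra.
HB.instance Definition _ := EqQuotient.on measure_algebra.

Definition measure_algebra_dist (m' : {finite_measure set X -> \bar R})
    (a b : measure_algebra) : R :=
  fine (m' ((repr a : mset) `+` (repr b : mset))).

Definition separable_measure_space : Prop :=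
  exists m' : {finite_measure set X -> \bar R},
    [/\ mu `<< m', m' `<< mu & dist_separable (measure_algebra_dist m')].

End MeasureAlgebra.

Record Grassmannian {R : realType} (B : separableBanach R) := ClosedSubspace {
  gr_set :> set B;
  gr_closed : closed gr_set;
  gr_zero : gr_set 0;
  gr_linear : forall (a : R) u v, gr_set u -> gr_set v -> gr_set (a *: u + v) }.

Record Banach_bundle {R : realType} (B : separableBanach R)
    {d : measure_display} (X : measurableType d) := BanachBundle {
  fiber :> X -> Grassmannian B;
  fiber_measurable : forall U : set B, open U ->
    measurable [set x | gr_set (fiber x) `&` U !=set0] }.

Section Bundles.
Context {R : realType} {B : separableBanach R}.
Context {d : measure_display} {X : measurableType d}.
Implicit Types E F G H : Banach_bundle B X.

Definition total_space E : set (X * borel B) := [set p | gr_set (E p.1) p.2].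

Lemma total_space_measurable E : measurable (total_space E).
Proof.
have [u du] := separable_seq B.
pose r (k : nat) : R := k.+1%:R^-1.
have r0 k : 0 < r k by rewrite invr_gt0.
have oball k n : open (ball (u n) (r k)) by exact: ball_open.
pose S k n : set (X * borel B) :=
  [set x | gr_set (E x) `&` ball (u n) (r k) !=set0] `*` ball (u n) (r k).
have -> : total_space E = \bigcap_k \bigcup_n S k n.
  apply/seteqP; split => [[x v] /= Ev k _|[x v] /= h].
    have [n hn] := du v (r k) (r0 k).
    have {}hn := ball_sym hn.
    by exists n => //; split => //=; exists v; split.
  rewrite /total_space /=; apply: (gr_closed (g := E x)) => A.
  move=> /nbhs_ballP[e /= e0 He].
  have e20 : 0 < e / 2 by rewrite divr_gt0.
  have := near_infty_natSinv_lt (PosNum e20) => -[k _ /(_ k (leqnn k)) /= hk].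
  have [n _ [/= [w [Ew bw]] bv]] := h k Logic.I.
  exists w; split => //; apply: He.
  apply: (@le_ball _ _ _ (r k + r k)); first by rewrite [e]splitr lerD// ltW.
  exact: ball_triangle (ball_sym bv) bw.
apply: bigcapT_measurable => k; apply: bigcupT_measurable => n.
apply: measurableX; first exact: fiber_measurable.
exact: sub_sigma_algebra.
Qed.

(** A map between the total spaces is represented by a map of [X * B] that is
    unconstrained outside [total_space E]; the quotient by [premorphism_eq]
    forgets these values. *)
Record premorphism E F := Premorphism {
  pm_fun : X * borel B -> X * borel B;
  pm_measurable : measurable_fun (total_space E) pm_fun;
  pm_base : forall x v, gr_set (E x) v -> (pm_fun (x, v)).1 = x;
  pm_fiber : forall x v, gr_set (E x) v -> gr_set (F x) (pm_fun (x, v)).2;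
  pm_linear : forall x (a : R) (v w : B), gr_set (E x) v -> gr_set (E x) w ->
    (pm_fun (x, a *: v + w)).2 = a *: ((pm_fun (x, v)).2 : B) + (pm_fun (x, w)).2;
  pm_contraction : forall x (v : B), gr_set (E x) v ->
    `|(pm_fun (x, v)).2 : B| <= `|v| }.

HB.instance Definition _ E F := gen_eqMixin (premorphism E F).
HB.instance Definition _ E F := gen_choiceMixin (premorphism E F).

Lemma pm_funE E F (f : premorphism E F) x v : gr_set (E x) v ->
  pm_fun f (x, v) = (x, (pm_fun f (x, v)).2).
Proof. by move=> /(pm_base f) {2}<-; case: (pm_fun f _). Qed.

Definition id_premorphism E : premorphism E E :=
  @Premorphism E E id (@measurable_id _ _ _) (fun _ _ _ => erefl)
    (fun _ _ Ev => Ev) (fun _ _ _ _ _ _ => erefl) (fun _ v _ => lexx `|v|).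

Section CompPremorphism.
Variables (E F G : Banach_bundle B X).
Variables (g : premorphism F G) (f : premorphism E F).

Let comp x := pm_fun g (pm_fun f x).

Lemma comp_pm_measurable : measurable_fun (total_space E) comp.
Proof.
apply: (measurable_comp (total_space_measurable F)) (pm_measurable g) (pm_measurable f).
move=> _ [[x v] /= Ev <-]; rewrite (pm_funE f Ev).
exact: pm_fiber.
Qed.

Lemma comp_pm_base x v : gr_set (E x) v -> (comp (x, v)).1 = x.
Proof. by move=> Ev; rewrite /comp (pm_funE f Ev) pm_base//; exact: pm_fiber. Qed.

Lemma comp_pm_fiber x v : gr_set (E x) v -> gr_set (G x) (comp (x, v)).2.
Proof. by move=> Ev; rewrite /comp (pm_funE f Ev); do 2!apply: pm_fiber. Qed.

Lemma comp_pm_linear x (a : R) (v w : B) : gr_set (E x) v -> gr_set (E x) w ->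
  (comp (x, a *: v + w)).2 = a *: ((comp (x, v)).2 : B) + (comp (x, w)).2.
Proof.
move=> Ev Ew; rewrite /comp (pm_funE f Ev) (pm_funE f Ew).
rewrite (pm_funE f (gr_linear a Ev Ew)) (pm_linear f)// (pm_linear g)//.
- exact: pm_fiber.
- exact: pm_fiber.
Qed.

Lemma comp_pm_contraction x (v : B) : gr_set (E x) v ->
  `|(comp (x, v)).2 : B| <= `|v|.
Proof.
move=> Ev; rewrite /comp (pm_funE f Ev); apply: le_trans (pm_contraction f Ev).
by apply: pm_contraction; exact: pm_fiber.
Qed.

Definition comp_premorphism : premorphism E G :=
  Premorphism comp_pm_measurable comp_pm_base comp_pm_fiber comp_pm_linear
    comp_pm_contraction.
End CompPremorphism.

Variable mu : {measure set X -> \bar R}.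

Section Morphism.
Variables E F : Banach_bundle B X.

Definition premorphism_eq (f g : premorphism E F) : bool :=
  `[< exists N, [/\ measurable N, mu N = 0%E &
        forall x, ~ N x -> forall v, gr_set (E x) v ->
          pm_fun f (x, v) = pm_fun g (x, v)] >].

Lemma premorphism_eq_refl : reflexive premorphism_eq.
Proof. by move=> f; apply/asboolP; exists set0; split. Qed.

Lemma premorphism_eq_sym : symmetric premorphism_eq.
Proof.
suff H f g : premorphism_eq f g -> premorphism_eq g f.
  by move=> f g; apply/idP/idP; exact: H.
move=> /asboolP[N [mN N0 fg]]; apply/asboolP; exists N; split=> // x Nx v Ev.
by rewrite fg.
Qed.

Lemma premorphism_eq_trans : transitive premorphism_eq.
Proof.
move=> g f h /asboolP[N [mN N0 fg]] /asboolP[M [mM M0 gh]].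
apply/asboolP; exists (N `|` M); split.
- exact: measurableU.
- by apply: null_set_setU.
- by move=> x NMx v Ev; rewrite fg ?gh//; apply: contra_not NMx; [right|left].
Qed.

Canonical premorphism_equiv := EquivRel premorphism_eq
  premorphism_eq_refl premorphism_eq_sym premorphism_eq_trans.

Definition bundle_morphism : Type := {eq_quot premorphism_eq}.
HB.instance Definition _ := Choice.on bundle_morphism.
HB.instance Definition _ := EqQuotient.on bundle_morphism.

Lemma bundle_morphismP (f g : premorphism E F) :
  \pi_bundle_morphism f = \pi_bundle_morphism g <->
  exists N, [/\ measurable N, mu N = 0%E &
    forall x, ~ N x -> forall v, gr_set (E x) v ->
      pm_fun f (x, v) = pm_fun g (x, v)].
Proof. by split=> [/eqmodP/asboolP|?]; [|apply/eqmodP/asboolP]. Qed.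

Lemma bundle_morphism_reprK (f : premorphism E F) :
  exists N, [/\ measurable N, mu N = 0%E &
    forall x, ~ N x -> forall v, gr_set (E x) v ->
      pm_fun (repr (\pi_bundle_morphism f)) (x, v) = pm_fun f (x, v)].
Proof. by apply/bundle_morphismP; rewrite reprK. Qed.
End Morphism.

Definition id_bundle_morphism E : bundle_morphism E E :=
  \pi_(bundle_morphism E E) (id_premorphism E).

Definition comp_bundle_morphism E F G (psi : bundle_morphism F G)
    (phi : bundle_morphism E F) : bundle_morphism E G :=
  \pi_(bundle_morphism E G) (comp_premorphism (repr psi) (repr phi)).

Lemma comp_bundle_morphismE E F G (g : premorphism F G) (f : premorphism E F) :
  comp_bundle_morphism (\pi g) (\pi f) =
  \pi_(bundle_morphism E G) (comp_premorphism g f).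
Proof.
apply/bundle_morphismP.
have [N [mN N0 Nf]] := bundle_morphism_reprK f.
have [M [mM M0 Mg]] := bundle_morphism_reprK g.
exists (N `|` M); split.
- exact: measurableU.
- by apply: null_set_setU.
- move=> x NMx v Ev /=.
  have Nx : ~ N x by apply: contra_not NMx; left.
  have Mx : ~ M x by apply: contra_not NMx; right.
  rewrite Nf// (pm_funE f Ev) Mg//; exact: pm_fiber.
Qed.

Lemma comp_bm1 E F (phi : bundle_morphism E F) :
  comp_bundle_morphism phi (id_bundle_morphism E) = phi.
Proof.
elim/quotW: phi => f; rewrite (comp_bundle_morphismE f).
by apply/bundle_morphismP; exists set0; split.
Qed.

Lemma comp_1bm E F (phi : bundle_morphism E F) :
  comp_bundle_morphism (id_bundle_morphism F) phi = phi.
Proof.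
elim/quotW: phi => f; rewrite (comp_bundle_morphismE _ f).
by apply/bundle_morphismP; exists set0; split.
Qed.

Lemma comp_bmA E F G H (phi : bundle_morphism E F) (psi : bundle_morphism F G)
    (chi : bundle_morphism G H) :
  comp_bundle_morphism chi (comp_bundle_morphism psi phi) =
  comp_bundle_morphism (comp_bundle_morphism chi psi) phi.
Proof.
elim/quotW: phi => f; elim/quotW: psi => g; elim/quotW: chi => h.
rewrite (comp_bundle_morphismE g f) (comp_bundle_morphismE h g).
rewrite (comp_bundle_morphismE h) (comp_bundle_morphismE _ f).
by apply/bundle_morphismP; exists set0; split.
Qed.

End Bundles.

Definition SBB {R : realType} (B : separableBanach R) {d : measure_display}
    {X : measurableType d} (mu : {measure set X -> \bar R}) : category :=
  Category (@comp_bm1 R B d X mu) (@comp_1bm R B d X mu) (@comp_bmA R B d X mu).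

Section Sections.
Context {R : realType} {B : separableBanach R}.
Context {d : measure_display} {X : measurableType d}.
Variable mu : {measure set X -> \bar R}.

Section Gamma.
Variable E : Banach_bundle B X.

Record bundle_section := BundleSection {
  sec_fun : X -> B;
  sec_measurable : measurable_fun setT (sec_fun : X -> borel B);
  sec_fiber : forall x, gr_set (E x) (sec_fun x) }.

Coercion sec_fun : bundle_section >-> Funclass.

HB.instance Definition _ := gen_eqMixin bundle_section.
HB.instance Definition _ := gen_choiceMixin bundle_section.

Implicit Types s t u : bundle_section.
Implicit Types f g : {mfun X >-> R}.

Definition section_eq s t : bool := `[< s = t %[ae mu] >].

Lemma section_eq_refl : reflexive section_eq.
Proof. by move=> s; apply/asboolP; exact: nearW. Qed.

Lemma section_eq_sym : symmetric section_eq.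
Proof.
suff H s t : section_eq s t -> section_eq t s by move=> s t; apply/idP/idP; exact: H.
by move=> /asboolP h; apply/asboolP; apply: filterS h => x /[apply].
Qed.

Lemma section_eq_trans : transitive section_eq.
Proof.
move=> t s u /asboolP h1 /asboolP h2; apply/asboolP.
by apply: filterS2 h1 h2 => x h1 h2 _; rewrite h1// h2.
Qed.

Canonical section_equiv :=
  EquivRel section_eq section_eq_refl section_eq_sym section_eq_trans.

Definition Gamma_sort : Type := {eq_quot section_eq}.
HB.instance Definition _ := Choice.on Gamma_sort.
HB.instance Definition _ := EqQuotient.on Gamma_sort.

Lemma Gamma_piP s t : (\pi_Gamma_sort s = \pi_Gamma_sort t) <-> (s = t %[ae mu]).
Proof. by split=> [/eqmodP/asboolP|H]; [exact|apply/eqmodP/asboolP]. Qed.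

Lemma Gamma_reprK s : (repr (\pi_Gamma_sort s) : bundle_section) = s %[ae mu].
Proof. by apply/Gamma_piP; rewrite reprK. Qed.

Lemma gr_add x v w : gr_set (E x) v -> gr_set (E x) w -> gr_set (E x) (v + w).
Proof. by move=> Ev Ew; rewrite -[v]scale1r; exact: gr_linear. Qed.

Lemma gr_scale x (a : R) v : gr_set (E x) v -> gr_set (E x) (a *: v).
Proof. by move=> Ev; rewrite -[_ *: _]addr0; apply: gr_linear => //; exact: gr_zero. Qed.

Definition sec_zero : bundle_section :=
  @BundleSection (fun=> 0) (@measurable_cst _ _ X (borel B) setT 0)
    (fun x => gr_zero (E x)).

Definition sec_add s t : bundle_section :=
  @BundleSection (fun x => s x + t x)
    (borel_measurableD (sec_measurable s) (sec_measurable t))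
    (fun x => gr_add (sec_fiber s x) (sec_fiber t x)).

Definition sec_scale f s : bundle_section :=
  @BundleSection (fun x => f x *: s x)
    (borel_measurableZ (measurable_funPT f) (sec_measurable s))
    (fun x => gr_scale (f x) (sec_fiber s x)).

Definition sec_norm s : {mfun X >-> R} :=
  mk_mfun (borel_measurable_norm (sec_measurable s)).

Definition Gamma_zero : Gamma_sort := \pi_Gamma_sort sec_zero.
Definition Gamma_add (a b : Gamma_sort) : Gamma_sort :=
  \pi_Gamma_sort (sec_add (repr a) (repr b)).
Definition Gamma_scale (f : L0 mu) (a : Gamma_sort) : Gamma_sort :=
  \pi_Gamma_sort (sec_scale (repr f) (repr a)).
Definition Gamma_opp (a : Gamma_sort) : Gamma_sort :=
  \pi_Gamma_sort (sec_scale (-1) (repr a)).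
Definition Gamma_norm (a : Gamma_sort) : L0 mu := \pi_(L0 mu) (sec_norm (repr a)).

Lemma Gamma_addE s t :
  Gamma_add (\pi_Gamma_sort s) (\pi_Gamma_sort t) = \pi_Gamma_sort (sec_add s t).
Proof.
apply/Gamma_piP; have := Gamma_reprK s; have := Gamma_reprK t.
by apply: filterS2 => x Ht Hs _ /=; rewrite Hs// Ht.
Qed.

Lemma Gamma_scaleE f s :
  Gamma_scale (\pi_(L0 mu) f) (\pi_Gamma_sort s) = \pi_Gamma_sort (sec_scale f s).
Proof.
apply/Gamma_piP; have := L0_reprK mu f; have := Gamma_reprK s.
by apply: filterS2 => x Hs Hf _ /=; rewrite Hs// Hf.
Qed.

Lemma Gamma_oppE s : Gamma_opp (\pi_Gamma_sort s) = \pi_Gamma_sort (sec_scale (-1) s).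
Proof.
apply/Gamma_piP; have := Gamma_reprK s.
by apply: filterS => x Hs _ /=; rewrite Hs.
Qed.

Lemma Gamma_normE s : Gamma_norm (\pi_Gamma_sort s) = \pi_(L0 mu) (sec_norm s).
Proof.
apply/L0_piP; have := Gamma_reprK s.
by apply: filterS => x Hs _ /=; rewrite Hs.
Qed.

Lemma Gamma_ext s t : s =1 t -> \pi_Gamma_sort s = \pi_Gamma_sort t.
Proof. by move=> st; apply/Gamma_piP; exact: nearW. Qed.

Lemma Gamma_addA : associative Gamma_add.
Proof.
move=> a b c; elim/quotW: a => s; elim/quotW: b => t; elim/quotW: c => u.
rewrite (Gamma_addE s t) (Gamma_addE t u) (Gamma_addE (sec_add s t)) (Gamma_addE s).
by apply: Gamma_ext => x /=; rewrite addrA.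
Qed.

Lemma Gamma_addC : commutative Gamma_add.
Proof.
move=> a b; elim/quotW: a => s; elim/quotW: b => t.
rewrite (Gamma_addE s) (Gamma_addE t).
by apply: Gamma_ext => x /=; rewrite addrC.
Qed.

Lemma Gamma_add0 : left_id Gamma_zero Gamma_add.
Proof.
move=> a; elim/quotW: a => s; rewrite (Gamma_addE sec_zero s).
by apply: Gamma_ext => x /=; rewrite add0r.
Qed.

Lemma Gamma_addN : left_inverse Gamma_zero Gamma_opp Gamma_add.
Proof.
move=> a; elim/quotW: a => s; rewrite (Gamma_oppE s) (Gamma_addE (sec_scale _ s)).
by apply: Gamma_ext => x /=; rewrite scaleN1r addNr.
Qed.

HB.instance Definition _ :=
  GRing.isZmodule.Build Gamma_sort Gamma_addA Gamma_addC Gamma_add0 Gamma_addN.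

Lemma Gamma_scaleA (f g : L0 mu) (a : Gamma_sort) :
  Gamma_scale f (Gamma_scale g a) = Gamma_scale (f * g) a.
Proof.
elim/quotW: f => f; elim/quotW: g => g; elim/quotW: a => s.
have -> : \pi_(L0 mu) f * \pi_(L0 mu) g = \pi_(L0 mu) (f * g) by exact: L0_mulE.
rewrite (Gamma_scaleE g s) (Gamma_scaleE f) (Gamma_scaleE (f * g)).
by apply: Gamma_ext => x /=; rewrite scalerA.
Qed.

Lemma Gamma_scale1 : left_id (1 : L0 mu) Gamma_scale.
Proof.
move=> a; elim/quotW: a => s; rewrite (Gamma_scaleE 1 s).
by apply: Gamma_ext => x /=; rewrite scale1r.
Qed.

Lemma Gamma_scaleDr : right_distributive Gamma_scale +%R.
Proof.
move=> f a b; elim/quotW: f => f; elim/quotW: a => s; elim/quotW: b => t.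
have DE (u v : bundle_section) :
  \pi_Gamma_sort u + \pi_Gamma_sort v = \pi_Gamma_sort (sec_add u v).
  exact: Gamma_addE.
rewrite (DE s t) (Gamma_scaleE f (sec_add s t)) (Gamma_scaleE f s).
rewrite (Gamma_scaleE f t) DE.
by apply: Gamma_ext => x /=; rewrite scalerDr.
Qed.

Lemma Gamma_scaleDl (a : Gamma_sort) :
  {morph Gamma_scale^~ a : f g / f + g >-> f + g}.
Proof.
move=> f g; elim/quotW: f => f; elim/quotW: g => g; elim/quotW: a => s.
have DE (u v : bundle_section) :
  \pi_Gamma_sort u + \pi_Gamma_sort v = \pi_Gamma_sort (sec_add u v).
  exact: Gamma_addE.
have -> : \pi_(L0 mu) f + \pi_(L0 mu) g = \pi_(L0 mu) (f + g) by exact: L0_addE.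
rewrite (Gamma_scaleE (f + g)) (Gamma_scaleE f) (Gamma_scaleE g) DE.
by apply: Gamma_ext => x /=; rewrite scalerDl.
Qed.

HB.instance Definition _ := GRing.Zmodule_isLmodule.Build (L0 mu) Gamma_sort
  Gamma_scaleA Gamma_scale1 Gamma_scaleDr Gamma_scaleDl.

Lemma Gamma_norm_ge0 (a : Gamma_sort) : L0_le 0 (Gamma_norm a).
Proof.
elim/quotW: a => s; rewrite (Gamma_normE s).
by apply/(L0_leP mu 0); apply: nearW => x; exact: normr_ge0.
Qed.

Lemma Gamma_norm_eq0 (a : Gamma_sort) : Gamma_norm a = 0 <-> a = 0.
Proof.
elim/quotW: a => s; rewrite (Gamma_normE s).
split=> [/(L0_piP mu _ 0)|/(Gamma_piP s sec_zero)] h.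
- apply/(Gamma_piP s sec_zero); apply: filterS h => x h _.
  by apply/eqP; rewrite -normr_eq0; apply/eqP; exact: h.
- apply/(L0_piP mu _ 0); apply: filterS h => x h _ /=.
  by rewrite h//= normr0.
Qed.

Lemma Gamma_normD (a b : Gamma_sort) :
  L0_le (Gamma_norm (a + b)) (Gamma_norm a + Gamma_norm b).
Proof.
elim/quotW: a => s; elim/quotW: b => t.
have -> : \pi_Gamma_sort s + \pi_Gamma_sort t = \pi_Gamma_sort (sec_add s t).
  exact: Gamma_addE.
rewrite (Gamma_normE (sec_add s t)) (Gamma_normE s) (Gamma_normE t).
have -> : \pi_(L0 mu) (sec_norm s) + \pi_(L0 mu) (sec_norm t) =
  \pi_(L0 mu) (sec_norm s + sec_norm t) by exact: L0_addE.
by apply/L0_leP; apply: nearW => x /=; exact: ler_normD.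
Qed.

Lemma Gamma_normZ (f : L0 mu) (a : Gamma_sort) :
  Gamma_norm (f *: a) = L0_abs f * Gamma_norm a.
Proof.
elim/quotW: f => f; elim/quotW: a => s.
have -> : \pi_(L0 mu) f *: \pi_Gamma_sort s = \pi_Gamma_sort (sec_scale f s).
  exact: Gamma_scaleE.
rewrite (Gamma_normE (sec_scale f s)) (Gamma_normE s) (L0_absE mu f).
have -> : \pi_(L0 mu) (mfun_norm f) * \pi_(L0 mu) (sec_norm s) =
  \pi_(L0 mu) (mfun_norm f * sec_norm s) by exact: L0_mulE.
by apply/L0_piP; apply: nearW => x _ /=; rewrite normrZ.
Qed.

Definition Gamma_obj : prenormed_module mu :=
  @PrenormedModule R d X mu Gamma_sort Gamma_norm
    Gamma_norm_ge0 Gamma_norm_eq0 Gamma_normD Gamma_normZ.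
End Gamma.

Section GammaMap.
Variables E F : Banach_bundle B X.

Lemma sec_map_measurable (f : premorphism E F) (s : bundle_section E) :
  measurable_fun setT ((fun x => (pm_fun f (x, s x)).2) : X -> borel B).
Proof.
have m2 : measurable_fun setT (fun p : X * borel B => p.2).
  exact: measurable_snd.
apply: (measurableT_comp m2).
apply: (measurable_comp (total_space_measurable E)) (pm_measurable f) _.
  by move=> _ [x _ <-]; exact: sec_fiber.
exact: measurable_fun_pair (@measurable_id _ _ _) (sec_measurable s).
Qed.

Definition sec_map (f : premorphism E F) (s : bundle_section E) :
    bundle_section F :=
  @BundleSection F (fun x => (pm_fun f (x, s x)).2) (sec_map_measurable f s)
    (fun x => pm_fiber f (sec_fiber s x)).

Definition Gamma_fun (phi : bundle_morphism mu E F) (a : Gamma_sort E) :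
    Gamma_sort F :=
  \pi_(Gamma_sort F) (sec_map (repr phi) (repr a)).

Lemma Gamma_funE (f : premorphism E F) (s : bundle_section E) :
  Gamma_fun (\pi_(bundle_morphism mu E F) f) (\pi_(Gamma_sort E) s) =
  \pi_(Gamma_sort F) (sec_map f s).
Proof.
apply/Gamma_piP; have [N [mN N0 Nf]] := bundle_morphism_reprK mu f.
have NN : {ae mu, forall x, ~ N x}.
  by exists N; split=> // x /=; exact: contrapT.
apply: filterS2 NN (Gamma_reprK s) => x Nx Hs _ /=.
by rewrite Hs// Nf//; exact: sec_fiber.
Qed.

Lemma Gamma_fun_linear (phi : bundle_morphism mu E F) (f : L0 mu)
    (v w : Gamma_obj E) :
  Gamma_fun phi (f *: v + w) = f *: Gamma_fun phi v + Gamma_fun phi w :> Gamma_obj F.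
Proof.
rewrite /= in v w *.
elim/quotW: phi => phi; elim/quotW: f => f; elim/quotW: v => s; elim/quotW: w => t.
have ZE G u : \pi_(L0 mu) f *: \pi_(Gamma_sort G) u =
    \pi_(Gamma_sort G) (sec_scale f u) by exact: Gamma_scaleE.
have DE G u v : \pi_(Gamma_sort G) u + \pi_(Gamma_sort G) v =
    \pi_(Gamma_sort G) (sec_add u v) by exact: Gamma_addE.
rewrite (ZE E) (DE E) (Gamma_funE phi (sec_add _ t)) (Gamma_funE phi s).
rewrite (Gamma_funE phi t) (ZE F) (DE F).
by apply: Gamma_ext => x /=; apply: pm_linear; exact: sec_fiber.
Qed.

Lemma Gamma_fun_contraction (phi : bundle_morphism mu E F) (v : Gamma_obj E) :
  L0_le (Gamma_norm (Gamma_fun phi v)) (Gamma_norm v).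
Proof.
rewrite /= in v *; elim/quotW: phi => phi; elim/quotW: v => s.
rewrite (Gamma_funE phi s) (Gamma_normE s) (Gamma_normE (sec_map phi s)).
apply/L0_leP; apply: nearW => x /=; apply: pm_contraction; exact: sec_fiber.
Qed.

Definition Gamma_map (phi : bundle_morphism mu E F) :
    module_morphism (Gamma_obj E) (Gamma_obj F) :=
  @ModuleMorphism R d X mu (Gamma_obj E) (Gamma_obj F) (Gamma_fun phi)
    (Gamma_fun_linear phi) (Gamma_fun_contraction phi).
End GammaMap.

Lemma Gamma_map1 (E : Banach_bundle B X) :
  Gamma_map (id_bundle_morphism mu E) = id_module_morphism (Gamma_obj E).
Proof.
apply: module_morphismP => a; rewrite /= in a *; elim/quotW: a => s.
by rewrite (Gamma_funE (id_premorphism E) s); exact: Gamma_ext.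
Qed.

Lemma Gamma_mapM (E F G : Banach_bundle B X) (psi : bundle_morphism mu F G)
    (phi : bundle_morphism mu E F) :
  Gamma_map (comp_bundle_morphism psi phi) =
  comp_module_morphism (Gamma_map psi) (Gamma_map phi).
Proof.
apply: module_morphismP => a; rewrite /= in a *; elim/quotW: a => s.
elim/quotW: psi => g; elim/quotW: phi => f.
rewrite (comp_bundle_morphismE mu g f) (Gamma_funE (comp_premorphism g f)).
rewrite (Gamma_funE f s) (Gamma_funE g (sec_map f s)).
by apply: Gamma_ext => x /=; rewrite (pm_funE f (sec_fiber s x)).
Qed.

(** The target is the category without completeness and countable generation;
    the functors to the full subcategories [NMod_cg] and [NMod_s] are the
    corestrictions of this one. *)
Definition Gamma : functor (SBB B mu) (PNMod mu) :=
  @Functor (SBB B mu) (PNMod mu) Gamma_obj Gamma_map Gamma_map1 Gamma_mapM.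

End Sections.

(* Main.v *)
(** Every bundle has a sequence of measurable sections [s n] that is dense in
    each fiber.  A morphism of section modules satisfies almost everywhere
    [|q T(s n) + T(s m) - T(s p)| <= |q (s n) + s m - s p|] for all indices and
    all rational [q], hence is induced by a unique linear contraction of almost
    every fiber: the section functor is fully faithful.

    A module generated by [v 0, v 1, ...] with [|v i| <= 1] gives a measurable
    family of seminorms [p x z = |sum_i z_i v_i|(x)] on the finitely supported
    rational sequences [z], and essential surjectivity amounts to realizing all
    the [p x] by measurable vectors in one separable Banach space.  No selection
    theorem is needed for that.  Cut [X] into nested countable families of cells
    on which [x |-> p x z] oscillates by at most [eta k z], with
    [sum_k eta k z] finite.  By Hahn-Banach, a functional dominated by the supremum
    of the [p x] over a cell can be moved to any subcell of the next level at a
    cost [eta k].  Evaluating at [z] the functionals moved to the cell of [x] of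
    level [k] defines a bounded function, one of countably many, and as [k]
    grows these functions converge uniformly to a vector of norm [p x z].  The
    closed span of these functions is separable, so it embeds into the universal
    space, and the completeness of the module makes it isomorphic to the module
    of sections of the bundle of the closures of the spans. *)

From HB Require Import structures.
From mathcomp Require Import all_boot all_order all_algebra.
From mathcomp Require Import generic_quotient.
From mathcomp Require Import all_classical all_reals all_analysis.
From mathcomp Require Import measurable_realfun ring lra.
Require Import Defs.

Set Implicit Arguments.
Unset Strict Implicit.
Unset Printing Implicit Defensive.

Import Order.TTheory GRing.Theory Num.Theory.
Import numFieldNormedType.Exports.

Local Open Scope classical_set_scope.
Local Open Scope ring_scope.
Local Open Scope quotient_scope.

(** * Separable closed spans of bounded functions *)

(** Almost everywhere statements survive only countable intersections. Hence fiberwise algebra is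
    tested on rational combinations of countably many elements, and real scalars return by density;
    this is why Hahn-Banach is proved over the rationals, where it yields additive functionals. The
    obstacle in the realization is to have vectors that are exactly additive in [z], depend
    measurably on [x] and lie in one space, all at once. The bounded functions therefore live on the
    set of all pairs of a base point and an additive functional below its seminorm. Additivity holds
    at each level because whole functionals are perturbed, not single values; the norm is attained
    because a functional is never moved along the cells of its base point. Morphisms on fibers and
    sections attached to module elements come from one device: a vector is located by bounds [r n]
    on its distances to points [b n]. In a complete space it exists once [|b n - b m| <= r n + r m]
    and the [r n] have infimum 0, and it is then unique. *)

Lemma rat_approx (R : realType) (a e : R) : 0 < e ->
  exists q : rat, `|a - ratr q| < e.
Proof.
move=> e0; have [||y [bay [q _ qy]]] := @dense_rat R (ball a e).
- by exists a; exact: ballxx.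
- exact: ball_open.
by exists q; rewrite qy.
Qed.

Lemma rat_approx_bounded (R : realType) (a c : R) : 0 < c -> c <= 1 ->
  exists2 q : rat, `|a - ratr q| < c & `|ratr q| <= `|a| + 1.
Proof.
move=> c0 c1; have [q aq] := rat_approx a c0; exists q => //.
rewrite -{1}(subrK a (ratr q)); apply: le_trans (ler_normD _ _) _.
by rewrite distrC addrC lerD2l; apply: ltW (lt_le_trans aq c1).
Qed.

Section UniformSpan.
Context {R : realType} {S : Type} (g : nat -> S -> R).
Hypothesis g_bounded : forall n, exists M, forall s, `|g n s| <= M.

Definition rat_comb (l : seq (rat * nat)) (s : S) : R :=
  \sum_(p <- l) ratr p.1 * g p.2 s.

Lemma rat_comb_linear (q : rat) (l l' : seq (rat * nat)) s :
  rat_comb ([seq (q * p.1, p.2) | p <- l] ++ l') s =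
  ratr q * rat_comb l s + rat_comb l' s.
Proof.
rewrite /rat_comb big_cat big_map mulr_sumr; congr (_ + _).
by apply: eq_bigr => p _; rewrite rmorphM mulrA.
Qed.

Lemma rat_comb_bounded l : exists M, forall s, `|rat_comb l s| <= M.
Proof.
elim: l => [|[q n] l [M HM]].
  by exists 0 => s; rewrite /rat_comb big_nil normr0.
have [N HN] := g_bounded n.
exists (`|ratr q| * N + M) => s; rewrite /rat_comb big_cons.
apply: le_trans (ler_normD _ _) _; apply: lerD; last exact: HM.
by rewrite normrM; apply: ler_wpM2l.
Qed.

(** The sup-norm closure of the real span of the [g n]; rational coefficients suffice for it and
    leave only countably many approximants. *)
Definition uniform_span : {pred S -> R} := fun f =>
  `[< forall e : R, 0 < e -> exists l, forall s, `|f s - rat_comb l s| <= e >].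

Lemma uniform_span_submod : submod_closed uniform_span.
Proof.
split.
  apply/asboolP => e e0; exists [::] => s.
  by rewrite /rat_comb big_nil subr0 normr0 ltW.
move=> a u v /asboolP Hu /asboolP Hv; apply/asboolP => e e0.
have a0 : 0 < 3 * (`|a| + 1) by rewrite mulr_gt0// ltr_wpDl.
have [|l hl] := Hu (e / (3 * (`|a| + 1))); first by rewrite divr_gt0.
have [|l' hl'] := Hv (e / 3); first by rewrite divr_gt0.
have [M HM] := rat_comb_bounded l.
have M0 : 0 < 3 * (`|M| + 1) by rewrite mulr_gt0// ltr_wpDl.
(* [q] comes after [l], because its tolerance depends on the bound [M] of that combination. *)
have [q hq] := @rat_approx R a (e / (3 * (`|M| + 1))) (divr_gt0 e0 M0).
exists ([seq (q * p.1, p.2) | p <- l] ++ l') => s; rewrite rat_comb_linear.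
rewrite (_ : _ - _ = a * (u s - rat_comb l s) + (a - ratr q) * rat_comb l s
  + (v s - rat_comb l' s)); last first.
  by rewrite (_ : (a *: u + v) s = a * u s + v s)//; ring.
rewrite (_ : e = e / 3 + e / 3 + e / 3); last by field.
apply: le_trans (ler_normD _ _) _; apply: lerD => //.
apply: le_trans (ler_normD _ _) _; rewrite !normrM; apply: lerD => //.
  apply: (@le_trans _ _ (`|a| * (e / (3 * (`|a| + 1))))).
    by apply: ler_wpM2l.
  rewrite mulrA ler_pdivrMr// -subr_ge0.
  rewrite (_ : _ - _ = e); first exact: ltW.
  by field.
apply: (@le_trans _ _ (e / (3 * (`|M| + 1)) * `|M|)).
  by apply: ler_pM => //; [exact: ltW|exact: le_trans (HM s) (ler_norm M)].
rewrite mulrAC ler_pdivrMr// -subr_ge0.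
rewrite (_ : _ - _ = e); first exact: ltW.
by field.
Qed.

HB.instance Definition _ :=
  GRing.isSubmodClosed.Build R (S -> R) uniform_span uniform_span_submod.

Record uspan := USpan {
  uspan_fun :> S -> R;
  _ : uspan_fun \in uniform_span }.

HB.instance Definition _ := [isSub for uspan_fun].
HB.instance Definition _ := gen_eqMixin uspan.
HB.instance Definition _ := gen_choiceMixin uspan.
HB.instance Definition _ := [SubChoice_isSubLmodule of uspan by <:].

Definition uspan_norm (f : uspan) : R := sup (range (fun s => `|f s|)).

Lemma uspan_bounded (f : uspan) : exists M, forall s, `|f s| <= M.
Proof.
case: f => f /= /asboolP /(_ 1 ltr01) [l hl].
have [M HM] := rat_comb_bounded l; exists (1 + M) => s.
rewrite -(subrK (rat_comb l s) (f s)).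
by apply: le_trans (ler_normD _ _) _; exact: lerD.
Qed.

Lemma uspan_norm_ge (f : uspan) s : `|f s| <= uspan_norm f.
Proof.
apply: ub_le_sup; last by exists s.
by have [M HM] := uspan_bounded f; exists M => y [t _ <-].
Qed.

(** The sign of [c] settles the empty index type, where the norm is [sup set0 = 0]. *)
Lemma uspan_norm_le (f : uspan) c : 0 <= c -> (forall s, `|f s| <= c) ->
  uspan_norm f <= c.
Proof.
move=> c0 fc; have [[s]|H] := pselect (inhabited S).
  apply: ge_sup; first by exists `|f s|, s.
  by move=> y [t _ <-].
have E : range (fun s => `|f s|) = set0.
  by apply/seteqP; split=> // y [t]; case: H.
by rewrite /uspan_norm E sup0.
Qed.

Lemma uspan_norm_ge0 (f : uspan) : 0 <= uspan_norm f.
Proof.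
have [[s]|H] := pselect (inhabited S).
  exact: le_trans (uspan_norm_ge f s).
have E : range (fun s => `|f s|) = set0.
  by apply/seteqP; split=> // y [t]; case: H.
by rewrite /uspan_norm E sup0.
Qed.

Lemma uspan_normD (f h : uspan) :
  uspan_norm (f + h) <= uspan_norm f + uspan_norm h.
Proof.
apply: uspan_norm_le => [|s]; first by rewrite addr_ge0// uspan_norm_ge0.
by apply: le_trans (ler_normD _ _) _; rewrite lerD// uspan_norm_ge.
Qed.

Lemma uspan_normZ (a : R) (f : uspan) :
  uspan_norm (a *: f) = `|a| * uspan_norm f.
Proof.
have le (b : R) (h : uspan) : uspan_norm (b *: h) <= `|b| * uspan_norm h.
  apply: uspan_norm_le => [|s]; first by rewrite mulr_ge0// uspan_norm_ge0.
  by rewrite [X in `|X|]/= normrM ler_wpM2l// uspan_norm_ge.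
apply/le_anti; rewrite le/=; have [->|a0] := eqVneq a 0.
  by rewrite normr0 mul0r uspan_norm_ge0.
have := le a^-1 (a *: f); rewrite scalerA mulVf// scale1r normrV ?unitfE//.
by rewrite mulrC ler_pdivlMr ?normr_gt0// mulrC.
Qed.

Lemma uspan_norm_eq0 (f : uspan) : uspan_norm f = 0 -> f = 0.
Proof.
move=> f0; apply: val_inj; apply/funext => s /=; apply/eqP.
by rewrite -normr_le0 -f0; exact: uspan_norm_ge.
Qed.

HB.instance Definition _ := Lmodule_isNormed.Build R uspan
  uspan_normD uspan_normZ uspan_norm_eq0.

(** The limit is pointwise. When a ball of radius [e] around [v] belongs to the filter, the limit
    stays within [e] of [v] uniformly in the point; this gives both its membership in the span and
    the convergence in norm. *)
Lemma uspan_complete (F : set_system uspan) :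
  ProperFilter F -> cauchy F -> cvg F.
Proof.
move=> FF /cauchyP cF.
pose ev s (f : uspan) : R := f s.
have evB s (f h : uspan) : `|ev s f - ev s h| <= `|f - h|.
  exact: (uspan_norm_ge (f - h) s).
have ev_cvg s : cvg (ev s @ F).
  apply/cauchy_cvgP/cauchy_exP => e e0.
  have [v Fv] := cF e e0; exists (ev s v).
  apply: (@filterS _ F _ _ _ _ Fv) => w; rewrite -ball_normE /= => vw.
  exact: le_lt_trans (evB s v w) vw.
pose l s : R := lim (ev s @ F).
have lv e v : 0 < e -> F (ball v e) -> forall s, `|l s - v s| <= e.
  move=> e0 Fv s.
  have cl : `|ev s w - v s| @[w --> F] --> `|l s - v s|.
    by apply: cvg_norm; apply: cvgB; [exact: ev_cvg|exact: cvg_cst].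
  apply: (@closed_cvg _ _ _ FF _ (fun x => x <= e) _ _ _ cl); first exact: closed_le.
  apply: filterS Fv => w; rewrite -ball_normE /= => vw.
  by rewrite distrC; apply: le_trans (evB s v w) (ltW vw).
have lP : l \in uniform_span.
  apply/asboolP => e e0; have e20 : 0 < e / 2 by rewrite divr_gt0.
  have [v Fv] := cF _ e20; have := lv _ _ e20 Fv.
  case: v {Fv} => v /= /asboolP /(_ _ e20) [k hk] hv; exists k => s.
  rewrite [e]splitr -(subrKA (v s)); apply: le_trans (ler_normD _ _) _.
  exact: lerD.
apply/cvg_ex; exists (USpan lP : uspan); apply/cvgrPdist_le => e e0.
have e20 : 0 < e / 2 by rewrite divr_gt0.
have [v Fv] := cF _ e20.
apply: (@filterS _ F _ _ _ _ Fv) => w vw; apply: uspan_norm_le; first exact: ltW.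
move=> s; rewrite [X in `|X|](_ : _ = l s - w s)//.
rewrite [e]splitr -(subrKA (v s)); apply: le_trans (ler_normD _ _) _.
apply: lerD; first exact: lv Fv s.
by rewrite -ball_normE /= in vw; apply: le_trans (evB s v w) (ltW vw).
Qed.

HB.instance Definition _ := Uniform_isComplete.Build uspan uspan_complete.

Lemma rat_comb_in l : rat_comb l \in uniform_span.
Proof. by apply/asboolP => e e0; exists l => s; rewrite subrr normr0 ltW. Qed.

Lemma uspan_separable : separable_space uspan.
Proof.
exists (range (fun l => USpan (rat_comb_in l) : uspan)).
  by apply: (sub_countable (card_image_le _ _)); exact: countableP.
move=> O [f Of] oO; have /nbhs_ballP[e /= e0 He] := open_nbhs_nbhs (conj oO Of).
have e20 : 0 < e / 2 by rewrite divr_gt0.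
have /asboolP/(_ _ e20)[l hl] := valP f.
exists (USpan (rat_comb_in l) : uspan); split; last by exists l.
apply: He; rewrite -ball_normE /=; apply: (@le_lt_trans _ _ (e / 2)).
  by apply: uspan_norm_le; [exact: ltW|exact: hl].
by rewrite gtr_pMr// invf_lt1// ltr1n.
Qed.

Definition uspan_Banach : separableBanach R :=
  @SeparableBanach R uspan uspan_separable.

End UniformSpan.

(** * The Hahn-Banach theorem over the rationals *)

Lemma inf_range_le (R : realType) (T : Type) (f : T -> R) (b : R) :
  (forall t, b <= f t) -> forall t, inf (range f) <= f t.
Proof. by move=> bf t; apply: ge_inf; [exists b => _ [s _ <-]|exists t]. Qed.

Lemma le_inf_range (R : realType) (T : Type) (f : T -> R) (b : R) (t0 : T) :
  (forall t, b <= f t) -> b <= inf (range f).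
Proof. by move=> bf; apply: lb_le_inf; [exists (f t0), t0|move=> _ [s _ <-]]. Qed.

Section HahnBanach.
Context {R : realType} {Z : lmodType rat}.

(** Over the rationals, homogeneity under natural multiples already implies homogeneity under
    nonnegative rationals, by division. *)
Definition sublinear (p : Z -> R) :=
  (forall y z, p (y + z) <= p y + p z) /\
  (forall z n, p (z *+ n) = n%:R * p z).

Definition additive_fun (f : Z -> R) := forall y z, f (y + z) = f y + f z.

Lemma sublinear0 p : sublinear p -> p 0 = 0.
Proof. by case=> _ /(_ 0 0%N); rewrite mulr0n mul0r. Qed.

Lemma sublinear_ge p : sublinear p -> forall y, - p (- y) <= p y.
Proof.
move=> sp y; have := sp.1 y (- y); rewrite subrr (sublinear0 sp); lra.
Qed.

Lemma additive_fun0 f : additive_fun f -> f 0 = 0.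
Proof. by move=> /(_ 0 0); rewrite addr0; lra. Qed.

Lemma additive_funN f : additive_fun f -> forall y, f (- y) = - f y.
Proof. by move=> af y; have := af y (- y); rewrite subrr (additive_fun0 af); lra. Qed.

Lemma additive_funMn f : additive_fun f -> forall y n, f (y *+ n) = n%:R * f y.
Proof.
move=> af y; elim=> [|n IH]; first by rewrite mulr0n mul0r additive_fun0.
by rewrite mulrSr af IH -natr1 mulrDl mul1r.
Qed.

(** [tighten p z] is a sublinear functional below [p] that is additive along
    [z]; a sublinear functional additive along every direction is additive. *)
Definition tighten (p : Z -> R) (z y : Z) : R :=
  inf (range (fun n : nat => p (y + z *+ n) - n%:R * p z)).

Section Tighten.
Variables (p : Z -> R) (z : Z).
Hypothesis sp : sublinear p.

Lemma tighten_lb y n : - p (- y) <= p (y + z *+ n) - n%:R * p z.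
Proof.
have := sp.1 (y + z *+ n) (- y); rewrite addrAC subrr add0r sp.2; lra.
Qed.

Lemma tighten_le_n y n : tighten p z y <= p (y + z *+ n) - n%:R * p z.
Proof. exact: inf_range_le (tighten_lb y) n. Qed.

Lemma tighten_le y : tighten p z y <= p y.
Proof. by have := tighten_le_n y 0; rewrite mulr0n addr0 mul0r subr0. Qed.

Lemma tightenN : tighten p z (- z) <= - p z.
Proof.
by have := tighten_le_n (- z) 1; rewrite mulr1n addNr (sublinear0 sp) mul1r sub0r.
Qed.

(** The extra [z *+ (m - n)] costs at most [(m - n)%:R * p z]. So the infimum may be computed along
    the multiples of any [n.+1], which is what the homogeneity of [tighten] needs. *)
Lemma tighten_mono y n m : (n <= m)%N ->
  p (y + z *+ m) - m%:R * p z <= p (y + z *+ n) - n%:R * p z.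
Proof.
move=> nm; have := sp.1 (y + z *+ n) (z *+ (m - n)).
rewrite -addrA -mulrnDr subnKC// sp.2 natrB//; lra.
Qed.

Lemma tighten_sublinear : sublinear (tighten p z).
Proof.
split=> [y y'|y n].
  rewrite -lerBlDr; apply: (le_inf_range 0%N) => n.
  rewrite lerBlDl -lerBlDr; apply: (le_inf_range 0%N) => m.
  rewrite lerBlDr; apply: le_trans (tighten_le_n _ (m + n)) _.
  have := sp.1 (y' + z *+ m) (y + z *+ n).
  by rewrite addrACA (addrC y') -mulrnDr natrD; lra.
case: n => [|n].
  rewrite mulr0n mul0r; apply/le_anti/andP; split.
    by apply: le_trans (tighten_le _) _; rewrite (sublinear0 sp).
  apply: (le_inf_range 0%N) => n; have := tighten_lb 0 n.
  by rewrite oppr0 (sublinear0 sp) oppr0.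
have E m : p (y *+ n.+1 + z *+ (m * n.+1)) - (m * n.+1)%:R * p z =
    n.+1%:R * (p (y + z *+ m) - m%:R * p z).
  by rewrite mulrnA -mulrnDl sp.2 natrM; ring.
apply/le_anti/andP; split.
  rewrite -ler_pdivrMl//; apply: (le_inf_range 0%N) => m.
  by rewrite ler_pdivrMl// -E; exact: tighten_le_n.
apply: (le_inf_range 0%N) => m.
apply: (@le_trans _ _ (n.+1%:R * (p (y + z *+ m) - m%:R * p z))).
  by rewrite ler_pM2l//; exact: tighten_le_n.
by rewrite -E; apply: tighten_mono; rewrite leq_pmulr.
Qed.
End Tighten.

Variable enum : nat -> Z.
Hypothesis enum_surj : forall z, exists n, enum n = z.

(** Tightening successively along an enumeration of the countable space takes the place of a
    maximality argument. Tightening along [z0] first forces [f (- z0) <= - p z0], hence equality at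
    [z0]. *)
Theorem Hahn_Banach (p : Z -> R) (z0 : Z) : sublinear p ->
  exists f, [/\ additive_fun f, forall z, f z <= p z & f z0 = p z0].
Proof.
move=> sp; pose P k := iteri k (fun i q => tighten q (enum i)) (tighten p z0).
have sP k : sublinear (P k) by elim: k => [|k IH]; exact: tighten_sublinear.
have P_le k y : P k.+1 y <= P k y by exact: tighten_le.
have P_mono y n m : (n <= m)%N -> P m y <= P n y.
  move=> nm; rewrite -(subnKC nm); elim: (m - n)%N => [|j IH].
    by rewrite addn0.
  by rewrite addnS; apply: le_trans IH.
have Pp k y : P k y <= p y.
  exact: le_trans (P_mono y 0%N k (leq0n k)) (tighten_le z0 sp y).
have Plb y k : - p (- y) <= P k y.
  by apply: le_trans (sublinear_ge (sP k) y); rewrite lerN2.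
pose f y := inf (range (P ^~ y)).
have fP y k : f y <= P k y by exact: (inf_range_le (Plb y)).
have fD y z : f (y + z) <= f y + f z.
  rewrite -lerBlDr; apply: (le_inf_range 0%N) => n.
  rewrite lerBlDl -lerBlDr; apply: (le_inf_range 0%N) => m.
  rewrite lerBlDr; apply: le_trans (fP _ (maxn n m)) _.
  apply: le_trans ((sP _).1 _ _) _; rewrite addrC.
  by apply: lerD; apply: P_mono; rewrite ?leq_maxl ?leq_maxr.
have fN z : f (- z) <= - f z.
  (* The direction [enum k] is tightened in passing from [P k] to [P k.+1], and the infimum [f] lies
     below both. *)
  have [k <-] := enum_surj z.
  apply: le_trans (fP _ k.+1) _; apply: le_trans (tightenN _ (sP k)) _.
  by rewrite lerN2.
have af : additive_fun f.
  move=> y z; apply/le_anti; rewrite fD /=.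
  by have := fD (y + z) (- z); have := fN z; rewrite addrK; lra.
exists f; split=> //; first by move=> z; exact: le_trans (fP z 0%N) (Pp _ _).
apply/le_anti; rewrite (le_trans (fP z0 0%N) (Pp _ _))/= -[leRHS]opprK lerNr.
rewrite -(additive_funN af); apply: le_trans (fP _ 0%N) _; exact: tightenN.
Qed.

(** Infimal convolution of [q] and [f + eta], then [Hahn_Banach]. *)
Lemma additive_perturbation (q eta f : Z -> R) :
  sublinear q -> sublinear eta -> (forall z, eta (- z) = eta z) ->
  additive_fun f -> (forall z, f z <= q z + eta z) ->
  exists h, [/\ additive_fun h, forall z, h z <= q z &
                forall z, `|h z - f z| <= eta z].
Proof.
move=> sq se eN af fq.
pose F z y := q (z - y) + f y + eta y.
have Flb z y : f z - eta z <= F z y.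
  have := fq (z - y); have := se.1 z (- y); rewrite eN.
  by rewrite af (additive_funN af) /F; lra.
pose r z := inf (range (F z)).
have rF z y : r z <= F z y by exact: (inf_range_le (Flb z)).
have sr : sublinear r.
  split=> [y y'|y n].
    rewrite -lerBlDr; apply: (le_inf_range 0) => u.
    rewrite lerBlDl -lerBlDr; apply: (le_inf_range 0) => v.
    rewrite lerBlDr; apply: le_trans (rF _ (v + u)) _.
    have := sq.1 (y' - v) (y - u); have := se.1 v u.
    by rewrite /F af opprD addrACA (addrC v) (addrC y'); lra.
  case: n => [|n].
    rewrite mulr0n mul0r; apply/le_anti/andP; split.
      apply: le_trans (rF 0 0) _.
      by rewrite /F subr0 (sublinear0 sq) (additive_fun0 af) (sublinear0 se); lra.
    apply: (le_inf_range 0) => y0; apply: le_trans (Flb 0 y0).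
    by rewrite (additive_fun0 af) (sublinear0 se); lra.
  have E z : F (y *+ n.+1) (z *+ n.+1) = n.+1%:R * F y z.
    by rewrite /F -mulrnBl sq.2 se.2 (additive_funMn af); ring.
  (* Every competitor for [y *+ n.+1] is the [n.+1]-th multiple of a competitor for [y]. *)
  have K z : z = (n.+1%:R^-1 *: z) *+ n.+1 :> Z.
    by rewrite -scaler_nat scalerA divff ?scale1r// pnatr_eq0.
  apply/le_anti/andP; split.
    rewrite -ler_pdivrMl//; apply: (le_inf_range 0) => z.
    by rewrite ler_pdivrMl// -E.
  by apply: (le_inf_range 0) => z; rewrite (K z) E ler_pM2l.
have [h [ah hr _]] := Hahn_Banach 0 sr.
exists h; split=> // z.
  apply: le_trans (hr z) _; apply: le_trans (rF z 0) _.
  by rewrite /F subr0 (additive_fun0 af) (sublinear0 se); lra.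
(* The competitor [0] gave [h <= q]; the competitor [y] itself gives this bound, which evenness of
   [eta] makes two-sided. *)
have H y : h y <= f y + eta y.
  by have := hr y; have := rF y y; rewrite /F subrr (sublinear0 sq); lra.
rewrite ler_norml; have := H z; have := H (- z).
by rewrite eN (additive_funN ah) (additive_funN af); lra.
Qed.

End HahnBanach.

(** * Seminorms on finitely supported rational sequences *)

Lemma cvg_div_exp2 (R : realType) (C : R) : C / 2 ^+ n @[n --> \oo] --> 0.
Proof.
rewrite -[X in _ --> X](mulr0 C); apply: cvgM; first exact: cvg_cst.
rewrite (_ : (fun n => (2 ^+ n)^-1) = GRing.exp 2^-1); last first.
  by apply/funext => n; rewrite exprVn.
by apply: cvg_expr; rewrite ger0_norm// invf_lt1// ltr1n.
Qed.

(** The estimate may start late: in the applications the threshold [K] depends on the sequence [z]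
    or on the point [x]. *)
Lemma geometric_cvg (R : realType) (V : completeNormedModType R) (u : nat -> V)
    (C : R) (K : nat) :
  (forall k, (K <= k)%N -> `|u k.+1 - u k| <= C / 2 ^+ k) ->
  exists2 l, u @ \oo --> l &
    forall k, (K <= k)%N -> `|l - u k| <= C * 2 / 2 ^+ k.
Proof.
move=> uC.
have C0 : 0 <= C.
  have := le_trans (normr_ge0 _) (uC K (leqnn K)).
  by rewrite pmulr_lge0// invr_gt0 exprn_gt0.
have B k j : (K <= k)%N -> `|u (k + j)%N - u k| <= C * 2 / 2 ^+ k.
  move=> Kk; apply: (@le_trans _ _ (C * 2 / 2 ^+ k - C * 2 / 2 ^+ (k + j))).
    elim: j => [|j IH]; first by rewrite addn0 !subrr normr0.
    rewrite addnS -(subrKA (u (k + j)%N)); apply: le_trans (ler_normD _ _) _.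
    have := uC (k + j)%N (leq_trans Kk (leq_addr _ _)).
    set x := C / 2 ^+ (k + j); rewrite (_ : _ / 2 ^+ (k + j) = x + x) in IH; last first.
      by rewrite /x; ring.
    rewrite (_ : C * 2 / 2 ^+ (k + j).+1 = x); last first.
      by rewrite /x exprS; field; rewrite expf_neq0.
    by move=> H; move: IH H; lra.
  by rewrite gerBl// divr_ge0// ?mulr_ge0// exprn_ge0.
have cu : cvg (u @ \oo).
  apply/cauchy_cvgP/cauchy_exP => e e0.
  have [k Kk ke] : exists2 k, (K <= k)%N & C * 2 / 2 ^+ k < e.
    have /cvgrPdist_lt/(_ e e0)[n _ hn] := cvg_div_exp2 (C * 2).
    exists (maxn K n); first exact: leq_maxl.
    have := hn (maxn K n) (leq_maxr _ _); rewrite /= sub0r normrN ger0_norm//.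
    by rewrite divr_ge0// ?mulr_ge0// exprn_ge0.
  exists (u k); exists k => // n /= kn; rewrite -ball_normE /=.
  by rewrite distrC -(subnKC kn); apply: le_lt_trans (B k _ Kk) ke.
exists (lim (u @ \oo)) => // k Kk.
have cl : `|u n - u k| @[n --> \oo] --> `|lim (u @ \oo) - u k|.
  by apply: cvg_norm; apply: cvgB; [exact: cu|exact: cvg_cst].
apply: (@closed_cvg _ _ _ _ _ (fun x => x <= C * 2 / 2 ^+ k) _ _ _ cl).
  exact: closed_le.
by exists k => // n /= kn; rewrite -(subnKC kn); exact: B.
Qed.

Lemma poly_sum_widen (K : nzRingType) (V : nmodType) (F : nat -> K -> V)
    (z : {poly K}) (n : nat) :
  (forall i, F i 0 = 0) -> (size z <= n)%N ->
  \sum_(i < size z) F i z`_i = \sum_(i < n) F i z`_i.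
Proof.
move=> F0 zn; rewrite (big_ord_widen n (fun i => F i z`_i))// big_mkcond /=.
apply: eq_bigr => i _; case: ltnP => // zi.
by rewrite nth_default.
Qed.

(** [{poly rat}] stands for the finitely supported rational sequences. *)
Section RatSeminorms.
Context {R : realType}.
Implicit Types (y z : {poly rat}) (p : {poly rat} -> R).

Definition rat_seminorm p :=
  (forall y z, p (y + z) <= p y + p z) /\
  (forall a z, p (a *: z) = `|ratr a| * p z).

Lemma rat_seminorm_sublinear p : rat_seminorm p -> sublinear p.
Proof.
move=> [pD pZ]; split=> // z n.
by rewrite -scaler_nat pZ ratr_nat ger0_norm.
Qed.

Lemma rat_seminormN p z : rat_seminorm p -> p (- z) = p z.
Proof. by move=> [_ pZ]; rewrite -scaleN1r pZ rmorphN1 normrN1 mul1r. Qed.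

Lemma rat_seminorm_ge0 p z : rat_seminorm p -> 0 <= p z.
Proof.
move=> sp; have := sp.1 z (- z).
by rewrite subrr (sublinear0 (rat_seminorm_sublinear sp)) (rat_seminormN z sp); lra.
Qed.

Lemma rat_seminorm_sum p n (F : nat -> {poly rat}) : rat_seminorm p ->
  p (\sum_(i < n) F i) <= \sum_(i < n) p (F i).
Proof.
move=> sp; elim: n => [|n IH].
  by rewrite !big_ord0 (sublinear0 (rat_seminorm_sublinear sp)).
by rewrite !big_ord_recr /=; apply: le_trans (sp.1 _ _) _; rewrite lerD2r.
Qed.

Definition wnorm (c : nat -> R) z : R := \sum_(i < size z) c i * `|ratr z`_i|.

Lemma wnormE c z n : (size z <= n)%N ->
  wnorm c z = \sum_(i < n) c i * `|ratr z`_i|.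
Proof.
move=> zn; rewrite /wnorm.
rewrite (@poly_sum_widen _ _ (fun i a => c i * `|ratr a|) _ n)// => i.
by rewrite rmorph0 normr0 mulr0.
Qed.

Lemma wnorm_seminorm c : (forall i, 0 <= c i) -> rat_seminorm (wnorm c).
Proof.
move=> c0; split=> [y z|a z].
  rewrite (@wnormE _ (y + z) (maxn (size y) (size z))) ?size_polyD//.
  rewrite (@wnormE _ y (maxn (size y) (size z))) ?leq_maxl//.
  rewrite (@wnormE _ z (maxn (size y) (size z))) ?leq_maxr//.
  rewrite -big_split; apply: ler_sum => i _ /=.
  by rewrite coefD rmorphD -mulrDr ler_wpM2l// ler_normD.
rewrite (@wnormE _ (a *: z) (size z)) ?size_scale_leq// /wnorm mulr_sumr.
by apply: eq_bigr => i _; rewrite coefZ rmorphM normrM mulrCA.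
Qed.

Lemma rat_seminorm_le_wnorm p z : rat_seminorm p -> (forall i, p 'X^i <= 1) ->
  p z <= wnorm (fun=> 1) z.
Proof.
move=> sp p1; rewrite -{1}[z]coefK poly_def.
apply: le_trans (rat_seminorm_sum _ (fun i => z`_i *: 'X^i) sp) _.
by apply: ler_sum => i _; rewrite sp.2 mul1r ler_piMr.
Qed.

Lemma wnorm_ge0 c z : (forall i, 0 <= c i) -> 0 <= wnorm c z.
Proof. by move=> c0; apply: sumr_ge0 => i _; rewrite mulr_ge0. Qed.

(** Two seminorms bounded by [1] on the ['X^i] that agree up to [2^-k] on the
    first [k] coordinates differ by at most [wnorm (level_weight k)]; these
    weights are summable in [k] for each sequence. *)
Definition level_weight (k i : nat) : R := if (i < k)%N then (2 ^+ k)^-1 else 2.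

Lemma level_weight_ge0 k i : 0 <= level_weight k i.
Proof. by rewrite /level_weight; case: ifP; rewrite // invr_ge0 exprn_ge0. Qed.

Lemma wnorm_level k z : (size z <= k)%N ->
  wnorm (level_weight k) z = wnorm (fun=> 1) z / 2 ^+ k.
Proof.
move=> zk; rewrite /wnorm mulr_suml; apply: eq_bigr => i _.
by rewrite /level_weight (leq_trans (ltn_ord i) zk) mul1r mulrC.
Qed.

(** Solves [(2 k + 1) / grid_size k = 2^-k]. *)
Definition grid_size (k : nat) : nat := ((2 * k).+1 * 2 ^ k)%N.

Lemma grid_size_gt0 k : (0 < grid_size k)%N.
Proof. by rewrite /grid_size muln_gt0 expn_gt0. Qed.

Definition grid (k : nat) (a : {ffun 'I_k -> 'I_(2 * grid_size k).+1}) :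
  {poly rat} :=
  \sum_(i < k) ((a i)%:R / (grid_size k)%:R - 1 : rat) *: 'X^i.

(** The coefficients lie in [-1, 1]. Shifted by 1 and rounded down to a multiple of
    [1 / grid_size k], each of the [k] of them loses at most [1 / grid_size k]. *)
Lemma grid_approx k z : (size z <= k)%N -> wnorm (fun=> 1) z = 1 ->
  exists a : {ffun 'I_k -> 'I_(2 * grid_size k).+1},
    wnorm (fun=> 1) (z - grid a) <= k%:R / (grid_size k)%:R.
Proof.
move: (grid_size_gt0 k); rewrite /grid; move: (grid_size k) => N N_gt0 zk z1.
have N0 : (0 < N%:R :> rat) by rewrite ltr0n.
have zi i : `|z`_i| <= 1.
  have [zi|iz] := leqP (size z) i; first by rewrite nth_default// normr0.
  have : `|ratr z`_i : R| <= 1.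
    rewrite -z1 /wnorm (bigD1 (Ordinal iz))//= mul1r lerDl.
    by apply: sumr_ge0 => j _; rewrite mul1r.
  by rewrite -ratr_norm -[X in _ <= X](rmorph1 (@ratr R)) ler_rat.
pose b (i : nat) := (Num.truncn ((z`_i + 1) * N%:R))%N.
have z10 i : 0 <= (z`_i + 1) * N%:R.
  by apply: mulr_ge0; [have := zi i; rewrite ler_norml => /andP[? ?]; lra|exact: ltW].
have bN i : (b i < (2 * N).+1)%N.
  rewrite ltnS -(ler_nat rat); apply: (@le_trans _ _ ((z`_i + 1) * N%:R)).
    by rewrite /b truncn_le.
  by rewrite natrM ler_pM2r//; have := zi i; rewrite ler_norml => /andP[? ?]; lra.
exists [ffun i : 'I_k => Ordinal (bN i)].
have -> : z - \sum_(i < k) (([ffun i : 'I_k => Ordinal (bN i)] i)%:R / N%:R - 1 : rat) *: 'X^i =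
    \poly_(i < k) (z`_i - ((b i)%:R / N%:R - 1)).
  rewrite poly_def -{1}[z]coefK poly_def.
  rewrite (@poly_sum_widen _ _ (fun i a => a *: 'X^i) _ k)//; last first.
    by move=> i; rewrite scale0r.
  by rewrite -sumrB; apply: eq_bigr => i _; rewrite ffunE -scalerBl.
rewrite (@wnormE _ _ k) ?size_poly//.
rewrite (_ : k%:R / N%:R = \sum_(i < k) N%:R^-1 :> R); last first.
  by rewrite sumr_const card_ord mulr_natl.
apply: ler_sum => i _; rewrite mul1r coef_poly ltn_ord.
rewrite -ratr_norm -(ratr_nat R N) -fmorphV ler_rat.
have := truncn_itv (z10 i); rewrite -/(b i) -natr1 => /andP[H1 H2].
have -> : z`_i - ((b i)%:R / N%:R - 1) = ((z`_i + 1) * N%:R - (b i)%:R) / N%:R.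
  by field; rewrite lt0r_neq0.
rewrite normrM normfV (ger0_norm (ltW N0)).
apply: ler_piMl; first by rewrite invr_ge0 ltW.
by rewrite ger0_norm; lra.
Qed.

End RatSeminorms.

(** * Simultaneous realization of a family of seminorms *)

Section Realization.
Context {R : realType} {X : Type} (p : X -> {poly rat} -> R).
Hypothesis sp : forall x, rat_seminorm (p x).
Hypothesis p1 : forall x i, p x 'X^i <= 1.

Implicit Types (y z : {poly rat}).

Local Notation l1 := (wnorm (fun=> 1 : R)).
Local Notation eta k := (wnorm (@level_weight R k)).

(** The label knows [p x] on the grid up to [1 / grid_size k]. The table is packed into a natural
    number so that words of labels form a countable type. *)
Definition label (k : nat) (x : X) : nat :=
  pickle [ffun a : {ffun 'I_k -> 'I_(2 * grid_size k).+1} =>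
    Num.floor ((grid_size k)%:R * p x (grid a))].

Let eta_seminorm k : rat_seminorm (eta k).
Proof. by apply: wnorm_seminorm => i; exact: level_weight_ge0. Qed.

Let l1_ge0 z : 0 <= l1 z. Proof. exact: wnorm_ge0. Qed.

Let p_l1 x z : p x z <= l1 z. Proof. exact: rat_seminorm_le_wnorm. Qed.

Let p_sublinear x : sublinear (p x).
Proof. exact: rat_seminorm_sublinear. Qed.

Let p_lip x y z : p x y <= p x z + l1 (y - z).
Proof.
rewrite -{1}(subrK z y) addrC; apply: le_trans ((sp x).1 _ _) _.
by rewrite lerD2l.
Qed.

(** Scale to [l1]-norm 1 and pass through a nearby grid point: two Lipschitz errors
    [k / grid_size k] and one floor error [1 / grid_size k] add up to [2^-k]. Equal labels are asked
    for [0 < k] only, since codes carry no label of level 0. *)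
Lemma label_close_finite k x x' : ((0 < k)%N -> label k x = label k x') ->
  forall z, (size z <= k)%N -> p x z <= p x' z + l1 z / 2 ^+ k.
Proof.
(* The [l1]-norm as a rational number, so that [z] can be normalized within [{poly rat}]. *)
move=> lx z zk; pose m : rat := \sum_(i < size z) `|z`_i|.
have mE : l1 z = ratr m.
  rewrite /wnorm /m rmorph_sum; apply: eq_bigr => i _.
  by rewrite mul1r -ratr_norm.
have m_ge0 : 0 <= m by apply: sumr_ge0.
have [m0|m0] := eqVneq m 0.
  apply: le_trans (p_l1 x z) _.
  by rewrite mE m0 rmorph0 mul0r addr0 rat_seminorm_ge0.
have m_gt0 : 0 < m by rewrite lt0r m0.
have k0 : (0 < k)%N.
  case: k zk {lx} => // /[!leqn0] /eqP z0; move: m0.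
  by rewrite /m z0 big_ord0 eqxx.
pose u := m^-1 *: z.
have zE : z = m *: u by rewrite /u scalerA divff// scale1r.
have mR : 0 < ratr m :> R by rewrite ltr0q.
have u1 : l1 u = 1.
  have sl1 : rat_seminorm l1 by exact: wnorm_seminorm.
  rewrite sl1.2 mE -ratr_norm -rmorphM /= ger0_norm ?invr_ge0//.
  by rewrite mulVf// rmorph1.
have [a ha] := grid_approx (leq_trans (size_scale_leq m^-1 z) zk) u1.
have N0 : 0 < (grid_size k)%:R :> R by rewrite ltr0n grid_size_gt0.
have fl : Num.floor ((grid_size k)%:R * p x (grid a)) =
    Num.floor ((grid_size k)%:R * p x' (grid a)).
  have /(pcan_inj pickleK)/ffunP/(_ a) := lx k0.
  by rewrite !ffunE.
have g1 : p x (grid a) <= p x' (grid a) + (grid_size k)%:R^-1.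
  rewrite -(ler_pM2l N0) mulrDr divff ?lt0r_neq0//.
  have /andP[_ h1] := Num.Theory.floor_itv ((grid_size k)%:R * p x (grid a)).
  have /andP[h2 _] := Num.Theory.floor_itv ((grid_size k)%:R * p x' (grid a)).
  by move: h1; rewrite fl intrD; move: h2; lra.
have h1 := le_trans (p_lip x u (grid a)) (lerD g1 ha).
have h2 := p_lip x' (grid a) u.
have e1 : l1 (grid a - u) = l1 (u - grid a).
  by rewrite -opprB rat_seminormN//; exact: wnorm_seminorm.
rewrite e1 in h2.
have h3 : p x u <= p x' u + (2 ^+ k)^-1.
  rewrite (_ : (2 ^+ k)^-1 = k%:R / (grid_size k)%:R + k%:R / (grid_size k)%:R
    + (grid_size k)%:R^-1 :> R); first by move: h1 h2 ha; lra.
  have k2 : 2 ^+ k != 0 :> R by rewrite expf_neq0.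
  have k3 : k%:R * 2 + 1 != 0 :> R by rewrite lt0r_neq0// ltr_wpDl// mulr_ge0.
  have -> : (grid_size k)%:R = (k%:R * 2 + 1) * 2 ^+ k :> R.
    by rewrite /grid_size natrM natrX -natr1 natrM [2%:R * _]mulrC.
  by field; rewrite k2 k3.
have pE w : p w z = ratr m * p w u by rewrite {1}zE (sp w).2 gtr0_norm.
by rewrite mE !pE -mulrDr ler_pM2l.
Qed.

(** Cut [z] after [k] coordinates. The tail is estimated by its [l1]-norm once for [p x] and once
    for [p x'], whence the value 2 of [level_weight] there. *)
Lemma label_close k x x' : ((0 < k)%N -> label k x = label k x') ->
  forall z, p x z <= p x' z + eta k z.
Proof.
move=> lx z; pose y := take_poly k z.
have h := label_close_finite lx (size_take_poly k z).
have h1 := p_lip x z y; have h2 := p_lip x' y z.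
have e1 : l1 (y - z) = l1 (z - y).
  by rewrite -opprB rat_seminormN//; exact: wnorm_seminorm.
rewrite -/y in h; rewrite e1 in h2.
suff : eta k z = l1 y / 2 ^+ k + l1 (z - y) + l1 (z - y).
  by move: h h1 h2; lra.
have [sy sz szy] : [/\ (size y <= maxn k (size z))%N,
    (size z <= maxn k (size z))%N & (size (z - y)%R <= maxn k (size z))%N].
  have sy := leq_trans (size_take_poly k z) (leq_maxl k (size z)).
  split=> //; first exact: leq_maxr.
  apply: leq_trans (size_polyD _ _) _.
  by rewrite size_polyN geq_max sy leq_maxr.
rewrite (wnormE _ sy) (wnormE _ sz) (wnormE _ szy) mulr_suml -!big_split.
apply: eq_bigr => i _ /=; rewrite coefB coef_take_poly /level_weight.
case: ifP => _; first by rewrite subrr rmorph0 normr0; ring.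
by rewrite subr0 rmorph0 normr0; ring.
Qed.

(** The cells of level [k] are the fibers of [code k]; a code lists its labels
    from the finest to the coarsest. *)
Fixpoint code (k : nat) (x : X) : seq nat :=
  if k is k'.+1 then label k x :: code k' x else [::].

Lemma size_code k x : size (code k x) = k.
Proof. by elim: k => //= k ->. Qed.

Lemma code_close k x x' : code k x = code k x' ->
  forall z, p x z <= p x' z + eta k z.
Proof. by move=> cx; apply: label_close; case: k cx => // k [->]. Qed.

(** [0] on the words that are not codes of points, as [sup set0 = 0]. *)
Definition cell_norm (c : seq nat) z : R :=
  sup [set p x z | x in [set x | code (size c) x = c]].

Lemma cell_norm_ge k x z : p x z <= cell_norm (code k x) z.
Proof.
apply: ub_le_sup; last by exists x => //=; rewrite size_code.
by exists (l1 z) => _ [x' _ <-].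
Qed.

Lemma cell_norm_le k x z b : (forall x', code k x' = code k x -> p x' z <= b) ->
  cell_norm (code k x) z <= b.
Proof.
move=> H; apply: ge_sup.
  by exists (p x z), x => //=; rewrite size_code.
by move=> _ [x' /= + <-]; rewrite size_code; exact: H.
Qed.

Lemma cell_norm_le_l1 c z : cell_norm c z <= l1 z.
Proof.
rewrite /cell_norm; set A := [set _ | _ in _].
have [[a Aa]|A0] := pselect (A !=set0).
  by apply: ge_sup; [exists a|move=> _ [x _ <-]].
suff -> : A = set0 by rewrite sup0.
by apply: contrapT => /eqP/set0P.
Qed.

Lemma cell_norm_sublinear k x : sublinear (cell_norm (code k x)).
Proof.
split=> [y z|z n].
  apply: cell_norm_le => x' cx; apply: le_trans ((sp x').1 _ _) _.
  by rewrite -cx; apply: lerD; exact: cell_norm_ge.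
apply/le_anti/andP; split.
  apply: cell_norm_le => x' cx.
  by rewrite (p_sublinear x').2 -cx ler_wpM2l// cell_norm_ge.
case: n => [|n].
  rewrite mul0r; apply: le_trans (cell_norm_ge k x _).
  exact: rat_seminorm_ge0.
rewrite -ler_pdivlMl//; apply: cell_norm_le => x' cx.
by rewrite ler_pdivlMl// -(p_sublinear x').2 -cx cell_norm_ge.
Qed.

(** The domain of the bounded functions: only the functions on it have to be countably many, not the
    functionals. *)
Definition functionals : Type :=
  {s : X * ({poly rat} -> R) | additive_fun s.2 /\ forall z, s.2 z <= p s.1 z}.

Implicit Types s : functionals.

(** The functional of [s] lives on the cells containing its base point, and is
    moved to every other cell [a :: c] from its parent [c] by a perturbation of
    size [eta (size c)]; the value off the codes of points is irrelevant, but
    bounded. *)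
Fixpoint transport (c : seq nat) s : {poly rat} -> R :=
  if c is a :: c' then
    if code (size c) (sval s).1 == c then (sval s).2
    else xget (transport c' s) [set h | [/\ additive_fun h,
           forall z, h z <= cell_norm c z &
           forall z, `|h z - transport c' s z| <= eta (size c') z]]
  else (sval s).2.

Lemma transport_base k s : transport (code k (sval s).1) s = (sval s).2.
Proof. by case: k => //= k; rewrite size_code eqxx. Qed.

Lemma transport_additive c s : additive_fun (transport c s).
Proof.
elim: c => [|a c IH]; first exact: (svalP s).1.
rewrite /=; case: ifP => _; first exact: (svalP s).1.
by case: xgetP => // h _ [].
Qed.

Lemma transport_le_l1 c s z : transport c s z <= l1 z.
Proof.
have base : (sval s).2 z <= l1 z by exact: le_trans ((svalP s).2 z) (p_l1 _ _).
elim: c => [|a c IH] //=; case: ifP => // _.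
case: xgetP => // h _ [_ hc _].
exact: le_trans (hc z) (cell_norm_le_l1 _ _).
Qed.

Lemma additive_norm_le (f : {poly rat} -> R) q : additive_fun f ->
  (forall z, q (- z) = q z) -> (forall z, f z <= q z) -> forall z, `|f z| <= q z.
Proof.
move=> af qN fq z; rewrite ler_norml fq andbT -qN lerNl -additive_funN//.
Qed.

Lemma transport_bounded c z s : `|transport c s z| <= l1 z.
Proof.
apply: additive_norm_le (transport_additive c s) _ (transport_le_l1 c s) _.
by move=> y; apply: rat_seminormN; exact: wnorm_seminorm.
Qed.

Let enumZ (n : nat) : {poly rat} := odflt 0 (unpickle n).
Let enumZ_surj z : exists n, enumZ n = z.
Proof. by exists (pickle z); rewrite /enumZ pickleK. Qed.

(** Domination at level [k] is what permits the move to level [k.+1], because the supremum over a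
    cell exceeds the supremum over a subcell by at most [eta k]. So the two claims are proved
    together by induction. *)
Lemma transportP k x s :
  (forall z, transport (code k x) s z <= cell_norm (code k x) z) /\
  (forall z, `|transport (code k.+1 x) s z - transport (code k x) s z| <= eta k z).
Proof.
have step j : (forall z, transport (code j x) s z <= cell_norm (code j x) z) ->
    (forall z, transport (code j.+1 x) s z <= cell_norm (code j.+1 x) z) /\
    (forall z, `|transport (code j.+1 x) s z - transport (code j x) s z| <= eta j z).
  move=> IH; have [E|E] := eqVneq (code j.+1 (sval s).1) (code j.+1 x).
    have E' : code j (sval s).1 = code j x by case: E.
    rewrite -E -E' !transport_base; split=> z.
      exact: le_trans ((svalP s).2 z) (cell_norm_ge _ _ _).
    by rewrite subrr normr0 rat_seminorm_ge0.
  rewrite [transport (code j.+1 x) s]/= size_code ifN//.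
  (* The default branch is refuted by [additive_perturbation], whose last hypothesis is the
     comparison of the two suprema. *)
  case: xgetP => [h _ [_ h1 h2]|/(_ _)none].
    by split=> // z; have := h2 z; rewrite size_code.
  have [] := @additive_perturbation R _ enumZ enumZ_surj (cell_norm (code j.+1 x))
     (eta j) (transport (code j x) s).
  - exact: cell_norm_sublinear.
  - exact: rat_seminorm_sublinear.
  - by move=> z; exact: rat_seminormN.
  - exact: transport_additive.
  - move=> z; apply: le_trans (IH z) _; apply: cell_norm_le => x' cx.
    apply: le_trans (code_close cx z) _.
    by rewrite lerD2r; exact: cell_norm_ge.
  by move=> h [ah h1 h2]; exfalso; apply: (none h); split=> // z; rewrite size_code.
suff H : forall z, transport (code k x) s z <= cell_norm (code k x) z.
  by split=> //; exact: (step k H).2.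
elim: k => [|k IH]; last exact: (step k IH).1.
(* Level 0 has a single cell, which contains every base point. *)
move=> z; apply: le_trans ((svalP s).2 z) _.
exact: (cell_norm_ge 0 (sval s).1).
Qed.

Let gen (n : nat) : functionals -> R :=
  if (unpickle n : option (seq nat * {poly rat})) is Some (c, z)
  then fun s => transport c s z else fun=> 0.

Let gen_bounded n : exists M, forall s, `|gen n s| <= M.
Proof.
rewrite /gen; case: unpickle => [[c z]|]; last by exists 0 => s; rewrite normr0.
by exists (l1 z) => s; exact: transport_bounded.
Qed.

Definition realization_space : separableBanach R := uspan_Banach gen_bounded.

Lemma cell_vector_subproof c z : (fun s => transport c s z) \in uniform_span gen.
Proof.
apply/asboolP => e e0; exists [:: (1, pickle (c, z))] => s.
rewrite /rat_comb big_seq1 /gen pickleK rmorph1 mul1r subrr normr0.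
exact: ltW.
Qed.

Definition cell_vector c z : realization_space := USpan (cell_vector_subproof c z).

Lemma cell_vector_cauchy x z k : (size z <= k)%N ->
  `|cell_vector (code k.+1 x) z - cell_vector (code k x) z| <= l1 z / 2 ^+ k.
Proof.
move=> zk; apply: uspan_norm_le; first by rewrite divr_ge0// exprn_ge0.
by move=> s; rewrite -wnorm_level//; exact: (transportP k x s).2.
Qed.

Definition realize (x : X) z : realization_space :=
  lim ((fun k => cell_vector (code k x) z) @ \oo).

Lemma realize_cvg x z : (fun k => cell_vector (code k x) z) @ \oo --> realize x z.
Proof.
have [l ul _] := geometric_cvg (@cell_vector_cauchy x z).
by apply/cvg_ex; exists l.
Qed.

Lemma realizeD x y z : realize x (y + z) = realize x y + realize x z.
Proof.
apply/cvg_lim => //.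
rewrite (_ : (fun k => _) = (fun k => cell_vector (code k x) y + cell_vector (code k x) z)).
  by apply: cvgD; exact: realize_cvg.
apply/funext => k; apply: val_inj; apply/funext => s /=.
exact: transport_additive.
Qed.

Lemma realize_norm x z : `|realize x z| = p x z.
Proof.
have h : `|cell_vector (code k x) z| @[k --> \oo] --> `|realize x z|.
  by apply: cvg_norm; exact: realize_cvg.
apply: (cvg_unique _ h) => //.
have eta0 : eta k z @[k --> \oo] --> 0.
  apply: cvg_trans (cvg_div_exp2 (l1 z)); apply: near_eq_cvg.
  by exists (size z) => // k /= zk; rewrite wnorm_level.
have up : p x z + eta k z @[k --> \oo] --> p x z.
  by rewrite -[X in _ --> X]addr0; apply: cvgD => //; exact: cvg_cst.
apply: (squeeze_cvgr _ (cvg_cst (p x z)) up); apply: nearW => k.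
apply/andP; split.
  (* A functional attaining [p x z], based at [x]: its value at [z] is unchanged at every level and
     bounds the norm from below. *)
  have [f [af fp fz]] := Hahn_Banach enumZ_surj z (p_sublinear x).
  pose s : functionals := exist _ (x, f) (conj af fp).
  have sE : transport (code k x) s = f := transport_base k s.
  rewrite -fz -sE; apply: le_trans (ler_norm _) _.
  exact: (uspan_norm_ge gen_bounded (cell_vector (code k x) z) s).
apply: uspan_norm_le => [|s].
  by rewrite addr_ge0// rat_seminorm_ge0.
(* Every transported functional lies below the supremum over the cell of [x], which exceeds [p x z]
   by at most [eta k z]. *)
apply: (@le_trans _ _ (cell_norm (code k x) z)); last first.
  by apply: cell_norm_le => x' cx; exact: code_close.
apply: additive_norm_le (transport_additive _ _) _ (transportP k x s).1 _ => y.
congr sup; apply/seteqP; split => _ [x' cx <-]; exists x' => //.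
  by rewrite rat_seminormN.
by rewrite rat_seminormN.
Qed.

End Realization.

(** * Measurable maps into a separable Banach space *)

Definition least (P : nat -> Prop) : nat :=
  xget 0%N [set n | P n /\ forall m, (m < n)%N -> ~ P m].

Lemma least_lt (P : nat -> Prop) n : P n ->
  P (least P) /\ forall m, (m < least P)%N -> ~ P m.
Proof.
move=> Pn; rewrite /least; case: xgetP => [m _ //|/= none]; exfalso.
elim/ltn_ind: n Pn => n IH Pn; by apply: (none n).
Qed.

Lemma leastP (P : nat -> Prop) : (exists n, P n) -> P (least P).
Proof. by case=> n /least_lt[]. Qed.

Section MeasurableSets.
Context {R : realType} {d : measure_display} {X : measurableType d}.

Lemma measurable_set_lt (f g : X -> R) :
  measurable_fun setT f -> measurable_fun setT g ->
  measurable [set x | f x < g x].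
Proof.
move=> mf mg; have mfg := measurable_fun_ltr mf mg.
have := mfg measurableT [set true] Logic.I; rewrite setTI.
by [].
Qed.

Lemma measurable_set_le (f g : X -> R) :
  measurable_fun setT f -> measurable_fun setT g ->
  measurable [set x | f x <= g x].
Proof.
move=> mf mg; have mfg := measurable_fun_ler mf mg.
have := mfg measurableT [set true] Logic.I; rewrite setTI.
by [].
Qed.

Lemma measurable_set_not (P : X -> Prop) :
  measurable [set x | P x] -> measurable [set x | ~ P x].
Proof. exact: measurableC. Qed.

Lemma measurable_set_and (P Q : X -> Prop) :
  measurable [set x | P x] -> measurable [set x | Q x] ->
  measurable [set x | P x /\ Q x].
Proof. exact: measurableI. Qed.

Lemma measurable_set_exists (T : countType) (P : T -> X -> Prop) :
  (forall t, measurable [set x | P t x]) -> measurable [set x | exists t, P t x].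
Proof.
move=> mP; rewrite (_ : [set x | _] = \bigcup_(t in [set: T]) [set x | P t x]).
  by apply: countable_bigcupT_measurable => //; exact: countableP.
by apply/seteqP; split => x /= [t]; [move=> ?; exists t|exists t].
Qed.

Lemma measurable_set_forall (T : countType) (P : T -> X -> Prop) :
  (forall t, measurable [set x | P t x]) -> measurable [set x | forall t, P t x].
Proof.
move=> mP; rewrite (_ : [set x | _] = [set x | ~ exists t, ~ P t x]).
  apply: measurable_set_not; apply: measurable_set_exists => t.
  exact: measurable_set_not.
apply/seteqP; split => x /= H; first by case=> t; apply.
by move=> t; apply: contrapT => nP; apply: H; exists t.
Qed.

Lemma measurable_set_cst (P : Prop) : measurable [set x : X | P].
Proof.
have [p|np] := pselect P.
  by rewrite (_ : [set _ | _] = setT)//; apply/seteqP; split.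
by rewrite (_ : [set _ | _] = set0)//; apply/seteqP; split.
Qed.

(** For a countable codomain this is measurability for the discrete sigma-algebra. *)
Definition measurable_levels (T : Type) (N : X -> T) :=
  forall t, measurable [set x | N x = t].

Lemma measurable_least (P : nat -> X -> Prop) :
  (forall n, measurable [set x | P n x]) ->
  measurable_levels (fun x => least (P ^~ x)).
Proof.
move=> mP n.
have mlt k : measurable [set x | forall m, (m < k)%N -> ~ P m x].
  apply: measurable_set_forall => m; have [mk|mk] := boolP (m < k)%N.
    rewrite (_ : [set x | _] = [set x | ~ P m x]).
      exact: measurable_set_not.
    by apply/seteqP; split=> x /= H => [|_] //; exact: H.
  by rewrite (_ : [set x | _] = setT)//; apply/seteqP; split.
(* The second alternative accounts for the default value 0 of [least], taken where no [P m x]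
   holds. *)
rewrite (_ : [set x | _] =
  [set x | (P n x /\ forall m, (m < n)%N -> ~ P m x) \/
           (n = 0%N /\ forall m, ~ P m x)]); last first.
  apply/seteqP; split => x /=.
    move=> <-; have [[k Pk]|H] := pselect (exists k, P k x).
      by left; exact: (least_lt Pk).
    have none m : ~ P m x by move=> Pm; apply: H; exists m.
    right; split=> //; rewrite /least; case: xgetP => // m _ [Pm _].
    by case: (none m).
  case=> [[Pn lt]|[-> none]].
    have [Pl ltl] := @least_lt (P ^~ x) n Pn.
    case: (ltngtP n (least (P ^~ x))) => // h; first by case: (ltl n h).
    by case: (lt _ h).
  by rewrite /least; case: xgetP => // m _ [Pm _]; case: (none m).
apply: measurableU; first exact: measurable_set_and.
apply: measurable_set_and; first exact: measurable_set_cst.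
by apply: measurable_set_forall => m; exact: measurable_set_not.
Qed.

Lemma measurable_levels_ffun (T : finType) (U : eqType) (N : T -> X -> U) :
  (forall t, measurable_levels (N t)) ->
  measurable_levels (fun x => [ffun t => N t x]).
Proof.
move=> mN f; rewrite (_ : [set x | _] = [set x | forall t, N t x = f t]).
  by apply: measurable_set_forall => t; exact: mN.
by apply/seteqP; split => x /= => [<- t|H]; [|apply/ffunP => t]; rewrite ffunE.
Qed.

Lemma measurable_levels_comp (T : countType) (U : Type) (N : X -> T) (h : T -> U) :
  measurable_levels N -> measurable_levels (h \o N).
Proof.
move=> mN u; rewrite (_ : [set x | _] = [set x | exists t, N x = t /\ h t = u]).
  apply: measurable_set_exists => t; apply: measurable_set_and => //.
  exact: measurable_set_cst.
by apply/seteqP; split => x /= => [<-|[t [-> //]]]; exists (N x).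
Qed.

Lemma measurable_levels_pair (T U : Type) (N : X -> T) (M : X -> U) :
  measurable_levels N -> measurable_levels M ->
  measurable_levels (fun x => (N x, M x)).
Proof.
move=> mN mM [t u]; rewrite (_ : [set x | _] = [set x | N x = t /\ M x = u]).
  exact: measurable_set_and.
by apply/seteqP; split => x /= [-> ->].
Qed.

Lemma measurable_levels_floor (f : X -> R) : measurable_fun setT f ->
  measurable_levels (fun x => Num.floor (f x)).
Proof.
move=> mf m; rewrite (_ : [set x | _] = [set x | m%:~R <= f x /\ f x < (m + 1)%:~R]).
  apply: measurable_set_and; first exact: measurable_set_le.
  exact: measurable_set_lt.
apply/seteqP; split => x /=.
  by move=> <-; have /andP[] := Num.Theory.floor_itv (f x).
by move=> [h1 h2]; apply: Num.Theory.floor_def; rewrite h1.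
Qed.

End MeasurableSets.

Section BanachValued.
Context {R : realType} {B : separableBanach R}.
Context {d : measure_display} {X : measurableType d}.

Definition mfunB (f : X -> B) := measurable_fun setT (f : X -> borel B).

Lemma mfunB_cst (b : B) : mfunB (fun=> b).
Proof. exact: (@measurable_cst _ _ X (borel B) setT b). Qed.

Lemma mfunB_dist (f g : X -> B) : mfunB f -> mfunB g ->
  measurable_fun setT (fun x => `|f x - g x|).
Proof.
move=> mf mg; apply: borel_measurable_norm.
rewrite (_ : (fun x => _) = (fun x => f x + (-1 : R) *: g x)); last first.
  by apply/funext => x; rewrite scaleN1r.
apply: borel_measurableD => //.
by apply: (@borel_measurableZ _ _ _ _ (fun=> -1)) => //; exact: measurable_cst.
Qed.

Lemma mfunB_ball (f : X -> B) :
  (forall b (r : R), measurable [set x | `|f x - b| < r]) -> mfunB f.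
Proof.
move=> H; apply/borel_measurableP => O oO.
have [u du] := separable_seq B.
pose r (k : nat) : R := k.+1%:R^-1.
have -> : f @^-1` O = [set x | exists i : nat * nat,
    ball (u i.1) (r i.2) `<=` O /\ `|f x - u i.1| < r i.2].
  apply/seteqP; split => x /=; last first.
    by move=> [i [iO fi]]; apply: iO; rewrite -ball_normE /= distrC.
  move=> Ox; have /nbhs_ballP[e /= e0 He] := open_nbhs_nbhs (conj oO Ox).
  have e20 : 0 < e / 2 by rewrite divr_gt0.
  have := near_infty_natSinv_lt (PosNum e20) => -[k _ /(_ k (leqnn k)) /= hk].
  have r0 : 0 < r k by rewrite invr_gt0.
  have [n hn] := du (f x) (r k) r0.
  exists (n, k); split => /=; last first.
    by move: hn; rewrite -ball_normE.
  move=> b hb; apply: He; apply: (@le_ball _ _ _ (r k + r k)).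
    by rewrite [e]splitr lerD// ltW.
  exact: ball_triangle hn hb.
apply: measurable_set_exists => i; apply: measurable_set_and => //.
exact: measurable_set_cst.
Qed.

(** Countably many measurable maps are pasted along a measurable index; the approximants of every
    limit construction that follows have this form. *)
Lemma mfunB_levels (T : countType) (N : X -> T) (f : T -> X -> B) :
  measurable_levels N -> (forall t, mfunB (f t)) -> mfunB (fun x => f (N x) x).
Proof.
move=> mN mf; apply: mfunB_ball => b r.
rewrite (_ : [set x | _] = [set x | exists t, N x = t /\ `|f t x - b| < r]).
  apply: measurable_set_exists => t; apply: measurable_set_and => //.
  apply: measurable_set_lt; last exact: measurable_cst.
  by apply: mfunB_dist => //; exact: mfunB_cst.
by apply/seteqP; split => x /= => [H|[t [-> //]]]; exists (N x).
Qed.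

Lemma mfunB_if (A : set X) (f g : X -> B) : measurable A -> mfunB f -> mfunB g ->
  mfunB (fun x => if `[< A x >] then f x else g x).
Proof.
move=> mA mf mg.
apply: (@mfunB_levels bool (fun x => `[< A x >]) (fun t x => if t then f x else g x)).
  case; last rewrite (_ : [set x | _] = [set x | ~ A x]).
  - rewrite (_ : [set x | _] = A)//.
    by apply/seteqP; split => x /= => [/asboolP|/asboolP].
  - exact: measurable_set_not.
  - by apply/seteqP; split => x /= => [/negbT/asboolPn//|Ax]; apply/negbTE/asboolPn.
by case.
Qed.

Lemma mfunB_lim (f : nat -> X -> B) (l : X -> B) : (forall n, mfunB (f n)) ->
  (forall x, f ^~ x @ \oo --> l x) -> mfunB l.
Proof.
move=> mf fl; apply: mfunB_ball => b r; apply: measurable_set_lt => //.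
apply: (@measurable_fun_cvg _ _ _ setT (fun n x => `|f n x - b|)) => [n|x _].
  by apply: mfunB_dist => //; exact: mfunB_cst.
by apply: cvg_norm; apply: cvgB; [exact: fl|exact: cvg_cst].
Qed.

End BanachValued.

Lemma realize_measurable (R : realType) (d : measure_display)
    (X : measurableType d) (p : X -> {poly rat} -> R)
    (sp : forall x, rat_seminorm (p x)) (p1 : forall x i, p x 'X^i <= 1) :
  (forall z, measurable_fun setT (p ^~ z)) ->
  forall z, mfunB (fun x => realize sp p1 x z).
Proof.
move=> mp z; apply: (@mfunB_lim _ _ _ _ (fun k x => cell_vector sp p1 (code p k x) z)).
  (* The approximant of level [k] depends on [x] only through its code, so it takes countably many
     values. *)
  move=> k; apply: (@mfunB_levels _ _ _ _ _ (code p k) (fun c _ => cell_vector sp p1 c z)).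
    elim: k => [|k IH] /=; first by move=> t; exact: measurable_set_cst.
    apply: (@measurable_levels_comp _ _ _ _ (fun x => (label p k.+1 x, code p k x))
      (fun t => t.1 :: t.2)).
    apply: measurable_levels_pair => //.
    apply: (@measurable_levels_comp _ _ _ _ _ pickle).
    apply: measurable_levels_ffun => a; apply: measurable_levels_floor.
    by apply: measurable_funM; [exact: measurable_cst|exact: mp].
  by move=> c; exact: mfunB_cst.
by move=> x; exact: realize_cvg.
Qed.

(** * Measurable sections *)

Lemma exp2V_gt0 (R : realType) k : 0 < (2 ^+ k)^-1 :> R.
Proof. by rewrite invr_gt0 exprn_gt0. Qed.

Lemma exp2V_lt (R : realType) (e : R) : 0 < e -> exists k : nat, (2 ^+ k)^-1 < e.
Proof.
move=> e0; have /cvgrPdist_lt/(_ e e0)[n _ /(_ n (leqnn n))] := cvg_div_exp2 (1 : R).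
by rewrite /= sub0r normrN mul1r gtr0_norm ?exp2V_gt0//; exists n.
Qed.

Lemma exp2VS (R : realType) k : (2 ^+ k.+1)^-1 = (2 ^+ k)^-1 / 2 :> R.
Proof. by rewrite exprS; field; rewrite expf_neq0. Qed.

(** Centers of small radius are close to each other, so they form a Cauchy sequence. Taking least
    indices makes the sequence canonical, hence measurable when [b] and [r] depend measurably on a
    point. *)
Lemma dense_limit (R : realType) (V : completeNormedModType R) (b : nat -> V)
    (r : nat -> R) :
  (forall n m, `|b n - b m| <= r n + r m) ->
  (forall e, 0 < e -> exists n, r n < e) ->
  exists2 l, (fun k => b (least (fun n => r n < (2 ^+ k)^-1))) @ \oo --> l &
    forall n, `|l - b n| <= r n.
Proof.
move=> bb rr; pose idx k := least (fun n => r n < (2 ^+ k)^-1).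
have idxP k : r (idx k) < (2 ^+ k)^-1.
  by apply: (@leastP (fun n => r n < (2 ^+ k)^-1)); apply: rr; exact: exp2V_gt0.
have [|l ul _] := @geometric_cvg R V (fun k => b (idx k)) 2 0.
  move=> k _; apply: le_trans (bb _ _) _.
  have := idxP k; have := idxP k.+1; rewrite exp2VS.
  by have := exp2V_gt0 R k; lra.
exists l => // n.
have cl : `|b (idx k) - b n| @[k --> \oo] --> `|l - b n|.
  by apply: cvg_norm; apply: cvgB; [exact: ul|exact: cvg_cst].
have cr : r n + 1 / 2 ^+ k @[k --> \oo] --> r n.
  by rewrite -[X in _ --> X]addr0; apply: cvgD; [exact: cvg_cst|exact: cvg_div_exp2].
apply: (ler_cvg_to cl cr); apply: nearW => k.
by apply: le_trans (bb _ _) _; rewrite addrC lerD2l mul1r ltW.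
Qed.

Section Bundle.
Context {R : realType} {B : separableBanach R}.
Context {d : measure_display} {X : measurableType d}.

Lemma gr_approx (G : Grassmannian B) (v : B) :
  (forall e : R, 0 < e -> exists2 w, gr_set G w & `|v - w| < e) -> gr_set G v.
Proof.
move=> H; apply: (gr_closed (g := G)) => A /nbhs_ballP[e /= e0 He].
have [w Gw vw] := H e e0; exists w; split=> //; apply: He.
by rewrite -ball_normE.
Qed.

Variable E : Banach_bundle B X.

Section Selection.
Variables (u : nat -> B) (n0 k0 : nat).
Hypothesis u_dense : forall x (e : R), 0 < e -> exists n, ball x e (u n).

Let hits (r : R) n x := exists2 w, gr_set (E x) w & `|u n - w| < r.

Let measurable_hits r n : measurable [set x | hits r n x].
Proof.
have := fiber_measurable E (ball_open (u n) r); congr measurable.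
apply/seteqP; split => x /= [w]; last by rewrite -ball_normE; exists w.
by move=> [Ew]; rewrite -ball_normE; exists w.
Qed.

Let rho j : R := (2 ^+ (k0 + j))^-1.

Fixpoint selector (j : nat) (x : X) : nat :=
  if j is i.+1 then
    least (fun m => hits (rho j) m x /\
      `|u m - u (selector i x)| < rho i + rho j)
  else n0.

Let selectorP x : hits (rho 0) n0 x ->
  forall j, hits (rho j) (selector j x) x /\
    `|u (selector j.+1 x) - u (selector j x)| < rho j + rho j.+1.
Proof.
move=> h0.
have step j : hits (rho j) (selector j x) x -> hits (rho j.+1) (selector j.+1 x) x /\
    `|u (selector j.+1 x) - u (selector j x)| < rho j + rho j.+1.
  move=> [w Ew uw] /=.
  apply: (@leastP (fun m => hits (rho j.+1) m x /\
    `|u m - u (selector j x)| < rho j + rho j.+1)).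
  (* A dense point near the fiber vector [w] that certified the previous index; the triangle
     inequality through [w] bounds the jump. *)
  have [m] := u_dense w (exp2V_gt0 R (k0 + j.+1)).
  rewrite -ball_normE /= => wm; exists m; split.
    by exists w => //; rewrite distrC.
  rewrite [ltRHS]addrC -(subrKA w); apply: le_lt_trans (ler_normD _ _) _.
  by rewrite distrC; apply: ltrD => //; rewrite distrC.
suff H j : hits (rho j) (selector j x) x by move=> j; split=> //; exact: (step j (H j)).2.
by elim: j => // j /step[].
Qed.

Let measurable_selector j : measurable_levels (selector j).
Proof.
elim: j => [|j IH] /=; first by move=> n; exact: measurable_set_cst.
apply: measurable_least => m; apply: measurable_set_and => //.
apply: measurable_set_lt; last exact: measurable_cst.
apply: mfunB_dist; first exact: mfunB_cst.
by apply: (@mfunB_levels _ _ _ _ _ (selector j) (fun n _ => u n)) => // n; exact: mfunB_cst.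
Qed.

(** Kuratowski-Ryll-Nardzewski, with values close to [u n0]. *)
Lemma selection : exists s : bundle_section E, forall x v,
  gr_set (E x) v -> `|u n0 - v| < (2 ^+ k0)^-1 ->
  `|v - s x| <= 6 / 2 ^+ k0.
Proof.
pose A := [set x | hits (rho 0) n0 x].
(* Where the fiber misses the initial ball the section is 0, which lies in every fiber. *)
pose f j x := if `[< A x >] then u (selector j x) else 0.
have rho0 : rho 0 = (2 ^+ k0)^-1 by rewrite /rho addn0.
have rhoE j : rho j = rho 0 / 2 ^+ j by rewrite rho0 /rho exprD invfM.
have fP x : exists2 l, f^~ x @ \oo --> l &
    gr_set (E x) l /\ (A x -> `|l - u n0| <= 4 / 2 ^+ k0).
  rewrite /f; case: asboolP => Ax; last first.
    by exists 0; [exact: cvg_cst|split=> //; exact: gr_zero].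
  (* Jumps are at most [2 * rho j], so the limit is within [4 * rho 0] of [u n0]. Adding the
     distance from [v] to [u n0] gives 5, and 6 leaves slack. *)
  have [|l ul hl] := @geometric_cvg R B (fun j => u (selector j x)) (2 * rho 0) 0.
    move=> j _; have [_ /ltW/le_trans] := selectorP Ax j; apply.
    rewrite -mulrA -rhoE {2}/rho addnS exp2VS -/(rho j).
    by have := exp2V_gt0 R (k0 + j); rewrite -/(rho j); lra.
  exists l => //; split=> [|_]; last first.
    apply: le_trans (hl 0%N isT) _; rewrite expr0 divr1 rho0 -rho0.
    by rewrite rho0; lra.
  apply: gr_approx => e e0; have e20 : 0 < e / 2 by rewrite divr_gt0.
  have /cvgrPdist_lt/(_ _ e20)[a _ ha] := ul.
  have /cvgrPdist_lt/(_ _ e20)[b _ hb] := cvg_div_exp2 (rho 0).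
  have [w Ew uw] := (selectorP Ax (maxn a b)).1.
  exists w => //; rewrite [e]splitr -(subrKA (u (selector (maxn a b) x))).
  apply: le_lt_trans (ler_normD _ _) _; apply: ltrD.
    exact: ha _ (leq_maxl _ _).
  apply: lt_trans uw _; have := hb _ (leq_maxr a b).
  by rewrite /= sub0r normrN -rhoE gtr0_norm// exp2V_gt0.
pose l x := sval (cid2 (fP x)).
have lP x : f^~ x @ \oo --> l x by exact: (svalP (cid2 (fP x))).1.
have [lE lA] : (forall x, gr_set (E x) (l x)) /\
    (forall x, A x -> `|l x - u n0| <= 4 / 2 ^+ k0).
  by split=> x; have [] := (s2valP' (cid2 (fP x))).
have ml : mfunB l.
  apply: (@mfunB_lim _ _ _ _ f) => // j; apply: mfunB_if.
  - exact: measurable_hits.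
  - by apply: (@mfunB_levels _ _ _ _ _ (selector j) (fun n _ => u n)) => // n;
      exact: mfunB_cst.
  - exact: mfunB_cst.
exists (BundleSection ml lE) => x v Ev uv /=.
have Ax : A x by exists v => //; rewrite rho0.
have lu := lA x Ax; rewrite -(subrKA (u n0)).
apply: le_trans (ler_normD _ _) _; rewrite [`|v - _|]distrC [`|u n0 - l x|]distrC.
by have := ltW uv; have := exp2V_gt0 R k0; move: lu; lra.
Qed.

End Selection.

(** One selection for each dense point [u n] and each radius [2^-k]; a fiber vector is close to the
    selection of any small ball that contains it. *)
Lemma Castaing : exists s : nat -> bundle_section E,
  forall x v (e : R), gr_set (E x) v -> 0 < e -> exists n, `|v - s n x| < e.
Proof.
have [u du] := separable_seq B.
have sel (nk : nat * nat) := cid (@selection u nk.1 nk.2 du).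
exists (fun i => sval (sel (odflt (0, 0)%N (unpickle i)))) => x v e Ev e0.
(* The 7 beats the constant 6 of [selection]. *)
have e7 : 0 < e / 7 by rewrite divr_gt0.
have [k ke] := exp2V_lt e7.
have [n] := du v _ (exp2V_gt0 R k); rewrite -ball_normE /= => vn.
exists (pickle (n, k)); rewrite pickleK /=.
have := svalP (sel (n, k)) x v Ev; rewrite /= distrC => /(_ vn) h.
apply: le_lt_trans h _; move: ke; rewrite -[6 / _]/(6 * _); lra.
Qed.

Variable mu : {measure set X -> \bar R}.

Lemma ae_forall (T : countType) (P : T -> X -> Prop) :
  (forall t, {ae mu, forall x, P t x}) -> {ae mu, forall x, forall t, P t x}.
Proof.
move=> aP; have : {ae mu, forall x, forall n : nat,
    if (unpickle n : option T) is Some t then P t x else True}.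
  by apply/ae_foralln => n; case: unpickle => [t|]; [exact: aP|exact: nearW].
by apply: filterS => x H t; have := H (pickle t); rewrite pickleK.
Qed.

(** Replacing the sections by 0 on a measurable null set makes them converge everywhere, and the
    limit stays in the closed fibers. *)
Lemma section_limit (b : nat -> bundle_section E) :
  {ae mu, forall x, cvg ((fun n => b n x : B) @ \oo)} ->
  exists s : bundle_section E, {ae mu, forall x, (fun n => b n x : B) @ \oo --> s x}.
Proof.
move=> [N [mN N0 HN]].
pose f k x := if `[< N x >] then 0 else b k x.
pose l x := lim (f^~ x @ \oo).
have lP x : f^~ x @ \oo --> l x.
  rewrite /l /f; case: asboolP => Nx; first exact: is_cvg_cst.
  by apply: contrapT => H; apply: Nx; exact: HN.
have lE x : gr_set (E x) (l x).
  apply: gr_approx => e e0; have /cvgrPdist_lt/(_ _ e0)[a _ ha] := lP x.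
  exists (f a x); last exact: ha a (leqnn a).
  by rewrite /f; case: ifP => _; [exact: gr_zero|exact: sec_fiber].
have ml : mfunB l.
  apply: (@mfunB_lim _ _ _ _ f) => // k; apply: mfunB_if => //.
    exact: mfunB_cst.
  exact: sec_measurable.
exists (BundleSection ml lE); exists N; split=> // x /= H.
apply: contrapT => Nx; apply: H; have := lP x.
by rewrite /f; case: asboolP.
Qed.

(** The measurable form of [dense_limit]: the least indices are measurable in [x]. *)
Lemma section_extension (b : nat -> bundle_section E) (r : nat -> X -> R) :
  (forall n, measurable_fun setT (r n)) ->
  {ae mu, forall x, (forall n m, `|b n x - b m x| <= r n x + r m x) /\
                    (forall e, 0 < e -> exists n, r n x < e)} ->
  exists s : bundle_section E, {ae mu, forall x, forall n, `|s x - b n x| <= r n x}.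
Proof.
move=> mr H.
pose idx k x := least (fun n => r n x < (2 ^+ k)^-1).
have mf k : mfunB (fun x => b (idx k x) x).
  apply: (@mfunB_levels _ _ _ _ _ (idx k) b) => [|n]; last exact: sec_measurable.
  by apply: measurable_least => n; apply: measurable_set_lt => //; exact: measurable_cst.
pose f k := BundleSection (mf k) (fun x => sec_fiber (b (idx k x)) x).
have [|s hs] := @section_limit f.
  by apply: filterS H => x [bb /(dense_limit bb)[l ul _]]; apply/cvg_ex; exists l.
exists s; apply: filterS2 H hs => x [bb /(dense_limit bb)[l ul hl]] /cvg_lim <- // n.
by rewrite (cvg_lim _ ul).
Qed.

End Bundle.

(** * Convergence in measure *)

(** Borel-Cantelli for a geometric series. *)
Lemma geometric_lim_sup_set0 (R : realType) (d : measure_display)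
    (X : measurableType d) (nu : {measure set X -> \bar R}) (A : nat -> set X) :
  (forall k, measurable (A k)) -> (forall k, (nu (A k) <= ((2 ^+ k)^-1)%:E)%E) ->
  nu (lim_sup_set A) = 0%E.
Proof.
move=> mA Ak; apply: lim_sup_set_cvg0 => //.
apply: (@le_lt_trans _ _ 2%:E); last by rewrite ltry.
apply: lime_le; first exact: is_cvg_nneseries.
apply: nearW => n; apply: (@le_trans _ _ (2 - 2 / 2 ^+ n)%:E); last first.
  by rewrite lee_fin gerBl// divr_ge0// exprn_ge0.
rewrite big_mkord; elim: n => [|n IH]; first by rewrite big_ord0 expr0 divr1 subrr.
rewrite big_ord_recr /=; apply: le_trans (leeD IH (Ak n)) _.
rewrite -EFinD lee_fin exp2VS; have := exp2V_gt0 R n; lra.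
Qed.

Section ConvergenceInMeasure.
Context {R : realType} {d : measure_display} {X : measurableType d}.
Variables (mu : {measure set X -> \bar R}) (m' : probability X R).
Hypotheses (mu_m' : mu `<< m') (m'_mu : m' `<< mu).
Implicit Types f g h : X -> R.

Lemma dominates_ae (nu1 nu2 : {measure set X -> \bar R}) (P : X -> Prop) :
  nu1 `<< nu2 -> {ae nu2, forall x, P x} -> {ae nu1, forall x, P x}.
Proof.
move=> dom [N [mN N0 HN]]; exists N; split=> //.
by apply/(measure0_null_setP nu1 mN)/dom/measure0_null_setP.
Qed.

Definition trunc_norm f : R := \int[m']_x Num.min `|f x| 1.

Let J f : \bar R := (\int[m']_x (Num.min `|f x| 1)%:E)%E.

Let min_ge0 (r : R) : 0 <= Num.min `|r| 1.
Proof. by rewrite le_min normr_ge0 ler01. Qed.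

Let measurable_min f : measurable_fun setT f ->
  measurable_fun setT (fun x => (Num.min `|f x| 1)%:E).
Proof.
move=> mf; apply: measurableT_comp => //; apply: measurable_minr.
  by apply: measurableT_comp => //; exact: normr_measurable.
exact: measurable_cst.
Qed.

Let J_le1 f : measurable_fun setT f -> (J f <= 1)%E.
Proof.
move=> mf; apply: (@le_trans _ _ (\int[m']_x (cst 1%E x))%E).
  apply: ge0_le_integral => //.
  - exact: measurable_min.
  - by move=> x _; rewrite lee_fin ge_min lexx orbT.
by rewrite integral_cst//= mul1e probability_setT.
Qed.

Let J_fin f : measurable_fun setT f -> J f \is a fin_num.
Proof.
move=> mf; rewrite ge0_fin_numE; last first.
  by apply: integral_ge0 => x _; rewrite lee_fin.
by apply: le_lt_trans (J_le1 mf) _; rewrite ltry.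
Qed.

Let trunc_normE f : measurable_fun setT f -> (trunc_norm f)%:E = J f.
Proof. by move=> mf; rewrite /trunc_norm /Rintegral fineK//; exact: J_fin. Qed.

Lemma trunc_norm_ge0 f : 0 <= trunc_norm f.
Proof. by apply: Rintegral_ge0 => x _. Qed.

Lemma trunc_norm_add f g h : measurable_fun setT f -> measurable_fun setT g ->
  measurable_fun setT h -> {ae mu, forall x, `|f x| <= `|g x| + `|h x|} ->
  trunc_norm f <= trunc_norm g + trunc_norm h.
Proof.
move=> mf mg mh H; rewrite -lee_fin EFinD !trunc_normE// /J -ge0_integralD//; last 2 first.
- exact: measurable_min.
- exact: measurable_min.
apply: ae_ge0_le_integral => //.
- exact: measurable_min.
- by move=> x _; rewrite adde_ge0// lee_fin.
- by apply: emeasurable_funD; exact: measurable_min.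
apply: dominates_ae m'_mu _; apply: filterS H => x H _.
rewrite -EFinD lee_fin; have := normr_ge0 (g x); have := normr_ge0 (h x).
by rewrite /Num.min; do 3 case: ifP; lra.
Qed.

Lemma trunc_norm0 : trunc_norm (fun=> 0) = 0.
Proof.
rewrite /trunc_norm (@eq_Rintegral _ _ _ m' setT (fun=> 0)) => [|x _]; last by rewrite normr0 min_l.
by rewrite Rintegral_cst// mul0r.
Qed.

Lemma trunc_norm_le f g : measurable_fun setT f -> measurable_fun setT g ->
  {ae mu, forall x, `|f x| <= `|g x|} -> trunc_norm f <= trunc_norm g.
Proof.
move=> mf mg H; rewrite -[leRHS]addr0 -trunc_norm0; apply: trunc_norm_add => //.
by apply: filterS H => x; rewrite normr0 addr0.
Qed.

Lemma trunc_norm_eq f g : measurable_fun setT f -> measurable_fun setT g ->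
  {ae mu, forall x, `|f x| = `|g x|} -> trunc_norm f = trunc_norm g.
Proof.
move=> mf mg H; apply/le_anti; rewrite !trunc_norm_le//; last first.
  by apply: filterS H => x ->.
by apply: filterS H => x ->.
Qed.

(** On [A] the integrand is at most 1 by truncation, whatever the size of [f]. *)
Lemma trunc_norm_le_set f (A : set X) (e : R) : measurable_fun setT f -> measurable A ->
  0 <= e -> {ae mu, forall x, ~ A x -> `|f x| <= e} -> trunc_norm f <= e + fine (m' A).
Proof.
move=> mf mA e0 H.
have mind : measurable_fun setT (fun x => (\1_A x : R)%:E).
  by apply: measurableT_comp => //; exact: measurable_indic.
have fA : m' A \is a fin_num by exact: fin_num_measure.
have -> : e + fine (m' A) = fine (\int[m']_x (e%:E + (\1_A x)%:E))%E.
  rewrite ge0_integralD//.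
  rewrite integral_indic// setIT (_ : (\int[m']__ e%:E)%E = e%:E).
    by rewrite fineD.
  by rewrite (integral_cst _ measurableT e%:E) /= probability_setT mule1.
rewrite -lee_fin trunc_normE// fineK; last first.
  rewrite ge0_integralD//.
  rewrite integral_indic// setIT (integral_cst _ measurableT e%:E) /= probability_setT mule1.
  by rewrite fin_numD fA.
apply: ae_ge0_le_integral => //.
- exact: measurable_min.
- by move=> x _; rewrite adde_ge0// lee_fin.
- by apply: emeasurable_funD => //; exact: measurable_cst.
apply: dominates_ae m'_mu _; apply: filterS H => x H _.
rewrite -EFinD lee_fin indicE; case: (boolP (x \in A)) => [_|/negP xA].
  by rewrite ge_min lerDr e0 orbT.
by rewrite addr0 ge_min H// => Ax; apply: xA; rewrite inE.
Qed.

(** Markov's inequality; [e <= 1] because the truncated integrand never exceeds 1. *)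
Lemma trunc_norm_markov f (e : R) : measurable_fun setT f -> 0 < e -> e <= 1 ->
  (e%:E * m' [set x | (e <= `|f x|)%R] <= (trunc_norm f)%:E)%E.
Proof.
move=> mf e0 e1; set A := [set x | _].
have mA : measurable A.
  apply: measurable_set_le; first exact: measurable_cst.
  by apply: measurableT_comp => //; exact: normr_measurable.
have mind : measurable_fun setT (fun x => (\1_A x : R)%:E).
  by apply: measurableT_comp => //; exact: measurable_indic.
have := @integral_indic _ _ _ m' setT measurableT A mA; rewrite setIT => <-.
rewrite trunc_normE// -ge0_integralZl//; last by rewrite lee_fin ltW.
apply: ge0_le_integral => //.
- by move=> x _; rewrite mule_ge0// lee_fin// ltW.
- by apply: measurable_funeM.
- exact: measurable_min.
move=> x _; rewrite -EFinM lee_fin indicE.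
have [/set_mem Ax|_] := boolP (x \in A); last by rewrite mulr0.
by rewrite mulr1 le_min e1 andbT.
Qed.

Lemma trunc_norm_eq0 f : measurable_fun setT f -> (forall e, 0 < e -> trunc_norm f <= e) ->
  {ae mu, forall x, f x = 0}.
Proof.
move=> mf H; apply: dominates_ae mu_m' _.
have tn0 : trunc_norm f = 0.
  apply/le_anti; rewrite trunc_norm_ge0 andbT; apply/ler_addgt0Pl => e e0.
  by rewrite addr0; exact: H.
have ae k : {ae m', forall x, `|f x| < (2 ^+ k)^-1}.
  exists [set x | (2 ^+ k)^-1 <= `|f x|]; split.
  - apply: measurable_set_le; first exact: measurable_cst.
    by apply: measurableT_comp => //; exact: normr_measurable.
  - have e1 : (2 ^+ k)^-1 <= 1 :> R by rewrite invf_le1 ?exprn_gt0// exprn_ege1// ler1n.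
    have := trunc_norm_markov mf (exp2V_gt0 R k) e1; rewrite tn0 => h.
    apply/eqP; rewrite -measure_le0.
    by move: h; rewrite pmule_rle0// lte_fin exp2V_gt0.
  - by move=> x /= /negP; rewrite -leNgt.
have := ae_forall ae; apply: filterS => x Hx; apply/eqP; rewrite -normr_le0.
apply/ler_addgt0Pl => e /exp2V_lt[k ke]; rewrite addr0.
exact/ltW/(lt_trans (Hx k)).
Qed.

(** The sets where the bound fails at some index beyond [n] decrease to a null set, so their measure
    tends to 0 by finiteness of [m']. One [e] bounds the values, the other the measure of the
    exceptional set. *)
Lemma trunc_norm_eventually (f : nat -> X -> R) (e : R) :
  (forall k, measurable_fun setT (f k)) -> 0 < e ->
  {ae mu, forall x, exists K, forall k, (K <= k)%N -> `|f k x| <= e} ->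
  exists K, forall k, (K <= k)%N -> trunc_norm (f k) <= e + e.
Proof.
move=> mf e0 H; pose A k := [set x | e < `|f k x|].
have mA k : measurable (A k).
  apply: measurable_set_lt; first exact: measurable_cst.
  by apply: measurableT_comp => //; exact: normr_measurable.
have mU n : measurable (\bigcup_(k >= n) A k).
  by apply: bigcup_measurable => k _; exact: mA.
have ls0 : m' (lim_sup_set A) = 0%E.
  apply: measure_negligible; first by apply: bigcap_measurable => //; exists 0%N.
  apply: negligibleS (dominates_ae m'_mu H) => x /= lx [K HK].
  have [k /= Kk] := lx K Logic.I.
  by rewrite /A /= ltNge HK.
have cvg0 : m' (\bigcup_(k >= n) A k) @[n --> \oo] --> 0%E.
  rewrite -ls0; apply: lim_sup_set_cvg => //.
  by apply: le_lt_trans (probability_le1 m' (mU 0%N)) _; rewrite ltry.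
have /fine_cvg/cvgrPdist_le/(_ e e0)[K _ HK] := cvg0.
exists K => k Kk; apply: (@le_trans _ _ (e + fine (m' (\bigcup_(k >= K) A k)))).
  apply: trunc_norm_le_set => //; first exact: ltW.
  by apply: nearW => x nA; rewrite leNgt; apply/negP => Ax; apply: nA; exists k.
rewrite lerD2l; have := HK K (leqnn K); rewrite /= sub0r normrN ger0_norm//.
exact: fine_ge0.
Qed.

(** Markov at height [2^-k] uses up one factor; the other bounds the measure of the bad sets, to
    which Borel-Cantelli applies. *)
Lemma trunc_norm_summable (f : nat -> X -> R) :
  (forall k, measurable_fun setT (f k)) ->
  (forall k, trunc_norm (f k) <= (2 ^+ k)^-1 * (2 ^+ k)^-1) ->
  {ae mu, forall x, exists K, forall k, (K <= k)%N -> `|f k x| <= (2 ^+ k)^-1}.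
Proof.
move=> mf H; pose A k := [set x | (2 ^+ k)^-1 <= `|f k x|].
have mA k : measurable (A k).
  apply: measurable_set_le; first exact: measurable_cst.
  by apply: measurableT_comp => //; exact: normr_measurable.
have Ak k : (m' (A k) <= ((2 ^+ k)^-1)%:E)%E.
  have e0 := exp2V_gt0 R k.
  have e1 : (2 ^+ k)^-1 <= 1 :> R by rewrite invf_le1 ?exprn_gt0// exprn_ege1// ler1n.
  have := le_trans (trunc_norm_markov (mf k) e0 e1) (_ : _ <= ((2 ^+ k)^-1 * (2 ^+ k)^-1)%:E)%E.
  by rewrite lee_fin => /(_ (H k)); rewrite EFinM lee_pmul2l.
apply: dominates_ae mu_m' _; exists (lim_sup_set A); split.
- by apply: bigcap_measurable => // k _; apply: bigcup_measurable.
- exact: geometric_lim_sup_set0.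
- move=> x /= nH n _; apply: contrapT => nA; apply: nH; exists n => k nk.
  by apply: ltW; rewrite ltNge; apply/negP => Ax; apply: nA; exists k.
Qed.

End ConvergenceInMeasure.

(** * Pointwise calculus in modules *)

Section PointwiseL0.
Context {R : realType} {d : measure_display} {X : measurableType d}.
Variable mu : {measure set X -> \bar R}.
Implicit Types (a b : L0 mu).

Lemma L0_measurable a : measurable_fun setT (a : X -> R).
Proof. exact: measurable_funPT. Qed.

Lemma ae_eqT (T : Type) (f g : X -> T) :
  f = g %[ae mu] -> {ae mu, forall x, f x = g x}.
Proof. by apply: filterS => x; apply. Qed.

Lemma L0_ext a b : {ae mu, forall x, a x = b x} -> a = b.
Proof.
move=> H; rewrite -[a]reprK -[b]reprK; apply/L0_piP.
by apply: filterS H => x H _.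
Qed.

Lemma L0_add_ae a b : {ae mu, forall x, (a + b : L0 mu) x = a x + b x}.
Proof. exact: ae_eqT (L0_reprK mu (repr a + repr b)). Qed.

Lemma L0_mul_ae a b : {ae mu, forall x, (a * b : L0 mu) x = a x * b x}.
Proof. exact: ae_eqT (L0_reprK mu (repr a * repr b)). Qed.

Lemma L0_opp_ae a : {ae mu, forall x, (- a : L0 mu) x = - a x}.
Proof. exact: ae_eqT (L0_reprK mu (- repr a)). Qed.

Lemma L0_abs_ae a : {ae mu, forall x, L0_abs a x = `|a x|}.
Proof. exact: ae_eqT (L0_reprK mu (mfun_norm (repr a))). Qed.

Lemma L0_zero_ae : {ae mu, forall x, (0 : L0 mu) x = 0}.
Proof. exact: ae_eqT (L0_reprK mu 0). Qed.

Lemma L0_one_ae : {ae mu, forall x, (1 : L0 mu) x = 1}.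
Proof. exact: ae_eqT (L0_reprK mu 1). Qed.

Definition L0_of (f : X -> R) (mf : measurable_fun setT f) : L0 mu :=
  \pi_(L0 mu) (mk_mfun mf).

Lemma L0_of_ae f (mf : measurable_fun setT f) :
  {ae mu, forall x, L0_of mf x = f x}.
Proof. exact: ae_eqT (L0_reprK mu (mk_mfun mf)). Qed.

Definition L0_cst (c : R) : L0 mu := L0_of (@measurable_cst _ _ X _ setT c).

Lemma L0_cst_ae c : {ae mu, forall x, L0_cst c x = c}.
Proof. exact: L0_of_ae. Qed.

End PointwiseL0.

Section PointwiseModule.
Context {R : realType} {d : measure_display} {X : measurableType d}.
Context {mu : {measure set X -> \bar R}}.

Section OneModule.
Variable M : prenormed_module mu.
Implicit Types v w u : M.

Lemma pnorm_ge0_ae v : {ae mu, forall x, 0 <= pnorm v x}.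
Proof.
by apply: filterS2 (pnorm_ge0 v) (L0_zero_ae mu) => x h0 <-.
Qed.

Lemma pnorm0_ae : {ae mu, forall x, pnorm (0 : M) x = 0}.
Proof.
have [_ /(_ erefl) ->] := pnorm_eq0 (0 : M); exact: L0_zero_ae.
Qed.

Lemma pnorm_eq0_ae v : {ae mu, forall x, pnorm v x = 0} -> v = 0.
Proof.
move=> H; apply/pnorm_eq0/L0_ext.
by apply: filterS2 H (L0_zero_ae mu) => x -> ->.
Qed.

Lemma pnormZ_ae (f : L0 mu) v :
  {ae mu, forall x, pnorm (f *: v) x = `|f x| * pnorm v x}.
Proof.
rewrite pnormZ; apply: filterS2 (L0_mul_ae (L0_abs f) (pnorm v)) (L0_abs_ae f).
by move=> x -> ->.
Qed.

Lemma pnormD_ae v w :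
  {ae mu, forall x, pnorm (v + w) x <= pnorm v x + pnorm w x}.
Proof.
by apply: filterS2 (pnormD v w) (L0_add_ae (pnorm v) (pnorm w)) => x + <-.
Qed.

Lemma pnormN v : pnorm (- v) = pnorm v.
Proof.
apply: L0_ext; rewrite -scaleN1r.
apply: filterS3 (pnormZ_ae (-1) v) (L0_opp_ae (1 : L0 mu)) (L0_one_ae mu).
by move=> x -> -> ->; rewrite normrN normr1 mul1r.
Qed.

Lemma pnorm_distC v w : pnorm (v - w) = pnorm (w - v).
Proof. by rewrite -opprB pnormN. Qed.

Lemma pnorm_triangle_ae u v w :
  {ae mu, forall x, pnorm (v - w) x <= pnorm (v - u) x + pnorm (u - w) x}.
Proof.
by have := pnormD_ae (v - u) (u - w); rewrite addrA subrK.
Qed.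

Lemma pnorm_lip_ae v w :
  {ae mu, forall x, `|pnorm v x - pnorm w x| <= pnorm (v - w) x}.
Proof.
have := pnormD_ae (v - w) w; rewrite subrK.
have := pnormD_ae (w - v) v; rewrite subrK pnorm_distC.
by apply: filterS2 => x h1 h2; rewrite ler_norml; apply/andP; split; lra.
Qed.

Variable m' : probability X R.
Hypotheses (mu_m' : mu `<< m') (m'_mu : m' `<< mu).

Lemma module_distE v w : module_dist m' v w = trunc_norm m' (pnorm (v - w)).
Proof.
rewrite /module_dist /L0_dist -[LHS]/(trunc_norm m' (fun x => pnorm (v - w) x - (0 : L0 mu) x)).
apply: (trunc_norm_eq m'_mu).
- by apply: measurable_funB; exact: L0_measurable.
- exact: L0_measurable.
by apply: filterS (L0_zero_ae mu) => x ->; rewrite subr0.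
Qed.

Lemma module_dist_ge0 v w : 0 <= module_dist m' v w.
Proof. by rewrite module_distE; exact: trunc_norm_ge0. Qed.

Lemma module_distxx v : module_dist m' v v = 0.
Proof.
rewrite module_distE subrr -(trunc_norm0 m'); apply: (trunc_norm_eq m'_mu).
- exact: L0_measurable.
- exact: measurable_cst.
- by apply: filterS pnorm0_ae => x ->.
Qed.

Lemma module_distC v w : module_dist m' v w = module_dist m' w v.
Proof. by rewrite !module_distE pnorm_distC. Qed.

Lemma module_dist_triangle u v w :
  module_dist m' v w <= module_dist m' v u + module_dist m' u w.
Proof.
rewrite !module_distE; apply: (trunc_norm_add m'_mu); try exact: L0_measurable.
apply: filterS2 (pnorm_triangle_ae u v w) (pnorm_ge0_ae (v - w)) => x h h0.
rewrite (ger0_norm h0); apply: le_trans h _.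
by apply: lerD; exact: ler_norm.
Qed.

Lemma module_dist_eq v w : (forall e, 0 < e -> module_dist m' v w <= e) -> v = w.
Proof.
move=> H; apply/eqP; rewrite -subr_eq0; apply/eqP/pnorm_eq0_ae.
apply: (trunc_norm_eq0 mu_m'); first exact: L0_measurable.
by move=> e e0; rewrite -module_distE; exact: H.
Qed.

End OneModule.

Lemma module_dist_le_pnorm (m' : probability X R) (M N : prenormed_module mu)
    (v w : M) (v' w' : N) : m' `<< mu ->
  L0_le (pnorm (v - w)) (pnorm (v' - w')) ->
  module_dist m' v w <= module_dist m' v' w'.
Proof.
move=> m'_mu H; rewrite !module_distE//.
apply: (trunc_norm_le m'_mu); try exact: L0_measurable.
apply: filterS2 H (pnorm_ge0_ae (v - w)) => x h h0.
by rewrite (ger0_norm h0); apply: le_trans h (ler_norm _).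
Qed.

Lemma module_morphism0 (M N : prenormed_module mu) (T : module_morphism M N) :
  T 0 = 0.
Proof.
have := mm_linear T 1 0 0; rewrite !scale1r addr0 => h.
by apply: (addrI (T 0)); rewrite -h addr0.
Qed.

Lemma module_morphismB (M N : prenormed_module mu) (T : module_morphism M N) v w :
  T (v - w) = T v - T w.
Proof. by rewrite addrC -scaleN1r mm_linear scaleN1r addrC. Qed.

End PointwiseModule.

Section PointwiseGamma.
Context {R : realType} {B : separableBanach R}.
Context {d : measure_display} {X : measurableType d}.
Context {mu : {measure set X -> \bar R}} {E : Banach_bundle B X}.
Implicit Types (a b : Gamma_obj mu E) (s t : bundle_section E).

Definition gsec s : Gamma_obj mu E := \pi_(Gamma_sort mu E) s.
Definition grep a : bundle_section E := repr (a : Gamma_sort mu E).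

Lemma grepK a : gsec (grep a) = a.
Proof. exact: reprK. Qed.

Lemma gsec_ae s : {ae mu, forall x, grep (gsec s) x = s x}.
Proof. by apply: filterS (Gamma_reprK mu s) => x; apply. Qed.

Lemma Gamma_ext_ae a b : {ae mu, forall x, grep a x = grep b x} -> a = b.
Proof.
move=> H; rewrite -[a]grepK -[b]grepK; apply/Gamma_piP.
by apply: filterS H => x H _.
Qed.

Lemma grepD_ae a b : {ae mu, forall x, grep (a + b) x = grep a x + grep b x}.
Proof. exact: (gsec_ae (sec_add (grep a) (grep b))). Qed.

Lemma grepZ_ae (f : L0 mu) a : {ae mu, forall x, grep (f *: a) x = f x *: grep a x}.
Proof. exact: (gsec_ae (sec_scale (repr f) (grep a))). Qed.

Lemma grepB_ae a b : {ae mu, forall x, grep (a - b) x = grep a x - grep b x}.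
Proof.
rewrite -scaleN1r; have := L0_opp_ae (1 : L0 mu); have := L0_one_ae mu.
apply: filterS3 (filterI (grepD_ae a (-1 *: b)) (grepZ_ae (-1) b)).
by move=> x [-> ->] h1 ->; rewrite h1 scaleN1r.
Qed.

Lemma grep0_ae : {ae mu, forall x, grep 0 x = 0}.
Proof. exact: (gsec_ae (sec_zero E)). Qed.

Lemma Gamma_pnorm_ae a : {ae mu, forall x, pnorm a x = `|grep a x|}.
Proof. exact: ae_eqT (L0_reprK mu (sec_norm (grep a))). Qed.

Lemma Gamma_pnormB_ae a b :
  {ae mu, forall x, pnorm (a - b) x = `|grep a x - grep b x|}.
Proof. by apply: filterS2 (Gamma_pnorm_ae (a - b)) (grepB_ae a b) => x -> ->. Qed.

End PointwiseGamma.

(** * Section modules *)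

Lemma cauchy_fast_subsequence (R : realType) (T : Type) (dist : T -> T -> R)
    (u : nat -> T) (e : nat -> R) : dist_cauchy dist u -> (forall k, 0 < e k) ->
  exists phi : nat -> nat, (forall k, (phi k <= phi k.+1)%N) /\
    forall k m n, (phi k <= m)%N -> (phi k <= n)%N -> dist (u m) (u n) < e k.
Proof.
move=> cu e0.
have [N HN] := choice (fun k => cu (e k) (e0 k)).
exists (fun k => \max_(i < k.+1) N i)%N; split=> [k|k m n km kn].
  by rewrite [leqRHS]big_ord_recr leq_maxl.
have Nk : (N k <= \max_(i < k.+1) N i)%N.
  by rewrite big_ord_recr leq_maxr.
by apply: HN; exact: leq_trans Nk _.
Qed.

Lemma countable_enum (T : Type) (A : set T) (t0 : T) : countable A ->
  exists g : nat -> T, A `<=` range g.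
Proof.
move=> cA; have [->|[g]] := pfcard_geP cA; first by exists (fun=> t0).
by exists g => y /(@surj _ _ _ _ g)[n _ gn]; exists n.
Qed.

Section GammaProperties.
Context {R : realType} {B : separableBanach R}.
Context {d : measure_display} {X : measurableType d}.
Context {mu : {measure set X -> \bar R}} (m' : probability X R).
Hypotheses (mu_m' : mu `<< m') (m'_mu : m' `<< mu).
Variable E : Banach_bundle B X.

Local Notation G := (Gamma_obj mu E).
Local Notation dist := (@module_dist _ _ _ _ m' G).

(** A subsequence with increments below [4^-k] has pointwise increments eventually below [2^-k], so
    its representatives converge almost everywhere; convergence in measure then recovers the limit
    for the distance. *)
Theorem Gamma_complete : is_normed_module m' G.
Proof.
move=> u cu.
have [|phi [phiS phiP]] :=
    @cauchy_fast_subsequence _ _ _ u (fun k => (2 ^+ k)^-1 * (2 ^+ k)^-1) cu.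
  by move=> k; rewrite mulr_gt0 ?exp2V_gt0.
pose b k := grep (u (phi k)).
have sm : {ae mu, forall x, exists K, forall k, (K <= k)%N ->
    `|pnorm (u (phi k.+1) - u (phi k)) x| <= (2 ^+ k)^-1}.
  apply: (trunc_norm_summable mu_m') => [k|k]; first exact: L0_measurable.
  by rewrite -module_distE//; apply: ltW; apply: phiP => //; exact: phiS.
have [|s hs] := @section_limit _ _ _ _ E mu b.
  have bk := ae_forall (fun k => Gamma_pnormB_ae (u (phi k.+1)) (u (phi k))).
  apply: filterS2 bk sm => x hb [K HK].
  have [|l ul _] := @geometric_cvg R B (fun k => b k x) 1 K.
    by move=> k Kk; rewrite mul1r -normr_id -hb; exact: HK.
  by apply/cvg_ex; exists l.
exists (gsec s); apply/cvgrPdist_le => e e0.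
(* One quarter for the Cauchy estimate, two for [trunc_norm_eventually]. *)
have e4 : 0 < e / 4 by rewrite divr_gt0.
have [||K HK] := @trunc_norm_eventually _ _ _ _ _ m'_mu
    (fun k => pnorm (u (phi k) - gsec s) : X -> R) (e / 4) _ e4.
- by move=> k; exact: L0_measurable.
- have bs := ae_forall (fun k => Gamma_pnormB_ae (u (phi k)) (gsec s)).
  apply: filterS3 bs (gsec_ae s) hs => x hb gs /cvgrPdist_le/(_ _ e4)[K _ HK].
  by exists K => k Kk; rewrite hb gs normr_id distrC; exact: HK.
have [k2 hk2] := exp2V_lt e4.
pose k := maxn K k2.
exists (phi k) => // n /= kn; rewrite sub0r normrN ger0_norm ?module_dist_ge0//.
apply: le_trans (module_dist_triangle m'_mu (u (phi k)) _ _) _.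
have h1 : dist (u n) (u (phi k)) <= e / 4.
  apply: le_trans (ltW (phiP k _ _ kn (leqnn _))) _.
  apply: le_trans (ltW hk2); apply: (@le_trans _ _ (2 ^+ k)^-1).
    by rewrite ler_piMl ?(ltW (exp2V_gt0 _ _))// invf_le1 ?exprn_gt0// exprn_ege1// ler1n.
  by rewrite lef_pV2 ?posrE ?exprn_gt0// ler_eXn2l ?ltr1n// leq_maxr.
have h2 := HK k (leq_maxl _ _).
by rewrite -module_distE// in h2; move: h1 h2; lra.
Qed.

(** * Density of sections glued from a fiberwise dense sequence *)

Section Dense.
Variable b : nat -> bundle_section E.

Fixpoint glue (A : nat -> set X) (mA : forall n, measurable (A n)) (K : nat) : G :=
  if K is k.+1
  then L0_of mu (measurable_indic (mA k)) *: gsec (b k) + glue mA k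
  else 0.

Hypothesis b_dense : forall x v (e : R), gr_set (E x) v -> 0 < e ->
  exists n, `|v - b n x| < e.

(** Cut [X] according to the first [b n] within [e / 3] of [a]. Each point is eventually covered as
    [K] grows, so the part where the glued section is still 0 becomes negligible. *)
Lemma glue_approx (a : G) (e : R) : 0 < e ->
  exists (A : nat -> set X) (mA : forall n, measurable (A n)) K,
    dist a (glue mA K) < e.
Proof.
move=> e0; have e3 : 0 < e / 3 by rewrite divr_gt0.
pose idx x := least (fun n => `|grep a x - b n x| < e / 3).
have idxP x : `|grep a x - b (idx x) x| < e / 3.
  apply: (@leastP (fun n => `|grep a x - b n x| < e / 3)).
  by apply: b_dense => //; exact: sec_fiber.
have midx n : measurable [set x | idx x = n].
  move: n; apply: measurable_least => n; apply: measurable_set_lt.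
    by apply: mfunB_dist; exact: sec_measurable.
  exact: measurable_cst.
exists (fun n => [set x | idx x = n]), midx.
have glueE : {ae mu, forall x, forall K,
    grep (glue midx K) x = if (idx x < K)%N then b (idx x) x else 0}.
  have step k : {ae mu, forall x, grep (glue midx k.+1) x =
      \1_[set y | idx y = k] x *: b k x + grep (glue midx k) x}.
    pose f := L0_of mu (measurable_indic (midx k)).
    have h1 := grepD_ae (f *: gsec (b k)) (glue midx k).
    have h2 := grepZ_ae f (gsec (b k) : G).
    have h3 := L0_of_ae mu (measurable_indic (midx k)).
    have h4 := @gsec_ae _ _ _ _ mu _ (b k).
    by apply: filterS2 (filterI h1 h2) (filterI h3 h4) => x [-> ->] [-> ->].
  apply: filterS2 (ae_forall step) (@grep0_ae _ _ _ _ mu E) => x st g0.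
  elim=> [|K IH]; first exact: g0.
  rewrite st IH indicE ltnS; case: (ltngtP (idx x) K) => xK.
  - by rewrite memNset ?scale0r ?add0r// => xK'; rewrite -xK' ltnn in xK.
  - by rewrite memNset ?scale0r ?add0r// => xK'; rewrite -xK' ltnn in xK.
  - by rewrite mem_set// xK scale1r addr0.
have [||K HK] := @trunc_norm_eventually _ _ _ _ _ m'_mu
    (fun K => pnorm (a - glue midx K) : X -> R) (e / 3) _ e3.
- by move=> K; exact: L0_measurable.
- have ag := ae_forall (fun K => Gamma_pnormB_ae a (glue midx K)).
  apply: filterS2 ag glueE => x hb hg; exists (idx x).+1 => K Kx.
  by rewrite hb hg normr_id Kx ltW.
exists K; rewrite module_distE//; have := HK K (leqnn K); move: e0; lra.
Qed.

Lemma glue_submodule (S : set G) : @is_submodule _ _ _ _ G S -> (forall n, S (gsec (b n))) ->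
  forall A (mA : forall n, measurable (A n)) K, S (glue mA K).
Proof.
move=> [S0 SP] Sb A mA; elim=> [|K IH] //=; exact: SP.
Qed.

Lemma submodule_dense : dist_dense dist (smallest (@is_submodule _ _ _ _ G) (range (gsec \o b))).
Proof.
move=> a e e0; have [A [mA [K HK]]] := glue_approx a e0.
exists (glue mA K) => // S [sS bS]; apply: glue_submodule => // n.
by apply: bS; exists n.
Qed.

Variable g : nat -> set X.
Hypothesis mg : forall n, measurable (g n).

Fixpoint glue_seq (l : seq (nat * nat)) : G :=
  if l is p :: l'
  then L0_of mu (measurable_indic (mg p.1)) *: gsec (b p.2) + glue_seq l'
  else 0.

Hypothesis g_dense : forall (A : set X) (e : R), measurable A -> 0 < e ->
  exists n, fine (m' (A `+` g n)) < e.

(** Replacing [A K] by some [g n] alters the section only on their symmetric difference, and by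
    truncation the cost is the measure of that set, however large [b K] is. *)
Lemma glue_seq_dense A (mA : forall n, measurable (A n)) K (e : R) : 0 < e ->
  exists l, dist (glue mA K) (glue_seq l) < e.
Proof.
elim: K e => [|K IH] e e0.
  by exists [::]; rewrite module_distxx.
have e2 : 0 < e / 2 by rewrite divr_gt0.
have [l hl] := IH _ e2; have [n hn] := g_dense (mA K) e2.
exists ((n, K) :: l); rewrite /=.
set f1 := L0_of mu _; set f2 := L0_of mu _; set w := gsec (b K).
apply: le_lt_trans (module_dist_triangle m'_mu (f2 *: w + glue mA K) _ _) _.
rewrite [e]splitr; apply: ler_ltD; last first.
  by rewrite module_distE// opprD addrACA subrr add0r -module_distE.
apply: le_trans (ltW hn); rewrite module_distE// opprD addrACA subrr addr0.
rewrite -scalerBl -[leRHS]add0r; apply: (trunc_norm_le_set m'_mu) => //; first by apply: measurableU; apply: measurableD.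
have h1 := L0_add_ae f1 (- f2); have h2 := L0_opp_ae f2.
have h3 := pnormZ_ae (f1 - f2) w.
have h4 := L0_of_ae mu (measurable_indic (mA K)).
have h5 := L0_of_ae mu (measurable_indic (mg n)).
apply: filterS2 (filterI (filterI h1 h2) h3) (filterI h4 h5).
move=> x [[e1 e3] e4] [e5 e6] nAg; rewrite e4 e1 e3 e5 e6 !indicE.
suff -> : (x \in A K) = (x \in g n) by rewrite subrr normr0 mul0r normr0.
apply/idP/idP => /set_mem xA; apply: mem_set; apply: contrapT => nx; apply: nAg.
  by left.
by right.
Qed.

Lemma glue_seq_separable : separable_module m' G.
Proof.
exists (range glue_seq).
  by apply: (sub_countable (card_image_le _ _)); exact: countableP.
move=> a e e0; have e2 : 0 < e / 2 by rewrite divr_gt0.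
have [A [mA [K HK]]] := glue_approx a e2.
have [l hl] := glue_seq_dense mA K e2.
exists (glue_seq l); first by exists l.
apply: le_lt_trans (module_dist_triangle m'_mu (glue mA K) _ _) _.
by rewrite [e]splitr ltrD.
Qed.

End Dense.

Theorem Gamma_countably_generated : countably_generated m' G.
Proof.
have [b bP] := Castaing E; exists (range (gsec \o b)); last exact: submodule_dense.
by apply: (sub_countable (card_image_le _ _)); exact: countableP.
Qed.

(** Otherwise sets with [nu (A k) < 2^-k] and [m' (A k) >= e] have a [nu]-null upper limit, of
    [m']-measure at least [e]. This transfers density of the measure algebra from [nu] to [m']. *)
Lemma dominates_small (nu : {finite_measure set X -> \bar R}) : m' `<< nu ->
  forall e : R, 0 < e -> exists2 c : R, 0 < c &
    forall A, measurable A -> fine (nu A) < c -> fine (m' A) < e.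
Proof.
move=> m'_nu e e0; apply: contrapT => none.
have H k : exists A, [/\ measurable A, fine (nu A) < (2 ^+ k)^-1 & e <= fine (m' A)].
  apply: contrapT => nA; apply: none; exists (2 ^+ k)^-1 => [|A mA nuA].
    exact: exp2V_gt0.
  by rewrite ltNge; apply/negP => eA; apply: nA; exists A.
have [A HA] := choice H.
have mA k : measurable (A k) by have [] := HA k.
have mU n : measurable (\bigcup_(k >= n) A k).
  by apply: bigcup_measurable => k _; exact: mA.
have mL : measurable (lim_sup_set A) by apply: bigcap_measurable => //; exists 0%N.
have ls0 : nu (lim_sup_set A) = 0%E.
  have Ak k : (nu (A k) <= ((2 ^+ k)^-1)%:E)%E.
    have [_ /ltW h _] := HA k.
    by rewrite -[nu _]fineK ?lee_fin//; exact: fin_num_measure.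
  exact: geometric_lim_sup_set0 mA Ak.
have m0 : m' (lim_sup_set A) = 0%E.
  by apply/(measure0_null_setP m' mL)/m'_nu/(measure0_null_setP nu mL).
have cvg0 : m' (\bigcup_(k >= n) A k) @[n --> \oo] --> 0%E.
  rewrite -m0; apply: lim_sup_set_cvg => //.
  by apply: le_lt_trans (probability_le1 m' (mU 0%N)) _; rewrite ltry.
have e2 : 0 < e / 2 by rewrite divr_gt0.
have /fine_cvg/cvgrPdist_le/(_ _ e2)[K _ /(_ K (leqnn K))] := cvg0.
rewrite /= sub0r normrN ger0_norm ?fine_ge0//.
have [_ _ eA] := HA K.
have AU : fine (m' (A K)) <= fine (m' (\bigcup_(k >= K) A k)).
  apply: fine_le; [exact: fin_num_measure|exact: fin_num_measure|].
  by apply: le_measure; rewrite ?inE// => x Ax; exists K => /=.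
by move: e0 eA AU; lra.
Qed.

Theorem Gamma_separable : separable_measure_space mu -> separable_module m' G.
Proof.
move=> [nu [mu_nu nu_mu [D cD dD]]].
have [g gP] := countable_enum (\pi_(measure_algebra mu) (MSet measurable0)) cD.
have [b bP] := Castaing E.
pose A n : mset := repr (g n).
apply: (@glue_seq_separable b bP (fun n => mset_set (A n)) (fun n => mset_measurable (A n))).
move=> C e mC e0.
have m'_nu : m' `<< nu by exact: null_dominates_trans m'_mu mu_nu.
have [c c0 Hc] := dominates_small m'_nu e0.
have [y Dy hy] := dD (\pi_(measure_algebra mu) (MSet mC)) c c0.
have [n _ gn] := gP y Dy; exists n; apply: Hc.
  by apply: measurableU; apply: measurableD => //; exact: mset_measurable.
move: hy; rewrite /measure_algebra_dist -gn -/(A n).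
set C' : mset := repr _ => /(le_lt_trans _); apply.
(* The distance is computed on representatives, so [C] is exchanged for that of its class at the
   price of a null set. *)
have CC' : {ae nu, forall x, C x <-> mset_set C' x}.
  apply: dominates_ae nu_mu _; have : \pi_(measure_algebra mu) (MSet mC) = \pi_(measure_algebra mu) C'.
    by rewrite reprK.
  by move=> /eqmodP/mset_eqP.
have mX (F F' : set X) : measurable F -> measurable F' -> measurable (F `+` F').
  by move=> mF mF'; apply: measurableU; apply: measurableD.
have mA := mset_measurable (A n); have mC' := mset_measurable C'.
apply: fine_le.
- by apply: fin_num_measure; exact: mX.
- by apply: fin_num_measure; exact: mX.
have [N [mN N0 HN]] := CC'.
apply: (@le_trans _ _ (nu ((C' `+` A n) `|` N))).
  apply: le_measure; rewrite ?inE; [exact: mX|by apply: measurableU => //; exact: mX|].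
  move=> x CA; have [CCx|nCC] := pselect (C x <-> mset_set C' x); last by right; exact: HN.
  by left; case: CA => -[h1 h2]; [left|right]; split=> //=; tauto.
rewrite measureU0//; exact: mX.
Qed.

End GammaProperties.

(** * Full faithfulness *)

(** Allows a single tolerance [c] for all approximations, once the total error is known to be at
    most [c * C]. *)
Lemma exists_small_factor (R : realType) (C e : R) : 0 < e ->
  exists c : R, [/\ 0 < c, c <= 1 & c * C <= e].
Proof.
move=> e0; have D0 : 0 < `|C| + e by rewrite ltr_wpDl.
exists (e / (`|C| + e)); split; first by rewrite divr_gt0.
- by rewrite ler_pdivrMr// mul1r lerDr.
- rewrite mulrAC ler_pdivrMr// ler_wpM2l// ?(ltW e0)//.
  by rewrite (le_trans (ler_norm _))// lerDl ltW.
Qed.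

Lemma le_eq_trans (R : realType) (a b a' b' : R) :
  a <= b -> a = a' -> b = b' -> a' <= b'.
Proof. by move=> + <- <-. Qed.

Lemma ler_normD4 (R : realType) (V : normedModType R) (x y z w : V) (a b c e : R) :
  `|x| <= a -> `|y| <= b -> `|z| <= c -> `|w| <= e ->
  `|x + y + z + w| <= a + b + c + e.
Proof.
move=> xa yb zc we.
by do 3 (apply: le_trans (ler_normD _ _) _; apply: lerD => //).
Qed.

Lemma subr_split (V : zmodType) (a b c x y z : V) :
  a + x - z = (c + y - z) + (a - b) + (b - c) + (x - y).
Proof.
rewrite -[_ + (a - b) + _]addrA subrKA [c + y - z + _]addrC -[c + y - z]addrA.
by rewrite [a - c + _]addrA subrK -[RHS]addrA [y - z + _]addrC subrKA addrA.
Qed.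

Section FullyFaithful.
Context {R : realType} {B : separableBanach R}.
Context {d : measure_display} {X : measurableType d}.
Context {mu : {measure set X -> \bar R}}.
Variables E F : Banach_bundle B X.

Lemma pm_lip (f : premorphism E F) x (v w : B) :
  gr_set (E x) v -> gr_set (E x) w ->
  `|((pm_fun f (x, v)).2 : B) - (pm_fun f (x, w)).2| <= `|v - w|.
Proof.
have subE (a b : B) : a - b = (-1) *: b + a by rewrite scaleN1r addrC.
move=> Ev Ew; rewrite !subE -(pm_linear f)//.
by apply: pm_contraction; exact: gr_linear.
Qed.

Theorem Gamma_faithful (phi psi : bundle_morphism mu E F) :
  Gamma_map phi = Gamma_map psi -> phi = psi.
Proof.
elim/quotW: phi => f; elim/quotW: psi => g fg.
have [s sP] := Castaing E.
have /ae_forall[N [mN N0 HN]] : forall n, {ae mu, forall x,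
    sec_map f (s n) x = sec_map g (s n) x}.
  move=> n; apply: ae_eqT; apply/Gamma_piP.
  by rewrite -!Gamma_funE; exact: (congr1 (fun T => mm_fun T (gsec (s n))) fg).
apply/bundle_morphismP; exists N; split=> // x Nx v Ev.
rewrite (pm_funE f Ev) (pm_funE g Ev); congr (_, _); apply/eqP.
rewrite -subr_eq0 -normr_le0; apply/ler_addgt0Pl => e e0; rewrite addr0.
have e2 : 0 < e / 2 by rewrite divr_gt0.
have [n hn] := sP x v _ Ev e2.
have /(_ n) /= fgn : forall n, sec_map f (s n) x = sec_map g (s n) x.
  by apply: contrapT => H; apply: Nx; exact: HN.
rewrite -(subrKA ((pm_fun f (x, s n x)).2 : B)) {2}fgn.
apply: le_trans (ler_normD _ _) _; rewrite [e]splitr; apply: lerD.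
  exact: le_trans (pm_lip f Ev (sec_fiber _ _)) (ltW hn).
rewrite distrC; exact: le_trans (pm_lip g Ev (sec_fiber _ _)) (ltW hn).
Qed.

(** * The bundle morphism induced by a module morphism *)

Section Full.
Variable T : module_morphism (Gamma_obj mu E) (Gamma_obj mu F).
Variable s : nat -> bundle_section E.

Let t n := grep (T (gsec (s n))).

(** The case [q = 0] of the second part lets the map [s n x] to [t n x] extend by continuity;
    general [q] makes the extension linear. *)
Definition compatible x := (forall n, `|t n x| <= `|s n x|) /\
  forall i : nat * nat * nat * rat, let: (p, n, m, q) := i in
    `|ratr q *: t n x + t m x - t p x| <= `|ratr q *: s n x + s m x - s p x|.

Lemma ae_compatible : {ae mu, forall x, compatible x}.
Proof.
have h1 : {ae mu, forall x n, `|t n x| <= `|s n x|}.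
  apply: ae_forall => n; have k1 := mm_contraction T (gsec (s n)).
  have k2 := Gamma_pnorm_ae (T (gsec (s n))); have k3 := Gamma_pnorm_ae (gsec (s n) : Gamma_obj mu E).
  have k4 := @gsec_ae _ _ _ _ mu _ (s n).
  apply: filterS2 (filterI k1 k2) (filterI k3 k4) => x [e1 e2] [e3 e4].
  by apply: le_eq_trans e1 e2 _; rewrite e3 e4.
have h2 : {ae mu, forall x (i : nat * nat * nat * rat), let: (p, n, m, q) := i in
    `|ratr q *: t n x + t m x - t p x| <= `|ratr q *: s n x + s m x - s p x|}.
  apply: ae_forall => -[[[p n] m] q]; pose c := L0_cst mu (ratr q).
  have LE (G : Banach_bundle B X) (a b e : Gamma_obj mu G) : {ae mu, forall x,
      pnorm (c *: a + b - e) x = `|ratr q *: grep a x + grep b x - grep e x|}.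
    have k1 := Gamma_pnormB_ae (c *: a + b) e; have k2 := grepD_ae (c *: a) b.
    have k3 := grepZ_ae c a; have k4 := L0_cst_ae mu (ratr q).
    by apply: filterS2 (filterI k1 k2) (filterI k3 k4) => x [-> ->] [-> ->].
  have k1 := mm_contraction T (c *: gsec (s n) + gsec (s m) - gsec (s p)).
  rewrite module_morphismB mm_linear in k1.
  have k2 := LE _ (T (gsec (s n))) (T (gsec (s m))) (T (gsec (s p))).
  have k3 := LE _ (gsec (s n)) (gsec (s m)) (gsec (s p)).
  have k4 k := @gsec_ae _ _ _ _ mu _ (s k).
  apply: filterS3 (filterI k1 k2) (filterI k3 (k4 n)) (filterI (k4 m) (k4 p)).
  move=> x [e1 e2] [e3 e4] [e5 e6]; apply: le_eq_trans e1 e2 _.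
  by rewrite e3 e4 e5 e6.
by apply: filterS2 h1 h2 => x; split.
Qed.

Hypothesis s_dense : forall x v (e : R), gr_set (E x) v -> 0 < e ->
  exists n, `|v - s n x| < e.

(** At compatible points and fiber vectors these bounds have exactly one solution, so identities for
    [phi] are proved by checking the bounds. *)
Let phi x (v : B) : B := xget 0 [set y | forall n, `|y - t n x| <= `|v - s n x|].

Let phiP x v : compatible x -> gr_set (E x) v -> forall n, `|phi x v - t n x| <= `|v - s n x|.
Proof.
move=> [_ gx] Ev; have [||l _ hl] := @dense_limit R B (fun n => t n x) (fun n => `|v - s n x|).
- move=> n m; have := gx (m, n, n, 0); rewrite /= rmorph0 !scale0r !add0r => /le_trans; apply.
  by rewrite -(subrKA v) addrC [`|v - s n x|]distrC addrC; exact: ler_normD.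
- by move=> e; exact: s_dense.
by rewrite /phi; case: xgetP => [y _ //|/(_ l)]; case.
Qed.

Let phi_unique x v y : compatible x -> gr_set (E x) v ->
  (forall n, `|y - t n x| <= `|v - s n x|) -> y = phi x v.
Proof.
move=> gx Ev hy; apply/eqP; rewrite -subr_eq0 -normr_le0.
apply/ler_addgt0Pl => e e0; rewrite addr0.
have e2 : 0 < e / 2 by rewrite divr_gt0.
have [n hn] := s_dense Ev e2; rewrite -(subrKA (t n x)).
apply: le_trans (ler_normD _ _) _; rewrite [e]splitr; apply: lerD.
  exact: le_trans (hy n) (ltW hn).
rewrite distrC; exact: le_trans (phiP gx Ev n) (ltW hn).
Qed.

Let phi_fiber x v : compatible x -> gr_set (E x) v -> gr_set (F x) (phi x v).
Proof.
move=> gx Ev; apply: gr_approx => e e0; have [n hn] := s_dense Ev e0.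
exists (t n x); first exact: sec_fiber.
exact: le_lt_trans (phiP gx Ev n) hn.
Qed.

Let phi_contraction x v : compatible x -> gr_set (E x) v -> `|phi x v| <= `|v|.
Proof.
move=> gx Ev; apply/ler_addgt0Pl => e e0.
have e2 : 0 < e / 2 by rewrite divr_gt0.
have [n hn] := s_dense Ev e2; have h1 := phiP gx Ev n; have h2 := gx.1 n.
have h3 : `|phi x v| <= `|phi x v - t n x| + `|t n x|.
  by rewrite -{1}(subrK (t n x) (phi x v)); exact: ler_normD.
have h4 : `|s n x| <= `|v - s n x| + `|v|.
  by rewrite distrC -{1}(subrK v (s n x)); exact: ler_normD.
by move: h1 h2 h3 h4 hn; lra.
Qed.

Let phi_linear x (a : R) v w : compatible x -> gr_set (E x) v -> gr_set (E x) w ->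
  phi x (a *: v + w) = a *: phi x v + phi x w.
Proof.
move=> gx Ev Ew; apply/esym/phi_unique => // [|p]; first exact: gr_linear.
apply/ler_addgt0Pl => e e0.
(* The sum of the coefficients of [c] in [H1] and [H2]. *)
have [c [c0 c1 cC]] := exists_small_factor
  (`|v| + `|phi x v| + 2 * (`|a| + 1) + 2) e0.
have [n hn] := s_dense Ev c0; have [m hm] := s_dense Ew c0.
have [q hq qa] := rat_approx_bounded a c0 c1.
have H1 : `|a *: phi x v + phi x w - t p x| <= `|ratr q *: t n x + t m x - t p x|
    + c * `|phi x v| + (`|a| + 1) * c + c.
  rewrite (subr_split _ (ratr q *: phi x v) (ratr q *: t n x) _ (t m x)).
  rewrite -scalerBl -scalerBr.
  apply: ler_normD4 => //.
  - by rewrite normrZ; apply: ler_wpM2r => //; exact: ltW.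
  - rewrite normrZ; apply: ler_pM => //.
    by apply: le_trans (phiP gx Ev n) _; exact: ltW.
  - by apply: le_trans (phiP gx Ew m) _; exact: ltW.
have H2 : `|ratr q *: s n x + s m x - s p x| <= `|a *: v + w - s p x|
    + (`|a| + 1) * c + c * `|v| + c.
  rewrite (subr_split _ (ratr q *: v) (a *: v) _ w) -scalerBl -scalerBr.
  apply: ler_normD4 => //.
  - by rewrite normrZ distrC; apply: ler_pM => //; exact: ltW.
  - by rewrite normrZ distrC; apply: ler_wpM2r => //; exact: ltW.
  - by rewrite distrC; exact: ltW.
have := gx.2 (p, n, m, q); move: H1 H2 cC => /=; rewrite !mulrDr; lra.
Qed.

Variables (N : set X) (mN : measurable N) (mu0 : mu N = 0%E).
Hypothesis N_compatible : forall x, ~ N x -> compatible x.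

(** The value 0 over [N] keeps the map linear on every fiber, and 0 off the total space makes it
    measurable on the whole product. *)
Let psi (p : X * borel B) : B :=
  if `[< total_space E p /\ ~ N p.1 >] then phi p.1 p.2 else 0.

Let psiE x v : ~ N x -> gr_set (E x) v -> psi (x, v) = phi x v.
Proof. by move=> Nx Ev; rewrite /psi asboolT. Qed.

Let psiN x v : N x -> psi (x, v) = 0.
Proof. by move=> Nx; rewrite /psi asboolF//= => -[]. Qed.

Let measurable_psi : mfunB psi.
Proof.
have mfst : measurable_fun setT (fst : X * borel B -> X) by exact: measurable_fst.
have msnd : mfunB (snd : X * borel B -> B) by exact: measurable_snd.
have mD : measurable [set p : X * borel B | total_space E p /\ ~ N p.1].
  apply: measurable_set_and; first exact: total_space_measurable.
  by apply: measurable_set_not; rewrite -[X in measurable X]setTI; exact: mfst.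
have ms n : mfunB (fun p : X * borel B => s n p.1).
  exact: (measurableT_comp (sec_measurable (s n)) mfst).
have mt n : mfunB (fun p : X * borel B => t n p.1).
  exact: (measurableT_comp (sec_measurable (t n)) mfst).
apply: mfunB_ball => b r.
(* [phi] comes from a choice, so its balls are rewritten through the measurable [s n] and [t n]:
   [t n x] is as close to [phi x v] as [s n x] is to [v]. *)
rewrite (_ : [set p | _] = [set p |
    ((total_space E p /\ ~ N p.1) /\
       exists n, `|p.2 - s n p.1| + `|t n p.1 - b| < r) \/
    (~ (total_space E p /\ ~ N p.1) /\ `|0 - b| < r)]); last first.
  apply/seteqP; split => -[x v]; rewrite /= /psi.
    case: asboolP => [[Ev Nx] h|nD h]; last by right.
    left; split => //; have gx := N_compatible Nx.
    have e0 : 0 < (r - `|phi x v - b|) / 2 by rewrite divr_gt0// subr_gt0.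
    have [n hn] := s_dense Ev e0; exists n.
    have h1 : `|t n x - b| <= `|phi x v - t n x| + `|phi x v - b|.
      by rewrite [`|phi x v - t n x|]distrC -[t n x - b](subrKA (phi x v)) ler_normD.
    have h2 := phiP gx Ev n; have h3 : `|v - s n x| < (r - `|phi x v - b|) / 2 := hn.
    by move: h1 h2 h3; lra.
  move=> [[[Ev Nx] [n hn]]|[nD hr]]; last by rewrite asboolF.
  rewrite asboolT//; apply: le_lt_trans hn; rewrite -(subrKA (t n x)).
  apply: le_trans (ler_normD _ _) _; rewrite lerD2r.
  exact: (phiP (N_compatible Nx) Ev n).
apply: measurableU.
  apply: measurable_set_and => //; apply: measurable_set_exists => n.
  apply: measurable_set_lt; last exact: measurable_cst.
  by apply: measurable_funD; apply: mfunB_dist => //; exact: mfunB_cst.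
apply: measurable_set_and; first exact: measurable_set_not.
exact: measurable_set_cst.
Qed.

Let pm (p : X * borel B) : X * borel B := (p.1, psi p).

Let pm_meas : measurable_fun (total_space E) pm.
Proof.
apply: measurable_funTS; apply: measurable_fun_pair; first exact: measurable_fst.
exact: measurable_psi.
Qed.

Let pm_fib x v : gr_set (E x) v -> gr_set (F x) (pm (x, v)).2.
Proof.
move=> Ev; rewrite /pm /=; have [Nx|Nx] := pselect (N x).
  by rewrite psiN//; exact: gr_zero.
by rewrite psiE//; apply: phi_fiber => //; exact: N_compatible.
Qed.

Let pm_lin x (a : R) (v w : B) : gr_set (E x) v -> gr_set (E x) w ->
  (pm (x, a *: v + w)).2 = a *: ((pm (x, v)).2 : B) + (pm (x, w)).2.
Proof.
move=> Ev Ew; rewrite /pm /=; have [Nx|Nx] := pselect (N x).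
  by rewrite !psiN// scaler0 addr0.
rewrite !psiE//; last exact: gr_linear.
by apply: phi_linear => //; exact: N_compatible.
Qed.

Let pm_contr x (v : B) : gr_set (E x) v -> `|(pm (x, v)).2 : B| <= `|v|.
Proof.
move=> Ev; rewrite /pm /=; have [Nx|Nx] := pselect (N x).
  by rewrite psiN// normr0.
by rewrite psiE//; apply: phi_contraction => //; exact: N_compatible.
Qed.

Lemma Gamma_full_dense : exists phi : bundle_morphism mu E F, Gamma_map phi = T.
Proof.
pose f : premorphism E F :=
  @Premorphism _ _ _ _ E F pm pm_meas (fun _ _ _ => erefl) pm_fib pm_lin pm_contr.
exists (\pi_(bundle_morphism mu E F) f); apply: module_morphismP => a.
rewrite -[a]grepK [LHS](Gamma_funE mu f (grep a)) grepK -[RHS]grepK.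
apply/Gamma_piP.
have k1 : {ae mu, forall x, ~ N x} by exists N; split=> // x /= /contrapT.
(* Contraction of [T] on [a - gsec (s n)] gives exactly the bounds that characterize [phi]. *)
have k2 : {ae mu, forall x n, `|grep (T a) x - t n x| <= `|grep a x - s n x|}.
  apply: ae_forall => n; have h1 := mm_contraction T (a - gsec (s n)).
  rewrite module_morphismB in h1.
  have h2 := Gamma_pnormB_ae (T a) (T (gsec (s n))).
  have h3 := Gamma_pnormB_ae a (gsec (s n)); have h4 := @gsec_ae _ _ _ _ mu _ (s n).
  apply: filterS2 (filterI h1 h2) (filterI h3 h4) => x [e1 e2] [e3 e4].
  by apply: le_eq_trans e1 e2 _; rewrite e3 e4.
apply: filterS2 k1 k2 => x Nx h _ /=.
rewrite psiE//; last exact: sec_fiber.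
by apply/esym/phi_unique => //; [exact: N_compatible|exact: sec_fiber].
Qed.

End Full.

Theorem Gamma_full (T : module_morphism (Gamma_obj mu E) (Gamma_obj mu F)) :
  exists phi : bundle_morphism mu E F, Gamma_map phi = T.
Proof.
have [s sP] := Castaing E; have [N [mN N0 HN]] := ae_compatible T s.
apply: (Gamma_full_dense sP mN N0) => x Nx.
by apply: contrapT => nc; apply: Nx; exact: HN.
Qed.

End FullyFaithful.

(** * Essential surjectivity *)

Lemma additive_ratZ (R : realType) (U : lmodType rat) (V : lmodType R) (f : U -> V) :
  (forall y z, f (y + z) = f y + f z) ->
  forall (a : rat) z, f (a *: z) = ratr a *: f z.
Proof.
move=> fD a z.
have f0 : f 0 = 0 by apply: (addrI (f 0)); rewrite -fD !addr0.
have fN y : f (- y) = - f y by apply: (addrI (f y)); rewrite -fD !subrr.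
have fn y n : f (y *+ n) = f y *+ n.
  by elim: n => [|n IH]; rewrite ?mulr0n// !mulrSr fD IH.
have fz y (m : int) : f (m%:~R *: y) = m%:~R *: f y.
  by rewrite !scaler_int; case: m => n; rewrite ?NegzE ?mulrNz ?fN -!pmulrn fn.
have d0 : (denq a)%:~R != 0 :> R by rewrite intr_eq0 denq_neq0.
apply: (scalerI d0); rewrite -fz scalerA [_ * a]mulrC -numqE fz scalerA; congr (_ *: _).
by rewrite -(@ratr_int R (numq a)) -(@ratr_int R (denq a)) numqE rmorphM mulrC.
Qed.

Lemma lmod_split (K : pzRingType) (V : lmodType K) (f c : K) (v w y z : V) :
  f *: v + w - (c *: y + z) = (f - c) *: v + c *: (v - y) + (w - z).
Proof.
by rewrite scalerBl scalerBr subrKA opprD addrACA.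
Qed.

Section L0Constants.
Context {R : realType} {d : measure_display} {X : measurableType d}.
Variable mu : {measure set X -> \bar R}.

Lemma L0_cstD (a b : R) : L0_cst mu (a + b) = L0_cst mu a + L0_cst mu b.
Proof.
apply: L0_ext; have h := L0_add_ae (L0_cst mu a) (L0_cst mu b).
have ha := L0_cst_ae mu a; have hb := L0_cst_ae mu b; have hab := L0_cst_ae mu (a + b).
by apply: filterS2 (filterI h ha) (filterI hb hab) => x [-> ->] [-> ->].
Qed.

Lemma L0_cstM (a b : R) : L0_cst mu (a * b) = L0_cst mu a * L0_cst mu b.
Proof.
apply: L0_ext; have h := L0_mul_ae (L0_cst mu a) (L0_cst mu b).
have ha := L0_cst_ae mu a; have hb := L0_cst_ae mu b; have hab := L0_cst_ae mu (a * b).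
by apply: filterS2 (filterI h ha) (filterI hb hab) => x [-> ->] [-> ->].
Qed.

Lemma L0_cst0 : L0_cst mu 0 = 0.
Proof.
by apply: L0_ext; apply: filterS2 (L0_cst_ae mu 0) (L0_zero_ae mu) => x -> ->.
Qed.

Lemma L0_cst1 : L0_cst mu 1 = 1.
Proof.
by apply: L0_ext; apply: filterS2 (L0_cst_ae mu 1) (L0_one_ae mu) => x -> ->.
Qed.

Lemma pnorm_split_ae (M : prenormed_module mu) (f : L0 mu) (r : R) (v w y z : M) :
  {ae mu, forall x, pnorm (f *: v + w - (L0_cst mu r *: y + z)) x <=
    `|f x - r| * pnorm v x + `|r| * pnorm (v - y) x + pnorm (w - z) x}.
Proof.
rewrite lmod_split.
set c := L0_cst mu r.
have h1 := pnormD_ae ((f - c) *: v + c *: (v - y)) (w - z).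
have h2 := pnormD_ae ((f - c) *: v) (c *: (v - y)).
have h3 := pnormZ_ae (f - c) v; have h4 := pnormZ_ae c (v - y).
have h5 := L0_add_ae f (- c); have h6 := L0_opp_ae c; have h7 := L0_cst_ae mu r.
apply: filterS3 (filterI h1 h2) (filterI h3 h4) (filterI (filterI h5 h6) h7).
move=> x [e1 e2] [e3 e4] [[e5 e6] e7]; apply: le_trans e1 _; rewrite lerD2r.
by apply: le_trans e2 _; rewrite e3 e4 e5 e6 e7.
Qed.

End L0Constants.

Section Representation.
Context {R : realType} {B : separableBanach R}.
Context {d : measure_display} {X : measurableType d}.
Context {mu : {measure set X -> \bar R}} (m' : probability X R).
Hypotheses (mu_m' : mu `<< m') (m'_mu : m' `<< mu).
Hypothesis B_universal : universal_separable_Banach B.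
Variable M : prenormed_module mu.
Variable v : nat -> M.
Hypothesis v_le1 : forall n, {ae mu, forall x, pnorm (v n) x <= 1}.
Hypothesis v_dense : dist_dense (@module_dist _ _ _ _ m' M)
  (smallest (@is_submodule _ _ _ _ M) (range v)).
Hypothesis M_complete : is_normed_module m' M.
Implicit Types (y z : {poly rat}).

Definition comb z : M := \sum_(i < size z) L0_cst mu (ratr z`_i) *: v i.

Lemma combE z n : (size z <= n)%N ->
  comb z = \sum_(i < n) L0_cst mu (ratr z`_i) *: v i.
Proof.
move=> zn; rewrite /comb.
rewrite (@poly_sum_widen _ _ (fun i a => L0_cst mu (ratr a) *: v i) _ n)// => i.
by rewrite rmorph0 L0_cst0 scale0r.
Qed.

Lemma comb_linear (a : rat) y z :
  comb (a *: y + z) = L0_cst mu (ratr a) *: comb y + comb z.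
Proof.
set n := maxn (size y) (size z).
have yn : (size y <= n)%N by exact: leq_maxl.
have zn : (size z <= n)%N by exact: leq_maxr.
have ayzn : (size (a *: y + z)%R <= n)%N.
  apply: leq_trans (size_polyD _ _) _; rewrite geq_max zn andbT.
  exact: leq_trans (size_scale_leq _ _) yn.
rewrite (combE ayzn) (combE yn) (combE zn) scaler_sumr -big_split.
apply: eq_bigr => i _ /=; rewrite coefD coefZ rmorphD rmorphM L0_cstD L0_cstM.
by rewrite scalerDl scalerA.
Qed.

Lemma comb0 : comb 0 = 0.
Proof. by rewrite /comb size_poly0 big_ord0. Qed.

Lemma combD y z : comb (y + z) = comb y + comb z.
Proof. by have := comb_linear 1 y z; rewrite scale1r rmorph1 L0_cst1 scale1r. Qed.

Lemma combZ a z : comb (a *: z) = L0_cst mu (ratr a) *: comb z.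
Proof. by have := comb_linear a z 0; rewrite comb0 !addr0. Qed.

Lemma combB y z : comb (y - z) = comb y - comb z.
Proof. by apply/eqP; rewrite eq_sym subr_eq -combD subrK. Qed.

Lemma combXn i : comb 'X^i = v i.
Proof.
rewrite (@combE _ i.+1) ?size_polyXn// big_ord_recr /= big1 => [|j _].
  by rewrite coefXn eqxx rmorph1 L0_cst1 scale1r add0r.
by rewrite coefXn ltn_eqF// rmorph0 L0_cst0 scale0r.
Qed.

Definition regular_point x :=
  rat_seminorm (fun z => pnorm (comb z) x) /\ forall i, pnorm (v i) x <= 1.

Lemma ae_regular_point : {ae mu, forall x, regular_point x}.
Proof.
have h1 : {ae mu, forall x (i : {poly rat} * {poly rat}),
    pnorm (comb (i.1 + i.2)) x <= pnorm (comb i.1) x + pnorm (comb i.2) x}.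
  by apply: ae_forall => -[y z]; rewrite combD; exact: pnormD_ae.
have h2 : {ae mu, forall x (i : rat * {poly rat}),
    pnorm (comb (i.1 *: i.2)) x = `|ratr i.1| * pnorm (comb i.2) x}.
  apply: ae_forall => -[a z]; rewrite combZ.
  have k1 := pnormZ_ae (L0_cst mu (ratr a)) (comb z).
  by apply: filterS2 k1 (L0_cst_ae mu (ratr a)) => x -> ->.
apply: filterS3 h1 h2 (ae_forall v_le1) => x e1 e2 e3; split=> //.
by split=> [y z|a z]; [exact: (e1 (y, z))|exact: (e2 (a, z))].
Qed.

(** Constant rational coefficients suffice because [z] may depend on [x]: at a fixed point a
    coefficient in [L0 mu] is just a real number. So the elements with this property form a
    submodule, and a fast approximating sequence carries it over to [w]. *)
Lemma comb_dense (w : M) : {ae mu, forall x (e : R), 0 < e ->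
  exists z, pnorm (w - comb z) x < e}.
Proof.
pose S : set M := [set w | {ae mu, forall x (e : R), 0 < e ->
  exists z, pnorm (w - comb z) x < e}].
have S_sub : is_submodule S.
  split.
    apply: filterS (pnorm0_ae M) => x h e e0; exists 0.
    by rewrite comb0 subr0 h.
  move=> f a b Sa Sb.
  have sp : {ae mu, forall x (i : rat * {poly rat} * {poly rat}),
      pnorm (f *: a + b - comb (i.1.1 *: i.1.2 + i.2)) x <=
      `|f x - ratr i.1.1| * pnorm a x + `|ratr i.1.1| * pnorm (a - comb i.1.2) x
        + pnorm (b - comb i.2) x}.
    by apply: ae_forall => i; rewrite comb_linear; exact: pnorm_split_ae.
  apply: filterS3 (filterI Sa Sb) sp (pnorm_ge0_ae a) => x [ea eb] h a0 e e0.
  have e20 : 0 < e / 2 by rewrite divr_gt0.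
  have [c [c0 c1 cC]] := exists_small_factor (pnorm a x + (`|f x| + 1) + 1) e20.
  have [r hr r1] := rat_approx_bounded (f x) c0 c1.
  have [y hy] := ea c c0; have [z hz] := eb c c0.
  exists (r *: y + z); apply: le_lt_trans (h (r, y, z)) _ => /=.
  apply: (@le_lt_trans _ _ (c * pnorm a x + (`|f x| + 1) * c + c)); last first.
    by move: cC; rewrite !mulrDr; lra.
  apply: lerD; last exact: ltW.
  apply: lerD; first by apply: ler_wpM2r => //; exact: ltW.
  apply: (@le_trans _ _ (`|ratr r| * c)); first by apply: ler_wpM2l => //; exact: ltW.
  by apply: ler_wpM2r => //; exact: ltW.
have vS : range v `<=` S.
  move=> _ [i _ <-]; apply: filterS (pnorm0_ae M) => x h e e0.
  by exists 'X^i; rewrite combXn subrr h.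
have /choice[u uP] k : exists u,
    S u /\ module_dist m' w u < (2 ^+ k)^-1 * (2 ^+ k)^-1.
  have [|y Cy wy] := v_dense w (e := (2 ^+ k)^-1 * (2 ^+ k)^-1).
    by rewrite mulr_gt0 ?exp2V_gt0.
  by exists y; split=> //; exact: Cy.
have Su := ae_forall (fun k => (uP k).1).
have su : {ae mu, forall x, exists K, forall k, (K <= k)%N ->
    `|pnorm (w - u k) x| <= (2 ^+ k)^-1}.
  apply: (trunc_norm_summable mu_m') => k; first exact: L0_measurable.
  by rewrite -module_distE// ltW//; exact: (uP k).2.
have tri : {ae mu, forall x (i : nat * {poly rat}),
    pnorm (w - comb i.2) x <= pnorm (w - u i.1) x + pnorm (u i.1 - comb i.2) x}.
  by apply: ae_forall => i; exact: pnorm_triangle_ae.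
apply: filterS3 Su su tri => x hS [K hK] ht e e0.
have e20 : 0 < e / 2 by rewrite divr_gt0.
have [k hk] := exp2V_lt e20; have [z hz] := hS (maxn K k) _ e20.
exists z; apply: le_lt_trans (ht (maxn K k, z)) _; rewrite [e]splitr; apply: ltrD => //=.
apply: le_lt_trans (ler_norm _) _; apply: le_lt_trans (hK _ (leq_maxl _ _)) _.
apply: le_lt_trans hk.
by rewrite lef_pV2 ?posrE ?exprn_gt0// ler_eXn2l ?ltr1n// leq_maxr.
Qed.

Variables (N : set X) (mN : measurable N) (mu0 : mu N = 0%E).
Hypothesis N_regular : forall x, ~ N x -> regular_point x.

(** The zero seminorm on [N] makes the hypotheses of the realization hold at every point. *)
Definition fiber_norm (x : X) z : R := \1_(~` N) x * pnorm (comb z) x.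

Let fiber_normN x z : ~ N x -> fiber_norm x z = pnorm (comb z) x.
Proof. by move=> Nx; rewrite /fiber_norm indicE mem_set// mul1r. Qed.

Let fiber_norm0 x z : N x -> fiber_norm x z = 0.
Proof. by move=> Nx; rewrite /fiber_norm indicE memNset ?mul0r//; exact. Qed.

Let fiber_norm_seminorm x : rat_seminorm (fiber_norm x).
Proof.
have [Nx|Nx] := pselect (N x).
  by split=> [y z|a z]; rewrite !fiber_norm0// ?addr0 ?mulr0.
have [sp _] := N_regular Nx.
by split=> [y z|a z]; rewrite !fiber_normN//; [exact: sp.1|exact: sp.2].
Qed.

Let fiber_norm_le1 x i : fiber_norm x 'X^i <= 1.
Proof.
have [Nx|Nx] := pselect (N x); first by rewrite fiber_norm0.
by rewrite fiber_normN// combXn; exact: (N_regular Nx).2.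
Qed.

Let measurable_fiber_norm z : measurable_fun setT (fiber_norm ^~ z).
Proof.
apply: measurable_funM; last exact: L0_measurable.
by apply: measurable_indic; exact: measurableC.
Qed.

Let V := realization_space fiber_norm_seminorm fiber_norm_le1.
Let w (x : X) z : V := realize fiber_norm_seminorm fiber_norm_le1 x z.
Let J : {linear V -> B} := sval (cid (B_universal V)).
Let JP u : `|J u| = `|u|. Proof. exact: (svalP (cid (B_universal V))). Qed.

Definition fiber_vector z (x : X) : B := J (w x z).

Lemma fiber_vectorD y z x :
  fiber_vector (y + z) x = fiber_vector y x + fiber_vector z x.
Proof. by rewrite /fiber_vector /w realizeD linearD. Qed.

Lemma fiber_vectorZ a z x : fiber_vector (a *: z) x = ratr a *: fiber_vector z x.
Proof. by apply: (additive_ratZ (f := fiber_vector ^~ x)) => y y'; exact: fiber_vectorD. Qed.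

Lemma fiber_vectorB y z x :
  fiber_vector (y - z) x = fiber_vector y x - fiber_vector z x.
Proof. by apply/eqP; rewrite eq_sym subr_eq -fiber_vectorD subrK. Qed.

Lemma fiber_vector_norm z x : `|fiber_vector z x| = fiber_norm x z.
Proof. by rewrite JP realize_norm. Qed.

Lemma fiber_vector_measurable z : mfunB (fiber_vector z).
Proof.
apply/borel_measurableP => O oO.
have mw : mfunB (fun x => w x z) by exact: realize_measurable.
have oJ : open ((J : V -> B) @^-1` O).
  rewrite openE => u /= Ou; have /nbhs_ballP[e /= e0 He] := open_nbhs_nbhs (conj oO Ou).
  apply/nbhs_ballP; exists e => // t; rewrite -ball_normE /= => ut.
  by apply: He; rewrite -ball_normE /= -linearB JP.
by move/borel_measurableP : mw => /(_ _ oJ).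
Qed.

Let fiber_set x : set B :=
  [set u | forall e : R, 0 < e -> exists z, `|u - fiber_vector z x| < e].

Let fiber_closed x : closed (fiber_set x).
Proof.
move=> u cu e e0; have e20 : 0 < e / 2 by rewrite divr_gt0.
have [t [/(_ _ e20)[z tz]]] := cu _ (nbhsx_ballx u _ e20).
rewrite -ball_normE /= => ut; exists z.
rewrite -(subrKA t) [e]splitr; apply: le_lt_trans (ler_normD _ _) _.
exact: ltrD.
Qed.

Let fiber_zero x : fiber_set x 0.
Proof.
move=> e e0; exists 0; rewrite sub0r normrN fiber_vector_norm.
by rewrite (sublinear0 (rat_seminorm_sublinear (fiber_norm_seminorm x))).
Qed.

Let fiber_linear x (a : R) (u t : B) :
  fiber_set x u -> fiber_set x t -> fiber_set x (a *: u + t).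
Proof.
move=> Eu Et e e0; have e20 : 0 < e / 2 by rewrite divr_gt0.
have [c [c0 c1 cC]] := exists_small_factor (`|u| + (`|a| + 1) + 1) e20.
have [r hr r1] := rat_approx_bounded a c0 c1.
have [y hy] := Eu c c0; have [z hz] := Et c c0.
exists (r *: y + z); rewrite fiber_vectorD fiber_vectorZ lmod_split.
apply: (@le_lt_trans _ _ (c * `|u| + (`|a| + 1) * c + c)); last first.
  by move: cC; rewrite !mulrDr; lra.
apply: le_trans (ler_normD _ _) _; apply: lerD; last exact: ltW.
apply: le_trans (ler_normD _ _) _; rewrite (normrZ (a - ratr r)) (normrZ (ratr r)); apply: lerD.
  by apply: ler_wpM2r => //; exact: ltW.
by apply: ler_pM => //; exact: ltW.
Qed.

Let fiber x : Grassmannian B :=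
  ClosedSubspace (@fiber_closed x) (@fiber_zero x) (@fiber_linear x).

Let fiber_vector_in z x : gr_set (fiber x) (fiber_vector z x).
Proof. by move=> e e0; exists z; rewrite subrr normr0. Qed.

Let fiber_meas (U : set B) : open U ->
  measurable [set x | gr_set (fiber x) `&` U !=set0].
Proof.
(* An open set meets the closure exactly when it contains one of the countably many vectors. *)
move=> oU; rewrite (_ : [set x | _] = [set x | exists z, U (fiber_vector z x)]).
  apply: measurable_set_exists => z.
  by have /borel_measurableP/(_ _ oU) := fiber_vector_measurable z.
apply/seteqP; split => x /=; last first.
  by move=> [z Uz]; exists (fiber_vector z x); split=> //; exact: fiber_vector_in.
move=> [u [Eu Uu]]; have /nbhs_ballP[e /= e0 He] := open_nbhs_nbhs (conj oU Uu).
by have [z uz] := Eu e e0; exists z; apply: He; rewrite -ball_normE.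
Qed.

Definition representing_bundle : Banach_bundle B X := BanachBundle fiber_meas.

(** * The isometry of the module onto the sections of the bundle *)

Local Notation E := representing_bundle.

Let sec z : bundle_section E :=
  @BundleSection _ _ _ _ E (fiber_vector z) (fiber_vector_measurable z)
    (@fiber_vector_in z).

Let decode (n : nat) : {poly rat} := odflt 0 (unpickle n).

Let decodeP z : decode (pickle z) = z. Proof. by rewrite /decode pickleK. Qed.

Let b n := sec (decode n).

Let b_dense x u (e : R) : gr_set (E x) u -> 0 < e -> exists n, `|u - b n x| < e.
Proof. by move=> Eu /Eu[z hz]; exists (pickle z); rewrite /b decodeP. Qed.

Let ae_N : {ae mu, forall x, ~ N x}.
Proof. by exists N; split=> // x /= /contrapT. Qed.

Let sec_pnorm_ae : {ae mu, forall x z, `|sec z x| = pnorm (comb z) x}.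
Proof.
by apply: filterS ae_N => x Nx z; rewrite /= fiber_vector_norm fiber_normN.
Qed.

(** Inequalities suffice: by [comb_dense] the right side is arbitrarily small, so they determine
    [a]. *)
Let represents (u : M) (a : Gamma_obj mu E) :=
  {ae mu, forall x z, `|grep a x - sec z x| <= pnorm (u - comb z) x}.

Let represents_ex u : exists a, represents u a.
Proof.
have [||s hs] := @section_extension _ _ _ _ E mu b (fun n => pnorm (u - comb (decode n)) : X -> R).
- by move=> n; exact: L0_measurable.
- have tri : {ae mu, forall x (i : {poly rat} * {poly rat}), pnorm (comb i.1 - comb i.2) x <=
      pnorm (comb i.1 - u) x + pnorm (u - comb i.2) x}.
    by apply: ae_forall => i; exact: pnorm_triangle_ae.
  apply: filterS3 sec_pnorm_ae tri (comb_dense u) => x h1 h2 h3; split=> [n m|e e0].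
    rewrite -[_ - _](fiber_vectorB (decode n) (decode m) x).
    rewrite -[fiber_vector _ x]/(sec (decode n - decode m) x) h1 combB.
    by apply: le_trans (h2 (decode n, decode m)) _; rewrite pnorm_distC.
  by have [z hz] := h3 e e0; exists (pickle z); rewrite decodeP.
exists (gsec s); apply: filterS2 hs (@gsec_ae _ _ _ _ mu _ s) => x hx -> z.
by have := hx (pickle z); rewrite /b decodeP.
Qed.

Let T u := sval (cid (represents_ex u)).

Let TP u : represents u (T u). Proof. exact: (svalP (cid (represents_ex u))). Qed.

Let T_norm u : {ae mu, forall x, pnorm (T u) x = pnorm u x}.
Proof.
have tri : {ae mu, forall x z, `|pnorm u x - pnorm (comb z) x| <= pnorm (u - comb z) x}.
  by apply: ae_forall => z; exact: pnorm_lip_ae.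
apply: filterS3 (filterI (TP u) tri) (filterI sec_pnorm_ae (comb_dense u)) (Gamma_pnorm_ae (T u)).
move=> x [h1 h2] [h3 h4] ->; apply/eqP; rewrite -subr_eq0 -normr_le0.
apply/ler_addgt0Pl => e e0; rewrite addr0.
have e20 : 0 < e / 2 by rewrite divr_gt0.
have [z hz] := h4 _ e20.
have k1 := le_trans (ler_dist_dist (grep (T u) x) (sec z x)) (h1 z).
have k2 := h2 z; rewrite distrC in k2; rewrite h3 in k1.
rewrite -(subrKA (pnorm (comb z) x)); apply: le_trans (ler_normD _ _) _.
by move: k1 k2 hz; lra.
Qed.

Let T_linear (f : L0 mu) (u t : M) : T (f *: u + t) = f *: T u + T t.
Proof.
apply: Gamma_ext_ae; have h1 := grepD_ae (f *: T u) (T t).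
have h2 := grepZ_ae f (T u); have h3 := TP (f *: u + t).
have sp : {ae mu, forall x (i : rat * {poly rat} * {poly rat}),
    pnorm (f *: u + t - comb (i.1.1 *: i.1.2 + i.2)) x <=
    `|f x - ratr i.1.1| * pnorm u x + `|ratr i.1.1| * pnorm (u - comb i.1.2) x
      + pnorm (t - comb i.2) x}.
  by apply: ae_forall => i; rewrite comb_linear; exact: pnorm_split_ae.
apply: filterS3 (filterI (filterI h1 h2) (filterI h3 sp))
  (filterI (TP u) (TP t)) (filterI (filterI (comb_dense u) (comb_dense t)) (pnorm_ge0_ae u)).
move=> x [[-> ->] [e3 esp]] [eu et] [[du dt] u0].
apply/eqP; rewrite -subr_eq0 -normr_le0; apply/ler_addgt0Pl => e e0; rewrite addr0.
(* The total coefficient of [c] in the errors made in [M] and in the fiber. *)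
have [c [c0 c1 cC]] := exists_small_factor
  (pnorm u x + `|grep (T u) x| + 2 * (`|f x| + 1) + 2) e0.
have [r hr r1] := rat_approx_bounded (f x) c0 c1.
have [y hy] := du c c0; have [z hz] := dt c c0.
have k1 := le_trans (e3 (r *: y + z)) (esp (r, y, z)).
have k2 : `|f x - ratr r| * pnorm u x <= c * pnorm u x.
  by apply: ler_wpM2r => //; exact: ltW.
have ry : `|ratr r| * pnorm (u - comb y) x <= (`|f x| + 1) * c.
  apply: (@le_trans _ _ (`|ratr r| * c)); first by apply: ler_wpM2l => //; exact: ltW.
  by apply: ler_wpM2r => //; exact: ltW.
have k3 : `|f x *: grep (T u) x + grep (T t) x - sec (r *: y + z) x| <=
    c * `|grep (T u) x| + (`|f x| + 1) * c + c.
  rewrite /= fiber_vectorD fiber_vectorZ lmod_split.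
  apply: le_trans (ler_normD _ _) _; apply: lerD; last first.
    by apply: le_trans (et z) _; exact: ltW.
  apply: le_trans (ler_normD _ _) _.
  rewrite (normrZ (f x - ratr r)) (normrZ (ratr r)); apply: lerD.
    by apply: ler_wpM2r => //; exact: ltW.
  apply: le_trans ry; apply: ler_wpM2l => //; exact: eu.
rewrite -(subrKA (sec (r *: y + z) x)); apply: le_trans (ler_normD _ _) _.
rewrite [X in _ + X]distrC; move: k1 k2 k3 ry hz cC => /=; rewrite !mulrDr.
by lra.
Qed.

Let T_contraction u : L0_le (pnorm (T u)) (pnorm u).
Proof. by apply: filterS (T_norm u) => x ->. Qed.

Let Tm : module_morphism M (Gamma_obj mu E) := ModuleMorphism T_linear T_contraction.

Let T_comb z : T (comb z) = gsec (sec z).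
Proof.
apply: Gamma_ext_ae.
apply: filterS3 (TP (comb z)) (pnorm0_ae M) (@gsec_ae _ _ _ _ mu _ (sec z)) => x h1 h2 ->.
by apply/eqP; rewrite -subr_eq0 -normr_le0; have := h1 z; rewrite subrr h2.
Qed.

Let T_dist u t : module_dist m' (T u) (T t) = module_dist m' u t.
Proof.
have TB : T u - T t = T (u - t) := esym (module_morphismB Tm u t).
apply/le_anti/andP; split; apply: module_dist_le_pnorm => //.
  by rewrite TB; exact: T_contraction.
by rewrite TB; apply: filterS (T_norm (u - t)) => x ->.
Qed.

Let T_inj u t : T u = T t -> u = t.
Proof.
move=> Tut; apply: (module_dist_eq mu_m' m'_mu) => e e0.
by rewrite -T_dist Tut module_distxx// ltW.
Qed.

(** The range is a submodule containing a fiberwise dense sequence, hence dense. Preimages of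
    approximations of [a] are Cauchy since [T] is isometric, and completeness of [M] supplies the
    preimage of [a]. *)
Let T_surj a : exists u, T u = a.
Proof.
pose S : set (Gamma_obj mu E) := range T.
have S_sub : is_submodule S.
  split; first by exists 0 => //; exact: (module_morphism0 Tm).
  by move=> f _ _ [u _ <-] [t _ <-]; exists (f *: u + t) => //; exact: T_linear.
have bS : range (gsec \o b) `<=` S by move=> _ [n _ <-]; exists (comb (decode n)).
have /choice[u uP] k : exists u, module_dist m' a (T u) < (2 ^+ k)^-1.
  have [y Cy ay] := submodule_dense m'_mu b_dense a (exp2V_gt0 R k).
  by have [t _ tE] := Cy S (conj S_sub bS); exists t; rewrite tE.
have [|l /cvgrPdist_lt ul] := M_complete (u := u).
  move=> e e0; have e20 : 0 < e / 2 by rewrite divr_gt0.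
  have [K hK] := exp2V_lt e20.
  have small k : (K <= k)%N -> module_dist m' a (T (u k)) < e / 2.
    move=> Kk; apply: lt_trans (uP k) _; apply: le_lt_trans hK.
    by rewrite lef_pV2 ?posrE ?exprn_gt0// ler_eXn2l ?ltr1n.
  exists K => m n Km Kn; rewrite -T_dist.
  apply: le_lt_trans (module_dist_triangle m'_mu a _ _) _.
  by rewrite [e]splitr module_distC// ltrD// small.
exists l; apply: (module_dist_eq mu_m' m'_mu) => e e0.
have e20 : 0 < e / 2 by rewrite divr_gt0.
have [K _ hK] := ul _ e20; have [k hk] := exp2V_lt e20.
rewrite module_distC//; apply: le_trans (module_dist_triangle m'_mu (T (u (maxn K k))) _ _) _.
rewrite [e]splitr; apply: lerD.
  apply: ltW; apply: lt_trans (uP _) _; apply: le_lt_trans hk.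
  by rewrite lef_pV2 ?posrE ?exprn_gt0// ler_eXn2l ?ltr1n// leq_maxr.
rewrite T_dist; have := hK _ (leq_maxl K k); rewrite /= sub0r normrN ger0_norm ?module_dist_ge0//.
exact: ltW.
Qed.

Lemma representation_generators : exists E : Banach_bundle B X,
  exists f : module_morphism M (Gamma_obj mu E),
  exists g : module_morphism (Gamma_obj mu E) M,
    comp_module_morphism g f = id_module_morphism M /\
    comp_module_morphism f g = id_module_morphism (Gamma_obj mu E).
Proof.
pose S a := sval (cid (T_surj a)).
have TS a : T (S a) = a := svalP (cid (T_surj a)).
have S_linear (f : L0 mu) a e : S (f *: a + e) = f *: S a + S e.
  by apply: T_inj; rewrite T_linear !TS.
have S_contraction a : L0_le (pnorm (S a)) (pnorm a).
  by rewrite -{2}(TS a); apply: filterS (T_norm (S a)) => x ->.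
exists E, Tm, (ModuleMorphism S_linear S_contraction); split.
  by apply: module_morphismP => u /=; apply: T_inj; rewrite TS.
by apply: module_morphismP => a /=; rewrite TS.
Qed.

End Representation.

(** * Equivalences of categories *)

Section EquivalenceCriterion.
Variables (C D : category) (F : functor C D).
Hypothesis F_faithful : forall (a b : C) (f g : hom a b), fmap F f = fmap F g -> f = g.
Hypothesis F_full : forall (a b : C) (h : hom (F a) (F b)), exists f, fmap F f = h.
Hypothesis F_ess_surj : forall d : D, exists (c : C) (f : hom (F c) d) (g : hom d (F c)),
  compm g f = idm (F c) /\ compm f g = idm d.

Let lift (a b : C) (h : hom (F a) (F b)) : hom a b := sval (cid (F_full h)).

Let liftK (a b : C) (h : hom (F a) (F b)) : fmap F (lift h) = h.
Proof. exact: (svalP (cid (F_full h))). Qed.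

Let pre (d : D) : C := sval (cid (F_ess_surj d)).

Let counit_ex (d : D) : exists f : hom (F (pre d)) d, exists g : hom d (F (pre d)),
  compm g f = idm (F (pre d)) /\ compm f g = idm d.
Proof. exact: (svalP (cid (F_ess_surj d))). Qed.

Let counit (d : D) : hom (F (pre d)) d := sval (cid (counit_ex d)).
Let counitV_ex (d : D) := svalP (cid (counit_ex d)).
Let counitV (d : D) : hom d (F (pre d)) := sval (cid (counitV_ex d)).

Let counitK d : compm (counitV d) (counit d) = idm (F (pre d)).
Proof. exact: (svalP (cid (counitV_ex d))).1. Qed.

Let counitVK d : compm (counit d) (counitV d) = idm d.
Proof. exact: (svalP (cid (counitV_ex d))).2. Qed.

Let map (d e : D) (h : hom d e) : hom (pre d) (pre e) :=
  lift (compm (counitV e) (compm h (counit d))).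

Let map1 d : map (idm d) = idm (pre d).
Proof. by apply: F_faithful; rewrite liftK comp1m counitK fmap1. Qed.

Let mapM (a b c : D) (g : hom b c) (f : hom a b) :
  map (compm g f) = compm (map g) (map f).
Proof.
apply: F_faithful; rewrite fmapM !liftK -!compmA.
by rewrite (compmA _ (counitV b) (counit b)) counitVK comp1m.
Qed.

Theorem equivalence_criterion : equivalence_of_categories F.
Proof.
exists (@Functor D C pre map map1 mapM); split.
  exists (fun a => lift (counit (F a))); split=> [a b f|a].
    by apply: F_faithful; rewrite !fmapM !liftK !compmA counitVK comp1m.
  exists (lift (counitV (F a))).
  by split; apply: F_faithful; rewrite fmapM fmap1 !liftK ?counitK ?counitVK.
exists counit; split=> [a b f|a].
  by rewrite /= liftK compmA counitVK comp1m.
by exists (counitV a); split; [exact: counitK|exact: counitVK].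
Qed.
End EquivalenceCriterion.

(** * Normalization of generators, and the equivalences *)

Section EssentiallySurjective.
Context {R : realType} {B : separableBanach R}.
Context {d : measure_display} {X : measurableType d}.
Context {mu : {measure set X -> \bar R}} (m' : probability X R).
Hypotheses (mu_m' : mu `<< m') (m'_mu : m' `<< mu).

Theorem Gamma_essentially_surjective (M : prenormed_module mu) :
  universal_separable_Banach B ->
  is_normed_module m' M -> countably_generated m' M ->
  exists (E : Banach_bundle B X) (f : module_morphism (Gamma_obj mu E) M)
    (g : module_morphism M (Gamma_obj mu E)),
    comp_module_morphism g f = id_module_morphism (Gamma_obj mu E) /\
    comp_module_morphism f g = id_module_morphism M.
Proof.
move=> uB cM [C cC dC]; have [c Cc] := countable_enum 0 cC.
(* Dividing by [1 + |c n|] brings the norms below 1 without dividing by zero. This factor is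
   invertible in [L0 mu], so the generated submodule is the same. *)
have pos n x : 0 < 1 + `|pnorm (c n) x| by rewrite ltr_pwDl.
have mk n : measurable_fun setT (fun x => 1 + `|pnorm (c n) x|).
  apply: measurable_funD; first exact: measurable_cst.
  by apply: measurableT_comp; [exact: normr_measurable|exact: L0_measurable].
have mh n : measurable_fun setT (fun x => (1 + `|pnorm (c n) x|)^-1).
  have cV : continuous (fun t : R => (1 + `|t|)^-1).
    move=> t; apply: cvgV; first by rewrite gt_eqF// ltr_pwDl.
    by apply: cvgD; [exact: cvg_cst|exact: norm_continuous].
  exact: (measurableT_comp (continuous_measurable_fun cV) (L0_measurable _)).
pose k n := L0_of mu (mk n); pose h n := L0_of mu (mh n).
pose v n := h n *: c n.
have v1 n : {ae mu, forall x, pnorm (v n) x <= 1}.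
  apply: filterS2 (pnormZ_ae (h n) (c n)) (L0_of_ae mu (mh n)) => x -> ->.
  rewrite normfV (gtr0_norm (pos n x)) mulrC ler_pdivrMr// mul1r.
  by apply: le_trans (ler_norm _) _; rewrite lerDr.
have kv n : c n = k n *: v n.
  rewrite /v scalerA -[LHS]scale1r; congr (_ *: _); apply: L0_ext.
  have h1 := L0_mul_ae (k n) (h n); have h2 := L0_one_ae mu.
  have h3 := L0_of_ae mu (mk n); have h4 := L0_of_ae mu (mh n).
  apply: filterS2 (filterI h1 h2) (filterI h3 h4) => x [-> ->] [-> ->].
  by rewrite divff// gt_eqF.
have dv : dist_dense (@module_dist _ _ _ _ m' M)
    (smallest (@is_submodule _ _ _ _ M) (range v)).
  move=> w e e0; have [y Cy wy] := dC w e e0; exists y => // S [sS vS]; apply: Cy.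
  split=> // a /Cc[n _ <-]; rewrite kv -[_ *: _]addr0.
  by apply: sS.2; [apply: vS; exists n|exact: sS.1].
have [N [mN N0 HN]] := ae_regular_point v1.
have Nreg x : ~ N x -> regular_point v x.
  by move=> Nx; apply: contrapT => nr; apply: Nx; exact: HN.
have [E [f [g [gf fg]]]] :=
  representation_generators mu_m' m'_mu uB dv cM mN N0 Nreg.
by exists E, g, f.
Qed.

End EssentiallySurjective.

Theorem theorem4p15 (R : realType) (d : measure_display) (X : measurableType d)
    (mu : {measure set X -> \bar R}) (m' : probability X R)
    (B : separableBanach R) :
  (forall x : X, measurable [set x]) ->
  measure_is_complete mu ->
  sigma_finite setT mu ->
  mu `<< m' -> m' `<< mu ->
  universal_separable_Banach B ->
  (exists Gamma_cg : forall E : SBB B mu,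
      is_normed_module m' (Gamma mu E) /\ countably_generated m' (Gamma mu E),
    equivalence_of_categories
      (corestrict Gamma_cg : functor (SBB B mu) (NMod_cg mu m'))) /\
  (separable_measure_space mu ->
   exists Gamma_s : forall E : SBB B mu,
      is_normed_module m' (Gamma mu E) /\ separable_module m' (Gamma mu E),
    equivalence_of_categories
      (corestrict Gamma_s : functor (SBB B mu) (NMod_s mu m'))).
Proof.
move=> _ _ _ mu_m' m'_mu uB; split=> [|sep].
  have cg (E : SBB B mu) : is_normed_module m' (Gamma mu E) /\
      countably_generated m' (Gamma mu E).
    by split; [exact: Gamma_complete|exact: Gamma_countably_generated].
  exists cg; apply: equivalence_criterion.
  - exact: Gamma_faithful.
  - exact: Gamma_full.
  - move=> [M [cM cgM]].
    exact: (Gamma_essentially_surjective mu_m' m'_mu uB cM cgM).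
have cs (E : SBB B mu) : is_normed_module m' (Gamma mu E) /\
    separable_module m' (Gamma mu E).
  by split; [exact: Gamma_complete|exact: Gamma_separable].
exists cs; apply: equivalence_criterion.
- exact: Gamma_faithful.
- exact: Gamma_full.
(* A countable dense set generates, since it lies in the submodule it spans. *)
- move=> [M [cM [A cA dA]]].
  apply: (Gamma_essentially_surjective mu_m' m'_mu uB cM); exists A => // v e e0.
  by have [y Ay vy] := dA v e e0; exists y => // S [_]; exact.
Qed.
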